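(* Let $q$ be a squarefree positive integer, fix a sign, and let $\Phi_q$ be the characteristic function of forms not lying in $V_p$ for every prime $p\mid q$. With $b^{\pm}_q(\mu)$ defined from this $\Phi_q$ as in the context, for every $\epsilon>0$, uniformly in $q$ and $X>0$, \[ \sum_{\mu<X}|b_q^{\pm}(\mu)|\ll_\epsilon q^{2+\epsilon}X\quad\text{and}\quad \sum_{\mu<X}|b_q^{\pm}(\mu)|\ll_\epsilon q^{1+\epsilon}X+q^{-1+\epsilon}. \]
   Context: $V_{\mathbb{Z}}$ is the lattice of integral binary cubic forms $au^3+bu^2v+cuv^2+dv^3$, $\widehat V_{\mathbb{Z}}$ the sublattice with $b,c\in3\mathbb{Z}$, $\mathrm{Disc}(f)=b^2c^2-4ac^3-4b^3d-27a^2d^2+18abcd$, $\mathrm{SL}_2(\mathbb{Z})$ acts by $(\gamma f)(u,v)=f((u,v)\gamma)$ with stabilizer $\mathrm{Stab}(x)$. $U_p$ is the set of forms not divisible by $p$ with no $\mathrm{GL}_2(\mathbb{Z})$-transform having $u^3$-coefficient divisible by $p^2$ and $u^2v$-coefficient divisible by $p$ (i.e. the associated Delone–Faddeev cubic ring $R$ is maximal at $p$). $V_p\subset U_p$ is the set of forms in $U_p$ whose ring $R$ is not totally ramified at $p$ (i.e. $R\otimes\mathbb{Z}_p$ is not the ring of integers of a totally ramified cubic extension of $\mathbb{Q}_p$); membership depends only on the form modulo $p^2$. With $[x,y]=x_4y_1-\tfrac13x_3y_2+\tfrac13x_2y_3-x_1y_4$, set $\widehat\Phi_q(x)=q^{-8}\sum_{y\in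 V_{\mathbb{Z}/q^2\mathbb{Z}}}\Phi_q(y)e^{2\pi i[x,y]/q^2}$ for $x\in\widehat V_{\mathbb{Z}}$, and for $\mu\in q^{-8}\mathbb{Z}_{>0}$ let $b_q^{\pm}(\mu)=\sum\widehat\Phi_q(x)/|\mathrm{Stab}(x)|$ over $x\in\mathrm{SL}_2(\mathbb{Z})\backslash\widehat V_{\mathbb{Z}}$ with $\pm\mathrm{Disc}(x)>0$ and $|\mathrm{Disc}(x)|/q^8=\mu$. *)

(* Defs.v *)
From HB Require Import structures.
From mathcomp Require Import all_boot all_order all_algebra all_field.
From mathcomp Require Import ring.
From mathcomp Require Import fraction finmap complex.
From mathcomp Require Import all_classical all_reals all_analysis.

Set Implicit Arguments.
Unset Strict Implicit.
Unset Printing Implicit Defensive.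

Import Order.TTheory GRing.Theory Num.Theory.

Local Open Scope classical_set_scope.
Local Open Scope ring_scope.

(* CubicForm a b c d is the cubic form a u^3 + b u^2 v + c u v^2 + d v^3.       *)
Record cubic_form (A : Type) := CubicForm { ca : A; cb : A; cc : A; cd : A }.

HB.instance Definition _ (A : Type) := gen_eqMixin (cubic_form A).
HB.instance Definition _ (A : Type) := gen_choiceMixin (cubic_form A).

Definition map_form (A B : Type) (h : A -> B) (f : cubic_form A) : cubic_form B :=
  CubicForm (h (ca f)) (h (cb f)) (h (cc f)) (h (cd f)).

Definition feval (A : comNzRingType) (f : cubic_form A) (u v : A) : A :=
  ca f * u ^+ 3 + cb f * u ^+ 2 * v + cc f * u * v ^+ 2 + cd f * v ^+ 3.

Definition form_disc (A : comNzRingType) (f : cubic_form A) : A :=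
  let: CubicForm a b c d := f in
  b ^+ 2 * c ^+ 2 - 4%:R * a * c ^+ 3 - 4%:R * b ^+ 3 * d
  - 27%:R * a ^+ 2 * d ^+ 2 + 18%:R * a * b * c * d.

(* The coefficients of f((u, v) g); see feval_form_act.                       *)
Definition form_act (A : comNzRingType) (g : 'M[A]_2) (f : cubic_form A) :
    cubic_form A :=
  let: CubicForm a b c d := f in
  let k := g 0 0 in let l := g 0 1 in let m := g 1 0 in let n := g 1 1 in
  CubicForm (a * k ^+ 3 + b * k ^+ 2 * l + c * k * l ^+ 2 + d * l ^+ 3)
       (3%:R * a * k ^+ 2 * m + b * (k ^+ 2 * n + 2%:R * k * l * m)
        + c * (2%:R * k * l * n + l ^+ 2 * m) + 3%:R * d * l ^+ 2 * n)
       (3%:R * a * k * m ^+ 2 + b * (2%:R * k * m * n + l * m ^+ 2)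
        + c * (k * n ^+ 2 + 2%:R * l * m * n) + 3%:R * d * l * n ^+ 2)
       (a * m ^+ 3 + b * m ^+ 2 * n + c * m * n ^+ 2 + d * n ^+ 3).

Lemma feval_form_act (A : comNzRingType) (g : 'M[A]_2) (f : cubic_form A) (u v : A) :
  feval (form_act g f) u v =
  feval f (u * g 0 0 + v * g 1 0) (u * g 0 1 + v * g 1 1).
Proof. by case: f => a b c d; rewrite /feval /form_act /=; ring. Qed.

Definition SL2Z : set 'M[int]_2 := [set g | \det g = 1].

Definition sl2_orbit (x : cubic_form int) : set (cubic_form int) :=
  [set form_act g x | g in SL2Z].

Definition sl2_stab (x : cubic_form int) : set 'M[int]_2 :=
  [set g | SL2Z g /\ form_act g x = x].

Definition hatV : set (cubic_form int) :=
  [set x | (3 %| cb x)%Z /\ (3 %| cc x)%Z].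

(* GL_2(Z) acts here without the twist by the determinant; the twist only     *)
(* changes signs, which does not affect the divisibility conditions.          *)
Definition U_ (p : nat) : set (cubic_form int) :=
  [set f | ~ [/\ (p %| ca f)%Z, (p %| cb f)%Z, (p %| cc f)%Z & (p %| cd f)%Z]
         /\ ~ exists2 g : 'M[int]_2, g \in unitmx &
              ((p ^ 2)%N %| ca (form_act g f))%Z /\ (p %| cb (form_act g f))%Z].

(* The cubic A-algebra with basis 1, w, t attached to f by the Delone-Faddeev *)
(* correspondence; (x, y, z) stands for x + y w + z t, and                    *)
(*   w t = - a d,  w^2 = - a c - b w + a t,  t^2 = - b d - d w + c t.         *)
Definition DFring (A : comNzRingType) (f : cubic_form A) : Type := (A * A * A)%type.

HB.instance Definition _ (A : comNzRingType) (f : cubic_form A) :=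
  GRing.Zmodule.copy (DFring f) (A * A * A)%type.

Definition DFone (A : comNzRingType) (f : cubic_form A) : DFring f := (1, 0, 0).

Definition DFmul (A : comNzRingType) (f : cubic_form A) (r s : DFring f) :
    DFring f :=
  let: CubicForm a b c d := f in
  let: (x, y, z) := r in let: (x', y', z') := s in
  (x * x' - a * c * (y * y') - a * d * (y * z' + z * y') - b * d * (z * z'),
   x * y' + y * x' - b * (y * y') - d * (z * z'),
   x * z' + z * x' + a * (y * y') + c * (z * z')).

Lemma DFmulA (A : comNzRingType) (f : cubic_form A) : associative (@DFmul A f).
Proof.
case: f => a b c d [[x y] z] [[x' y'] z'] [[x'' y''] z''] /=.
by congr (_, _, _); ring.
Qed.

Lemma DFmulC (A : comNzRingType) (f : cubic_form A) : commutative (@DFmul A f).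
Proof.
by case: f => a b c d [[x y] z] [[x' y'] z'] /=; congr (_, _, _); ring.
Qed.

Lemma DFmul1 (A : comNzRingType) (f : cubic_form A) :
  left_id (DFone f) (@DFmul A f).
Proof. by case: f => a b c d [[x y] z] /=; congr (_, _, _); ring. Qed.

Lemma DFmulDl (A : comNzRingType) (f : cubic_form A) :
  left_distributive (@DFmul A f) +%R.
Proof.
case: f => a b c d [[x y] z] [[x' y'] z'] [[x'' y''] z''] /=.
by congr (_, _, _); rewrite /=; ring.
Qed.

Lemma DFone_neq0 (A : comNzRingType) (f : cubic_form A) : DFone f != 0.
Proof. by apply/eqP => -[/eqP]; rewrite oner_eq0. Qed.

HB.instance Definition _ (A : comNzRingType) (f : cubic_form A) :=
  GRing.Zmodule_isComNzRing.Build (DFring f)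
    (@DFmulA A f) (@DFmulC A f) (@DFmul1 A f) (@DFmulDl A f) (DFone_neq0 f).

(* Z_p as the inverse limit of the Z/p^n: coherent sequences of residues,     *)
(* normalized by 0 <= res n < p^n.                                            *)
Record padic_int (p : nat) (pr : prime p) := PadicInt {
  res : nat -> int;
  res_coh : forall n, res n = (res n.+1 %% (p ^ n)%N)%Z }.

Lemma padic_ext (p : nat) (pr : prime p) (x y : padic_int pr) :
  res x =1 res y -> x = y.
Proof.
case: x y => [x hx] [y hy] /= /funext exy; rewrite -exy in hy *.
by congr PadicInt; exact: Prop_irrelevance.
Qed.

HB.instance Definition _ (p : nat) (pr : prime p) :=
  gen_eqMixin (padic_int pr).
HB.instance Definition _ (p : nat) (pr : prime p) :=
  gen_choiceMixin (padic_int pr).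

Lemma modz_coh (p n : nat) (m : int) :
  ((m %% (p ^ n.+1)%N)%Z %% (p ^ n)%N)%Z = (m %% (p ^ n)%N)%Z.
Proof.
rewrite {2}(divz_eq m (p ^ n.+1)%N) expnS PoszM mulrA.
by rewrite modzMDl.
Qed.

Lemma res_mod (p : nat) (pr : prime p) (x : padic_int pr) n :
  (res x n %% (p ^ n)%N)%Z = res x n.
Proof. by rewrite res_coh modz_mod. Qed.

Lemma int_coh (p : nat) (m : int) n :
  (m %% (p ^ n)%N)%Z = ((m %% (p ^ n.+1)%N)%Z %% (p ^ n)%N)%Z.
Proof. by rewrite modz_coh. Qed.

Definition padic_of_int (p : nat) (pr : prime p) (m : int) : padic_int pr :=
  PadicInt pr (int_coh p m).

Lemma add_coh (p : nat) (pr : prime p) (x y : padic_int pr) n :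
  ((res x n + res y n)%R %% (p ^ n)%N)%Z =
  (((res x n.+1 + res y n.+1)%R %% (p ^ n.+1)%N)%Z %% (p ^ n)%N)%Z.
Proof. by rewrite modz_coh [res x n]res_coh [res y n]res_coh modzDm. Qed.

Definition padic_add (p : nat) (pr : prime p) (x y : padic_int pr) :=
  PadicInt pr (add_coh x y).

Lemma opp_coh (p : nat) (pr : prime p) (x : padic_int pr) n :
  ((- res x n)%R %% (p ^ n)%N)%Z =
  (((- res x n.+1)%R %% (p ^ n.+1)%N)%Z %% (p ^ n)%N)%Z.
Proof. by rewrite modz_coh [res x n]res_coh modzNm. Qed.

Definition padic_opp (p : nat) (pr : prime p) (x : padic_int pr) :=
  PadicInt pr (opp_coh x).

Lemma mul_coh (p : nat) (pr : prime p) (x y : padic_int pr) n :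
  ((res x n * res y n)%R %% (p ^ n)%N)%Z =
  (((res x n.+1 * res y n.+1)%R %% (p ^ n.+1)%N)%Z %% (p ^ n)%N)%Z.
Proof. by rewrite modz_coh [res x n]res_coh [res y n]res_coh modzMm. Qed.

Definition padic_mul (p : nat) (pr : prime p) (x y : padic_int pr) :=
  PadicInt pr (mul_coh x y).

Lemma padic_addA (p : nat) (pr : prime p) : associative (@padic_add p pr).
Proof. by move=> x y z; apply: padic_ext => n /=; rewrite modzDml modzDmr addrA. Qed.

Lemma padic_addC (p : nat) (pr : prime p) : commutative (@padic_add p pr).
Proof. by move=> x y; apply: padic_ext => n /=; rewrite addrC. Qed.

Lemma padic_add0 (p : nat) (pr : prime p) :
  left_id (padic_of_int pr 0) (@padic_add p pr).
Proof. by move=> x; apply: padic_ext => n /=; rewrite modzDml add0r res_mod. Qed.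

Lemma padic_addN (p : nat) (pr : prime p) :
  left_inverse (padic_of_int pr 0) (@padic_opp p pr) (@padic_add p pr).
Proof. by move=> x; apply: padic_ext => n /=; rewrite modzDml addNr. Qed.

HB.instance Definition _ (p : nat) (pr : prime p) :=
  GRing.isZmodule.Build (padic_int pr) (@padic_addA p pr) (@padic_addC p pr)
    (@padic_add0 p pr) (@padic_addN p pr).

Lemma padic_mulA (p : nat) (pr : prime p) : associative (@padic_mul p pr).
Proof. by move=> x y z; apply: padic_ext => n /=; rewrite modzMml modzMmr mulrA. Qed.

Lemma padic_mulC (p : nat) (pr : prime p) : commutative (@padic_mul p pr).
Proof. by move=> x y; apply: padic_ext => n /=; rewrite mulrC. Qed.

Lemma padic_mul1 (p : nat) (pr : prime p) :
  left_id (padic_of_int pr 1) (@padic_mul p pr).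
Proof. by move=> x; apply: padic_ext => n /=; rewrite modzMml mul1r res_mod. Qed.

Lemma padic_mulDl (p : nat) (pr : prime p) :
  left_distributive (@padic_mul p pr) (@padic_add p pr).
Proof.
move=> x y z; apply: padic_ext => n /=.
by rewrite modzMml modzDml modzDmr mulrDl.
Qed.

Lemma padic_1_neq0 (p : nat) (pr : prime p) :
  padic_of_int pr 1 != padic_of_int pr 0.
Proof.
apply/eqP => /(congr1 (fun x => res x 1)) /=.
by rewrite mod0z expn1 modz_small // ltz_nat prime_gt1.
Qed.

HB.instance Definition _ (p : nat) (pr : prime p) :=
  GRing.Zmodule_isComNzRing.Build (padic_int pr) (@padic_mulA p pr)
    (@padic_mulC p pr) (@padic_mul1 p pr) (@padic_mulDl p pr)
    (padic_1_neq0 pr).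

Definition padic_unit (p : nat) (pr : prime p) : {pred padic_int pr} :=
  [pred x | `[< exists y, y * x = 1 >]].

Definition padic_inv (p : nat) (pr : prime p) (x : padic_int pr) :=
  if pselect (exists y, y * x = 1) is left ex then projT1 (cid ex) else x.

Lemma padic_mulV (p : nat) (pr : prime p) :
  {in @padic_unit p pr, left_inverse 1 (@padic_inv p pr) *%R}.
Proof.
move=> x /asboolP Ux; rewrite /padic_inv; case: pselect => // ex.
by case: cid.
Qed.

Lemma padic_unitP (p : nat) (pr : prime p) (x y : padic_int pr) :
  y * x = 1 -> padic_unit x.
Proof. by move=> yx; apply/asboolP; exists y. Qed.

Lemma padic_inv_out (p : nat) (pr : prime p) :
  {in [predC @padic_unit p pr], @padic_inv p pr =1 id}.
Proof.
by move=> x /asboolP nUx; rewrite /padic_inv; case: pselect.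
Qed.

HB.instance Definition _ (p : nat) (pr : prime p) :=
  GRing.ComNzRing_hasMulInverse.Build (padic_int pr) (@padic_mulV p pr)
    (@padic_unitP p pr) (@padic_inv_out p pr).

Lemma res_mod_add (p : nat) (pr : prime p) (x : padic_int pr) n k :
  res x n = (res x (n + k)%N %% (p ^ n)%N)%Z.
Proof.
elim: k => [|k ->]; first by rewrite addn0 res_mod.
rewrite addnS [res x (n + k)%N]res_coh expnD PoszM.
rewrite {2}(divz_eq (res x (n + k).+1) (Posz (p ^ n) * Posz (p ^ k))).
by rewrite [Posz (p ^ n) * _]mulrC mulrA modzMDl.
Qed.

Lemma padic_idomain (p : nat) (pr : prime p) :
  GRing.integral_domain_axiom (padic_int pr).
Proof.
move=> x y xy0; apply/norP => -[x0 y0].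
have nz (z : padic_int pr) : z != 0 -> exists n, res z n != 0.
  move=> z0; apply: contrapT => h; case/eqP: z0; apply: padic_ext => n.
  rewrite /= mod0z; apply/eqP; apply: contrapT => /negP nz.
  by apply: h; exists n.
have [n xn] := nz _ x0; have [m ym] := nz _ y0.
have ndv (z : padic_int pr) a b : res z a != 0 ->
    ~~ (p ^ a %| absz (res z (a + b)%N))%N.
  by rewrite (res_mod_add z a b); apply: contra => dv; apply/eqP/dvdz_mod0P.
have xX := ndv x n m xn; have := ndv y m n ym; rewrite addnC => yY.
have nzX : (0 < absz (res x (n + m)%N))%N.
  by rewrite lt0n; apply: contraNneq xX => ->; rewrite dvdn0.
have nzY : (0 < absz (res y (n + m)%N))%N.
  by rewrite lt0n; apply: contraNneq yY => ->; rewrite dvdn0.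
move/(congr1 (fun z => res z (n + m)%N)): xy0 => /=; rewrite mod0z.
move/dvdz_mod0P; rewrite dvdzE abszM pfactor_dvdn ?muln_gt0 ?nzX //.
move: xX yY; rewrite !pfactor_dvdn // -!ltnNge lognM // => lx ly.
by rewrite leqNgt -addSn leq_add // ltnW.
Qed.

HB.instance Definition _ (p : nat) (pr : prime p) :=
  GRing.ComUnitRing_isIntegral.Build (padic_int pr) (@padic_idomain p pr).

Definition Qp (p : nat) (pr : prime p) : fieldType := {fraction padic_int pr}.

Definition integers (p : nat) (pr : prime p) (K : fieldExtType (Qp pr)) :
    set K :=
  [set x | integralOver (fun z : padic_int pr => (FracField.tofrac z)%:A : K) x].

Definition integer_units (p : nat) (pr : prime p) (K : fieldExtType (Qp pr)) :
    set K :=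
  [set x | [/\ x != 0, integers x & integers x^-1]].

Definition uniformizer (p : nat) (pr : prime p) (K : fieldExtType (Qp pr))
    (w : K) : Prop :=
  w != 0 /\ forall x, integers x -> (~ integer_units x <-> integers (x / w)).

(* The ramification index, i.e. the e such that p = (unit) * w ^ e for a      *)
(* uniformizer w, is equal to the degree.                                     *)
Definition totally_ramified (p : nat) (pr : prime p)
    (K : fieldExtType (Qp pr)) : Prop :=
  exists w : K, [/\ integers w, uniformizer w &
    integer_units (p%:R / w ^+ \dim {:K})].

(* The Delone-Faddeev ring of f over Z_p is R tensor Z_p, R being the one     *)
(* over Z.                                                                    *)
Definition totally_ramified_at (p : nat) (pr : prime p) (f : cubic_form int) :
    Prop :=
  exists K : fieldExtType (Qp pr),
    [/\ \dim {:K} = 3%N, totally_ramified K &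
        exists phi : {rmorphism DFring (map_form (padic_of_int pr) f) -> K},
          injective phi /\ range phi = @integers p pr K].

Definition V_ (p : nat) (pr : prime p) : set (cubic_form int) :=
  [set f | U_ p f /\ ~ totally_ramified_at pr f].

Definition Phi (R : realType) (q : nat) (f : cubic_form int) : R[i] :=
  (`[< forall (p : nat) (pr : prime p), (p %| q)%N -> ~ V_ pr f >])%:R.

Definition pairing (R : realType) (x y : cubic_form int) : R :=
  (cd x)%:~R * (ca y)%:~R - 3%:R^-1 * (cc x)%:~R * (cb y)%:~R
  + 3%:R^-1 * (cb x)%:~R * (cc y)%:~R - (ca x)%:~R * (cd y)%:~R.

Definition expi (R : realType) (t : R) : R[i] := Complex (cos t) (sin t).

(* Z/q^2 is represented by 0, ..., q^2 - 1.                                   *)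
Definition hatPhi (R : realType) (q : nat) (x : cubic_form int) : R[i] :=
  q%:R ^- 8 *
  \sum_(a < q ^ 2) \sum_(b < q ^ 2) \sum_(c < q ^ 2) \sum_(d < q ^ 2)
    let y := CubicForm (a : nat)%:Z (b : nat)%:Z (c : nat)%:Z (d : nat)%:Z in
    Phi R q y * expi (2%:R * pi * pairing R x y / q%:R ^+ 2).

(* The SL_2(Z)-orbits of the x in hatV with (-1)^s Disc(x) > 0 and            *)
(* |Disc(x)| / q^8 = mu.                                                      *)
Definition orbits (R : realType) (q : nat) (s : bool) (mu : R) :
    set (set (cubic_form int)) :=
  [set sl2_orbit x | x in [set x | [/\ hatV x, 0 < (-1) ^+ s * form_disc x &
                                      `|form_disc x|%:~R / q%:R ^+ 8 = mu]]].

(* The summand is constant on an orbit O, so it is evaluated at an arbitrary  *)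
(* element of O. Both the set of orbits and the stabilizers are finite, as    *)
(* only forms of a fixed nonzero discriminant occur.                          *)
Definition b_ (R : realType) (q : nat) (s : bool) (mu : R) : R[i] :=
  \sum_(O \in orbits q s mu)
    let x := xget (CubicForm 0 0 0 0) O in
    hatPhi R q x / #|` fset_set (sl2_stab x)|%fset%:R.

Definition sum_abs_b (R : realType) (q : nat) (s : bool) (X : R) : R :=
  \sum_(mu \in [set mu : R | (exists2 n : nat, (0 < n)%N &
                                mu = n%:R / q%:R ^+ 8) /\ mu < X])
    Normc.normc (b_ q s mu).

(* Main.v *)
(* Modulo p^2 the complement of V_p is a union, over the points r of P^1(F_p), of two
   congruence lattices: after moving r to (1 : 0), either p^2 | a and p | b (R is not
   maximal at p), or p | a, b, c; in the latter case, if R is maximal at p, the form is an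
   Eisenstein form and R is totally ramified. Conversely a uniformizer of a totally
   ramified R is nilpotent of order exactly 3 modulo p, which forces f to be a multiple of
   a cube modulo p. Inclusion-exclusion over these lattices turns the Fourier transform of
   the indicator of the complement into a combination of indicators of dual lattices with
   coefficients p^-3 and p^-4, so that the transform of Phi_q is bounded by a product of
   local weights.

   A form x in a dual lattice at p is either p y, or p x is the transform by diag(p, 1) of
   a form y whose discriminant is smaller by p^2 and such that p divides the Hessian
   or the discriminant of y. Removing the primes of q one by one leaves the problem of
   counting the classes of forms with |Disc| <= Y, Hessian divisible by m and discriminant
   divisible by n. Each class meets one of the boxes |a| << lam / t^3, |b| << lam / t,
   |c| << lam t, |d| << lam t^3 with t a power of 2 and lam = Y^(1/4), by reduction of the
   Hessian or of a definite quadratic factor. Counting coefficient by coefficient in the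
   boxes bounds the number of classes by Y / (m^2 n) + Y^(3/4) / m + Y^(1/2), up to a factor
   exponential in the number of primes of m n. *)
Require Import Defs.
From HB Require Import structures.
From mathcomp Require Import all_boot all_order all_algebra all_field.
From mathcomp Require Import ring lra zify.
From mathcomp Require Import generic_quotient fraction finmap complex.
From mathcomp Require Import all_classical all_reals all_analysis.

Set Implicit Arguments.
Unset Strict Implicit.
Unset Printing Implicit Defensive.

Import Order.TTheory GRing.Theory Num.Theory.
Local Open Scope ring_scope.

(** * Binary cubic forms *)

(** The exponents balance as follows. With Y = q^8 X, each prime must save p^7 in the main term. A
    form of type [isBd] has coefficient p^-3, loses p^2 in the discriminant and acquires a Hessian
    divisible by p, worth p^2; one of type [isTd] has coefficient p^-4, loses p^2 and acquires a
    discriminant divisible by p, worth p. Both products are p^-7, whence q X. As these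
    divisibilities pay only in the final count, the induction over the primes has to carry m and n
    along. The lower terms of the count are absorbed in two ways. Since m^2 <= Y, all terms are at
    most Y / m; this saves only p^6 and gives q^2 X. The inequality between arithmetic and geometric
    means gives instead Y / (m^2 n) + m^2 n^3, whose second term costs p^2 against p^-3 or p^3
    against p^-4, whence q^-1. A constant factor per prime is harmless, being absorbed in q^eps; so
    the primes 2 and 3 can have the trivial weight 1, and for p >= 5 the factors 3, 4, 9, 27 in the
    Hessian and the discriminant are units modulo p. *)

Definition mx22 (A : Type) (k l m n : A) : 'M[A]_2 :=
  \matrix_(i, j) if i == 0 then (if j == 0 then k else l)
                 else (if j == 0 then m else n).

Definition fscale (A : comNzRingType) (k : A) (f : cubic_form A) :=
  map_form (fun x => k * x) f.

Lemma mulmx22E (A : comNzRingType) (g h : 'M[A]_2) i j :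
  (g *m h) i j = g i 0 * h 0 j + g i 1 * h 1 j.
Proof. by rewrite mxE big_ord_recl big_ord1; congr (_ + _ * _); congr (_ _ _); apply/val_inj. Qed.

Lemma det22 (A : comNzRingType) (g : 'M[A]_2) :
  \det g = g 0 0 * g 1 1 - g 0 1 * g 1 0.
Proof.
rewrite (expand_det_row _ 0) big_ord_recl big_ord1 /cofactor !det_mx11 !mxE /=.
rewrite addn0 expr0 mul1r expr1 mulN1r mulrN.
by congr (_ * _ - _ * _); congr (g _ _); apply/val_inj.
Qed.

Lemma mx22E (A : Type) (k l m n : A) :
  ((mx22 k l m n 0 0 = k) * (mx22 k l m n 0 1 = l) *
   (mx22 k l m n 1 0 = m) * (mx22 k l m n 1 1 = n))%type.
Proof. by rewrite /mx22 !mxE. Qed.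

Lemma mx22_eqP (A : Type) (g h : 'M[A]_2) : g 0 0 = h 0 0 -> g 0 1 = h 0 1 ->
  g 1 0 = h 1 0 -> g 1 1 = h 1 1 -> g = h.
Proof.
move=> e1 e2 e3 e4; apply/matrixP.
have two (i : 'I_2) : i = 0 \/ i = 1.
  by case: i => [[|[|//]] ?]; [left|right]; apply/val_inj.
by move=> i j; case: (two i) => ->; case: (two j) => ->.
Qed.

Lemma form_actM (A : comNzRingType) (g h : 'M[A]_2) f :
  form_act (g *m h) f = form_act g (form_act h f).
Proof.
case: f => a b c d; rewrite /form_act !mulmx22E.
by congr CubicForm; ring.
Qed.

Lemma form_act1 (A : comNzRingType) (f : cubic_form A) : form_act 1%:M f = f.
Proof.
by case: f => a b c d; rewrite /form_act !mxE /=; congr CubicForm; ring.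
Qed.

Definition adj22 (A : comNzRingType) (g : 'M[A]_2) : 'M[A]_2 :=
  mx22 (g 1 1) (- g 0 1) (- g 1 0) (g 0 0).

(** The product of a matrix and its adjugate is the scalar det, and a scalar acts on a cubic by its
    cube. The adjugate thus inverts the action over any ring, up to a factor prime to p if the
    determinant is. *)
Lemma form_act_adj (A : comNzRingType) (g : 'M[A]_2) f :
  form_act (adj22 g) (form_act g f) = fscale (\det g ^+ 3) f.
Proof.
rewrite det22 -form_actM; case: f => a b c d.
rewrite /form_act /fscale /map_form !mulmx22E /adj22 !mx22E /=.
by congr CubicForm; ring.
Qed.

Lemma det_adj22 (A : comNzRingType) (g : 'M[A]_2) : \det (adj22 g) = \det g.
Proof. by rewrite !det22 /adj22 !mx22E; ring. Qed.

Lemma fscale1 (A : comNzRingType) (f : cubic_form A) : fscale 1 f = f.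
Proof. by case: f => a b c d; rewrite /fscale /map_form /= !mul1r. Qed.

Lemma form_act_adj1 (A : comNzRingType) (g : 'M[A]_2) f : \det g = 1 ->
  form_act (adj22 g) (form_act g f) = f.
Proof. by move=> e; rewrite form_act_adj e expr1n fscale1. Qed.

Lemma form_act_scale (A : comNzRingType) (g : 'M[A]_2) k f :
  form_act g (fscale k f) = fscale k (form_act g f).
Proof.
case: f => a b c d; rewrite /form_act /fscale /map_form /=.
by congr CubicForm; ring.
Qed.

Lemma form_disc_act (A : comNzRingType) (g : 'M[A]_2) f :
  form_disc (form_act g f) = \det g ^+ 6 * form_disc f.
Proof. by case: f => a b c d; rewrite /form_disc /form_act det22; ring. Qed.

Lemma form_disc_scale (A : comNzRingType) k (f : cubic_form A) :
  form_disc (fscale k f) = k ^+ 4 * form_disc f.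
Proof. by case: f => a b c d; rewrite /form_disc /fscale /map_form /=; ring. Qed.

(** * The Hessian covariant *)

Definition hessA (A : comNzRingType) (f : cubic_form A) :=
  cb f ^+ 2 - 3%:R * ca f * cc f.

Definition hessB (A : comNzRingType) (f : cubic_form A) :=
  cb f * cc f - 9%:R * ca f * cd f.

Definition hessC (A : comNzRingType) (f : cubic_form A) :=
  cc f ^+ 2 - 3%:R * cb f * cd f.

Lemma hessA_act (A : comNzRingType) (g : 'M[A]_2) f :
  hessA (form_act g f) = \det g ^+ 2 *
    (hessA f * g 0 0 ^+ 2 + hessB f * g 0 0 * g 0 1 + hessC f * g 0 1 ^+ 2).
Proof.
by case: f => a b c d; rewrite /hessA /hessB /hessC /form_act det22 /=; ring.
Qed.

Lemma hessB_act (A : comNzRingType) (g : 'M[A]_2) f :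
  hessB (form_act g f) = \det g ^+ 2 *
    (2%:R * hessA f * g 0 0 * g 1 0 + hessB f * (g 0 0 * g 1 1 + g 0 1 * g 1 0)
     + 2%:R * hessC f * g 0 1 * g 1 1).
Proof.
by case: f => a b c d; rewrite /hessA /hessB /hessC /form_act det22 /=; ring.
Qed.

Lemma hessC_act (A : comNzRingType) (g : 'M[A]_2) f :
  hessC (form_act g f) = \det g ^+ 2 *
    (hessA f * g 1 0 ^+ 2 + hessB f * g 1 0 * g 1 1 + hessC f * g 1 1 ^+ 2).
Proof.
by case: f => a b c d; rewrite /hessA /hessB /hessC /form_act det22 /=; ring.
Qed.

(** The discriminant of the Hessian is -3 times that of the cubic. So the Hessian is definite when
    the discriminant is positive, and a Hessian divisible by m makes 3 Disc divisible by m^2. *)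
Lemma hess_disc (A : comNzRingType) (f : cubic_form A) :
  4%:R * hessA f * hessC f - hessB f ^+ 2 = 3%:R * form_disc f.
Proof.
by case: f => a b c d; rewrite /hessA /hessB /hessC /form_disc /=; ring.
Qed.

Definition pdiv_form (p : int) (f : cubic_form int) : bool :=
  [&& (p %| ca f)%Z, (p %| cb f)%Z, (p %| cc f)%Z & (p %| cd f)%Z].

Lemma pdiv_formP (p : int) f : reflect (exists h, f = fscale p h) (pdiv_form p f).
Proof.
apply: (iffP and4P) => [[]|[h ->]]; last by rewrite /fscale /map_form /= !dvdz_mulr.
case: f => a b c d /= /dvdzP[a' ->] /dvdzP[b' ->] /dvdzP[c' ->] /dvdzP[d' ->].
by exists (CubicForm a' b' c' d'); rewrite /fscale /map_form /= ![p * _]mulrC.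
Qed.

Lemma pdiv_form_act (p : int) g f : pdiv_form p f -> pdiv_form p (form_act g f).
Proof.
by move/pdiv_formP => [h ->]; apply/pdiv_formP; exists (form_act g h); rewrite form_act_scale.
Qed.

Lemma pdiv_form_scale_coprime (m k : int) f : coprimez m k ->
  pdiv_form m (fscale k f) -> pdiv_form m f.
Proof.
by move=> c; rewrite /pdiv_form /fscale /map_form /= !(Gauss_dvdzr _ c).
Qed.

Lemma pdiv_form_actK (m : int) g f : coprimez m (\det g) ->
  pdiv_form m (form_act g f) = pdiv_form m f.
Proof.
move=> c; apply/idP/idP; last exact: pdiv_form_act.
move/(pdiv_form_act (adj22 g)); rewrite form_act_adj.
by apply: pdiv_form_scale_coprime; rewrite coprimezXr.
Qed.

(* Invariance under the stabilizer of the point (1 : 0) of P^1(F_p): such a condition can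
   be tested on the representatives [proj_mx] only. *)
Definition lower_stable (p : nat) (P : pred (cubic_form int)) : Prop :=
  (forall (h : 'M[int]_2) f, (p %| (h 0 1)%R)%Z -> P f -> P (form_act h f)) /\
  (forall k f, ~~ (p %| k)%Z -> P (fscale k f) -> P f).

(* The first rows (1, 0) and (j, 1) of these matrices run over P^1(F_p). *)
Definition proj_mx (p : nat) (r : option 'I_p) : 'M[int]_2 :=
  if r is Some j then mx22 (j : nat)%:Z 1 (-1) 0 else 1%:M.

Lemma det_proj_mx p (r : option 'I_p) : \det (proj_mx r) = 1.
Proof. by case: r => [j|] /=; rewrite ?det1 // det22 !mx22E; ring. Qed.

Lemma coprimez_prime (p : nat) (k : int) : prime p ->
  coprimez p k = ~~ (p %| k)%Z.
Proof. by move=> pr; rewrite coprimezE prime_coprime. Qed.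

Lemma dvdzM_prime (p : nat) (x y : int) : prime p ->
  (p %| x * y)%Z = (p %| x)%Z || (p %| y)%Z.
Proof. by move=> pr; rewrite !dvdzE abszM Euclid_dvdM. Qed.

Lemma dvdzX_prime (p : nat) (x : int) n : prime p -> (0 < n)%N ->
  (p %| x ^+ n)%Z = (p %| x)%Z.
Proof. by move=> pr n0; rewrite !dvdzE abszX Euclid_dvdX // n0 andbT. Qed.

(** [r] is the point (k : l) of P^1(F_p): [None] if p divides l, and otherwise the residue of k / l,
    an inverse [v] of l coming from Bezout. *)
Lemma exists_proj_row (p : nat) (k l : int) : prime p ->
  exists r : option 'I_p, (p %| (proj_mx r 0 1 * k - proj_mx r 0 0 * l)%R)%Z.
Proof.
move=> pr; have [dl|ndl] := boolP (p %| l)%Z.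
  by exists None; rewrite /= !mxE /= mul0r sub0r mul1r rpredN.
have [u [v]] := Bezoutz p l.
move: ndl; rewrite -coprimez_prime // /coprimez => /eqP -> e.
have p0 : (0 < p)%N by apply: prime_gt0.
have jl : (absz ((v * k) %% p)%Z < p)%N.
  by have := ltz_pmod (v * k) (d := p); have := modz_ge0 (v * k) (d := p); lia.
exists (Some (Ordinal jl)); rewrite /= !mx22E mul1r.
have -> : Posz (absz ((v * k) %% p)%Z) = ((v * k) %% p)%Z.
  by rewrite gez0_abs // modz_ge0 //; lia.
have -> : ((v * k) %% p)%Z = v * k - ((v * k) %/ p)%Z * p by rewrite {2}(divz_eq (v * k) p); ring.
set q := (_ %/ _)%Z.
apply/dvdzP; exists (k * u + q * l).
have -> : k = k * (u * p + v * l) by rewrite e mulr1.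
rewrite e mulr1; have -> : k * u = k * (u * p + v * l) * u by rewrite e mulr1.
have e' : v * l = 1 - u * p by rewrite -e; ring.
have -> : (v * k - q * p) * l = (v * l) * k - q * p * l by ring.
by rewrite e'; ring.
Qed.

(** Only the first row of g modulo p matters, up to a scalar. If [r] is the point of that row,
    [proj_mx r *m adj22 g] has upper right entry divisible by p, and it takes [form_act g f] to a
    multiple of [form_act (proj_mx r) f] by a unit modulo p. *)
Lemma lower_stable_lift (p : nat) P (g : 'M[int]_2) f : prime p ->
  lower_stable p P -> ~~ (p %| \det g)%Z -> P (form_act g f) ->
  exists r : option 'I_p, P (form_act (proj_mx r) f).
Proof.
move=> pr [Pl Pk] ndet Pg.
have [r hr] := exists_proj_row (g 0 0) (g 0 1) pr; exists r.
apply: (Pk (\det g ^+ 3)); first by rewrite dvdzX_prime.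
rewrite -form_act_scale -form_act_adj -form_actM.
apply: Pl => //; rewrite mulmx22E /adj22 !mx22E.
by move: hr; rewrite mulrN addrC.
Qed.

(* Conditions at the point (1 : 0) of P^1(F_p): [isB] says that the ring is visibly not
   maximal, [isE] that the form has a triple root modulo p; [isBd], [isEd] and [isTd] cut
   out the lattices dual to [isB], [isE] and to their intersection. *)
Definition isB (p : nat) (f : cubic_form int) : bool :=
  ((p ^ 2)%N %| ca f)%Z && (p %| cb f)%Z.

Definition isE (p : nat) (f : cubic_form int) : bool :=
  [&& (p %| ca f)%Z, (p %| cb f)%Z & (p %| cc f)%Z].

Definition isBd (p : nat) (f : cubic_form int) : bool :=
  [&& ((p ^ 2)%N %| ca f)%Z, ((p ^ 2)%N %| cb f)%Z & (p %| cc f)%Z].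

Definition isTd (p : nat) (f : cubic_form int) : bool :=
  [&& ((p ^ 2)%N %| ca f)%Z, (p %| cb f)%Z & (p %| cc f)%Z].

Definition isEd (p : nat) (f : cubic_form int) : bool :=
  [&& ((p ^ 2)%N %| ca f)%Z, (p %| cb f)%Z, (p %| cc f)%Z & (p %| cd f)%Z].

Lemma dvdz_sq_coprime (p : nat) (k x : int) : prime p -> ~~ (p %| k)%Z ->
  ((p ^ 2)%N %| k * x)%Z = ((p ^ 2)%N %| x)%Z.
Proof.
move=> pr nk; apply: Gauss_dvdzr.
by rewrite coprimezE /= coprimeXl // prime_coprime.
Qed.

Lemma dvdz_coprime (p : nat) (k x : int) : prime p -> ~~ (p %| k)%Z ->
  (p %| k * x)%Z = (p %| x)%Z.
Proof. by move=> pr nk; apply: Gauss_dvdzr; rewrite coprimezE prime_coprime. Qed.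

Lemma PoszX2 (p : nat) : Posz (p ^ 2)%N = p%:Z * p%:Z.
Proof. by rewrite -PoszM mulnn. Qed.

Lemma isB_stable p : prime p -> lower_stable p (isB p).
Proof.
move=> pr; split=> [h [a b c d]|k [a b c d] nk]; rewrite /isB /fscale /=; last first.
  by rewrite dvdz_sq_coprime // dvdz_coprime.
set k := h 0 0; set l := h 0 1; set m := h 1 0; set n := h 1 1.
rewrite PoszX2 => /dvdzP[l' ->] /andP[/dvdzP[a' ->] /dvdzP[b' ->]].
apply/andP; split; apply/dvdzP.
  by exists (a' * k ^+ 3 + b' * k ^+ 2 * l' + c * k * l' ^+ 2 + d * p%:Z * l' ^+ 3); ring.
by eexists (3%:R * (a' * p%:Z) * k ^+ 2 * m + b' * (k ^+ 2 * n + 2%:R * k * (l' * p%:Z) * m)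
        + c * (2%:R * k * l' * n + l' * (l' * p%:Z) * m) + 3%:R * d * l' * (l' * p%:Z) * n); ring.
Qed.

Lemma isE_stable p : prime p -> lower_stable p (isE p).
Proof.
move=> pr; split=> [h [a b c d]|k [a b c d] nk]; rewrite /isE /fscale /=; last first.
  by rewrite !dvdz_coprime.
set k := h 0 0; set l := h 0 1; set m := h 1 0; set n := h 1 1.
move=> /dvdzP[l' ->] /and3P[/dvdzP[a' ->] /dvdzP[b' ->] /dvdzP[c' ->]].
apply/and3P; split; apply/dvdzP.
- by exists (a' * k ^+ 3 + b' * k ^+ 2 * l' * p%:Z + c' * p%:Z * k * l' * (l' * p%:Z) + d * p%:Z ^+ 2 * l' ^+ 3); ring.
- exists (3%:R * a' * k ^+ 2 * m + b' * (k ^+ 2 * n + 2%:R * k * (l' * p%:Z) * m)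
        + c' * (2%:R * k * l' * p%:Z * n + p%:Z * l' * (l' * p%:Z) * m) + 3%:R * d * l' * p%:Z * l' * n); ring.
- exists (3%:R * a' * k * m ^+ 2 + b' * (2%:R * k * m * n + l' * p%:Z * m ^+ 2)
        + c' * (k * n ^+ 2 + 2%:R * l' * p%:Z * m * n) + 3%:R * d * l' * n ^+ 2); ring.
Qed.

Lemma isBd_stable p : prime p -> lower_stable p (isBd p).
Proof.
move=> pr; split=> [h [a b c d]|k [a b c d] nk]; rewrite /isBd /fscale /=; last first.
  by rewrite !dvdz_sq_coprime // dvdz_coprime.
set k := h 0 0; set l := h 0 1; set m := h 1 0; set n := h 1 1.
rewrite PoszX2 => /dvdzP[l' ->] /and3P[/dvdzP[a' ->] /dvdzP[b' ->] /dvdzP[c' ->]].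
apply/and3P; split; apply/dvdzP.
- by exists (a' * k ^+ 3 + b' * k ^+ 2 * l' * p%:Z + c' * p%:Z * k * l' ^+ 2 + d * p%:Z * l' ^+ 3); ring.
- exists (3%:R * a' * k ^+ 2 * m + b' * (k ^+ 2 * n + 2%:R * k * (l' * p%:Z) * m)
        + c' * (2%:R * k * l' * n + l' * (l' * p%:Z) * m) + 3%:R * d * l' * l' * n); ring.
- exists (3%:R * (a' * p%:Z) * k * m ^+ 2 + b' * p%:Z * (2%:R * k * m * n + l' * p%:Z * m ^+ 2)
        + c' * (k * n ^+ 2 + 2%:R * l' * p%:Z * m * n) + 3%:R * d * l' * n ^+ 2); ring.
Qed.

Lemma isTd_stable p : prime p -> lower_stable p (isTd p).
Proof.
move=> pr; split=> [h [a b c d]|k [a b c d] nk]; rewrite /isTd /fscale /=; last first.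
  by rewrite dvdz_sq_coprime // !dvdz_coprime.
set k := h 0 0; set l := h 0 1; set m := h 1 0; set n := h 1 1.
rewrite PoszX2 => /dvdzP[l' ->] /and3P[/dvdzP[a' ->] /dvdzP[b' ->] /dvdzP[c' ->]].
apply/and3P; split; apply/dvdzP.
- by exists (a' * k ^+ 3 + b' * k ^+ 2 * l' + c' * p%:Z * k * l' ^+ 2 + d * p%:Z * l' ^+ 3); ring.
- exists (3%:R * a' * p%:Z * k ^+ 2 * m + b' * (k ^+ 2 * n + 2%:R * k * (l' * p%:Z) * m)
        + c' * (2%:R * k * l' * p%:Z * n + p%:Z * l' * (l' * p%:Z) * m) + 3%:R * d * l' * p%:Z * l' * n); ring.
- exists (3%:R * (a' * p%:Z) * k * m ^+ 2 + b' * (2%:R * k * m * n + l' * p%:Z * m ^+ 2)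
        + c' * (k * n ^+ 2 + 2%:R * l' * p%:Z * m * n) + 3%:R * d * l' * n ^+ 2); ring.
Qed.

(** When p divides a and b, the form is v^2 (c u + d v) modulo p, with a double root at (1 : 0). The
    entry [g 0 1] being prime to p, the second hypothesis gives a double root at another point, and
    a nonzero cubic cannot have two. *)
Lemma double_root_uniq (p : nat) (g : 'M[int]_2) f : prime p ->
  ~~ (p %| \det g)%Z -> ~~ (p %| (g 0 1)%R)%Z ->
  (p %| ca f)%Z -> (p %| cb f)%Z ->
  (p %| ca (form_act g f))%Z -> (p %| cb (form_act g f))%Z -> pdiv_form p f.
Proof.
move=> pr; case: f => a b c d; rewrite det22 /pdiv_form /form_act /=.
set k := g 0 0; set l := g 0 1; set m := g 1 0; set n := g 1 1.
move=> ndet nl /dvdzP[a' ->] /dvdzP[b' ->] da db.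
have e1 : (p %| c * k + d * l)%Z.
  rewrite -(@dvdz_coprime p (l ^+ 2)) ?dvdzX_prime //.
  move: da; rewrite -!addrA [X in (_ %| X)%Z](_ : _ = p%:Z * (a' * k ^+ 3 + b' * k ^+ 2 * l) + l ^+ 2 * (c * k + d * l)); last by ring.
  by rewrite rpredDl // dvdz_mulr.
have dc : (p %| c)%Z.
  have : (p %| - (l * (k * n - l * m)) * c)%Z.
    have -> : - (l * (k * n - l * m)) * c =
      (3%:R * (a' * p%:Z) * k ^+ 2 * m + b' * p%:Z * (k ^+ 2 * n + 2%:R * k * l * m)
        + c * (2%:R * k * l * n + l ^+ 2 * m) + 3%:R * d * l ^+ 2 * n)
      - p%:Z * (3%:R * a' * k ^+ 2 * m + b' * (k ^+ 2 * n + 2%:R * k * l * m))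
      - 3%:R * l * n * (c * k + d * l) by ring.
    by rewrite rpredB ?dvdz_mull // rpredB ?dvdz_mulr.
  by rewrite dvdz_coprime // rpredN dvdzM_prime // negb_or nl.
rewrite !dvdz_mull //= dc /= -(@dvdz_coprime p l) //.
by rewrite mulrC; move: e1; rewrite rpredDl // dvdz_mulr.
Qed.

(** * Reduction *)

Definition qval (R : comNzRingType) (P Q S k l : R) : R :=
  P * k ^+ 2 + Q * k * l + S * l ^+ 2.

Definition qpol (R : comNzRingType) (P Q S k l m n : R) : R :=
  2%:R * P * k * m + Q * (k * n + l * m) + 2%:R * S * l * n.

(** The difference of the two sides is a sum of two squares. This coercivity confines the search for
    a minimum to finitely many integer vectors. *)
Lemma qval_lower (R : realType) (P Q S k l : R) : 0 < P -> Q ^+ 2 < 4%:R * P * S ->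
  (4%:R * P * S - Q ^+ 2) * (k ^+ 2 + l ^+ 2) <= 4%:R * (P + S) * qval P Q S k l.
Proof.
move=> P0 D; have S0 : 0 < S.
  have : 0 < P * S by have := sqr_ge0 Q; nra.
  by rewrite pmulr_rgt0.
rewrite -subr_ge0.
have -> : 4%:R * (P + S) * qval P Q S k l - (4%:R * P * S - Q ^+ 2) * (k ^+ 2 + l ^+ 2) =
  (2%:R * P * k + Q * l) ^+ 2 + (2%:R * S * l + Q * k) ^+ 2 by rewrite /qval; ring.
by rewrite addr_ge0 ?sqr_ge0.
Qed.

Lemma exists_min_primitive (R : realType) (P Q S : R) : 0 < P -> Q ^+ 2 < 4%:R * P * S ->
  exists k l : int, coprimez k l /\
   forall k' l' : int, coprimez k' l' ->
     qval P Q S k%:~R l%:~R <= qval P Q S k'%:~R l'%:~R.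
Proof.
move=> P0 D; have S0 : 0 < S.
  have : 0 < P * S by have := sqr_ge0 Q; nra.
  by rewrite pmulr_rgt0.
set De := 4%:R * P * S - Q ^+ 2; have De0 : 0 < De by rewrite subr_gt0.
(* Outside the square of half-side [N] the form is at least P, its value at (1, 0), by
   [qval_lower]. *)
have [N hN] : exists N : nat, 4%:R * (P + S) * P <= De * N%:R.
  exists (Num.Def.archi_bound (4%:R * (P + S) * P / De)).
  rewrite [De * _]mulrC -ler_pdivrMr // ltW // archi_boundP //.
  by rewrite divr_ge0 ?ltW // !mulr_gt0 // addr_gt0.
pose F (x : 'I_(N.*2.+1) * 'I_(N.*2.+1)) : R :=
  qval P Q S ((x.1 : nat)%:Z - N%:Z)%:~R ((x.2 : nat)%:Z - N%:Z)%:~R.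
pose c (x : 'I_(N.*2.+1) * 'I_(N.*2.+1)) :=
  coprimez ((x.1 : nat)%:Z - N%:Z) ((x.2 : nat)%:Z - N%:Z).
have [N0|N0] := posnP N.
  exfalso; move: hN; rewrite N0 mulr0; apply/negP; rewrite -ltNge.
  by rewrite !mulr_gt0 // addr_gt0.
(* Coordinates are shifted by [N]: this is the vector (1, 0). *)
pose x0 : 'I_(N.*2.+1) * 'I_(N.*2.+1) := (inord N.+1, inord N).
have cx0 : c x0.
  by rewrite /c /x0 /= !inordK ?subrr; try lia; rewrite -addn1 PoszD [_ + 1]addrC addrK.
have Fx0 : F x0 = P.
  rewrite /F /x0 /= !inordK ?subrr; try lia.
  by rewrite -addn1 PoszD [_ + 1]addrC addrK /qval; ring.
have [i ci mi] := @real_arg_minP R _ x0 c F cx0 (fun i _ => num_real _).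
exists ((i.1 : nat)%:Z - N%:Z), ((i.2 : nat)%:Z - N%:Z); split=> // k' l' ck.
have [/andP[h1 h2]|] := boolP ((absz k' <= N)%N && (absz l' <= N)%N).
  pose y : 'I_(N.*2.+1) * 'I_(N.*2.+1) := (inord (absz (k' + N%:Z)), inord (absz (l' + N%:Z))).
  have e1 : (y.1 : nat)%:Z - N%:Z = k' by rewrite /y /= inordK; lia.
  have e2 : (y.2 : nat)%:Z - N%:Z = l' by rewrite /y /= inordK; lia.
  by have := mi y; rewrite /c /F e1 e2; apply.
move=> big; apply: le_trans (mi _ cx0) _; rewrite Fx0.
have := @qval_lower R P Q S k'%:~R l'%:~R P0 D; rewrite -/De => low.
have : N%:R <= (k'%:~R ^+ 2 + l'%:~R ^+ 2 : R).
  rewrite -!rmorphXn -rmorphD -[N%:R]/(N%:Z%:~R) ler_int /=.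
  by move: big; rewrite negb_and -!ltnNge => /orP[] h; nia.
move=> h; rewrite -(ler_pM2l (_ : 0 < 4%:R * (P + S))); last by rewrite mulr_gt0 // addr_gt0.
apply: le_trans hN _; apply: le_trans low; by rewrite ler_pM2l.
Qed.

(** A minimal primitive vector is completed to a basis by Bezout. Adding a multiple of it to the
    second vector makes the polar term small, and the second vector stays primitive, so its value is
    not below the minimum. *)
Lemma quad_reduce (R : realType) (P Q S : R) : 0 < P -> Q ^+ 2 < 4%:R * P * S ->
  exists2 g : 'M[int]_2, \det g = 1 &
    let k := (g 0 0)%:~R in let l := (g 0 1)%:~R in
    let m := (g 1 0)%:~R in let n := (g 1 1)%:~R in
    `|qpol P Q S k l m n| <= qval P Q S k l <= qval P Q S m n.
Proof.
move=> P0 D; have [k [l [ckl mn]]] := exists_min_primitive P0 D.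
have [u [v e]] := Bezoutz k l; move: (ckl); rewrite /coprimez => /eqP ge.
rewrite ge in e.
set P' := qval P Q S k%:~R l%:~R in mn.
have P'0 : 0 < P'.
  have S0 : 0 < S.
    have : 0 < P * S by have := sqr_ge0 Q; nra.
    by rewrite pmulr_rgt0.
  have := @qval_lower R P Q S k%:~R l%:~R P0 D; rewrite -/P' => low.
  have h : 0 < k%:~R ^+ 2 + l%:~R ^+ 2 :> R.
    rewrite -!rmorphXn -rmorphD ltr0z /=.
    have : (k != 0) || (l != 0).
      apply: contraT; rewrite negb_or !negbK => /andP[/eqP k0 /eqP l0].
      by move: e; rewrite k0 l0 !mulr0.
    by have := sqr_ge0 k; have := sqr_ge0 l; have := sqrf_eq0 k; have := sqrf_eq0 l; lia.
  have h2 : 0 < 4%:R * (P + S) by rewrite mulr_gt0 // addr_gt0.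
  rewrite -(pmulr_rgt0 _ h2); apply: lt_le_trans low.
  by rewrite mulr_gt0 // subr_gt0.
pose Q0 := qpol P Q S k%:~R l%:~R (- v%:~R) u%:~R.
(* Minus the integer nearest to Q0 / (2 P'), so that the new polar term Q0 + 2 j P' is at most P' in
   absolute value. *)
pose j : int := - Num.floor (Q0 / (2%:R * P') + 2%:R^-1).
pose g : 'M[int]_2 := mx22 k l (- v + j * k) (u + j * l).
have dg : \det g = 1 by rewrite det22 /g !mx22E -e; ring.
exists g => //; rewrite /g !mx22E /= -/P'; apply/andP; split; last first.
  apply: mn; apply/coprimezP; exists (- l, k) => /=.
  by rewrite -e; ring.
have -> : qpol P Q S k%:~R l%:~R (- v + j * k)%:~R (u + j * l)%:~R =
   Q0 + 2%:R * j%:~R * P'.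
  by rewrite /Q0 /P' /qpol /qval; ring.
have := floor_itv (Q0 / (2%:R * P') + 2%:R^-1).
rewrite /j rmorphN; set z := Num.floor _.
rewrite intrD /= => /andP[z1 z2].
set w : R := z%:~R; rewrite -/w in z1 z2.
have eq : Q0 / (2%:R * P') * (2%:R * P') = Q0 by rewrite divfK // gt_eqF // mulr_gt0.
set y := Q0 / (2%:R * P') in z1 z2 eq *.
by rewrite -eq ler_norml; apply/andP; split; nra.
Qed.

Lemma cubic_real_root (R : realType) (a b c d : R) : a != 0 ->
  exists t, a * t ^+ 3 + b * t ^+ 2 + c * t + d = 0.
Proof.
move=> a0; wlog ap : a b c d a0 / 0 < a.
  move=> H; case: (ltgtP 0 a) => [ap|an|e0]; last by rewrite -e0 eqxx in a0.
    exact: H.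
  have [|| t ht] := H (- a) (- b) (- c) (- d); rewrite ?oppr_eq0 ?oppr_gt0 //.
  by exists t; apply: oppr_inj; rewrite oppr0 -ht; ring.
(* From a M = a + |b| + |c| + |d| the leading term dominates at -M and M, and the polynomial changes
   sign between them. *)
pose M := 1 + (`|b| + `|c| + `|d|) / a.
have M1 : 1 <= M by rewrite lerDl divr_ge0 ?addr_ge0 ?normr_ge0 // ltW.
have aM : a * M = a + `|b| + `|c| + `|d| by rewrite /M; field.
pose p : {poly R} := a *: 'X^3 + b *: 'X^2 + c *: 'X + d%:P.
have pe t : p.[t] = a * t ^+ 3 + b * t ^+ 2 + c * t + d by rewrite /p !hornerE.
have bnd (x y : R) : `|x| <= y -> - y <= x <= y by rewrite ler_norml.
have nb := bnd _ _ (lexx `|b|); have nc := bnd _ _ (lexx `|c|); have nd := bnd _ _ (lexx `|d|).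
have M2 : 1 <= M ^+ 2 by rewrite exprn_ege1.
have M21 : M <= M ^+ 2 by rewrite expr2 ler_peMr //; lra.
have aM3 : a * M ^+ 3 = (a + `|b| + `|c| + `|d|) * M ^+ 2 by rewrite -aM; ring.
have b0 := normr_ge0 b; have c0 := normr_ge0 c; have d0 := normr_ge0 d.
have [||t _ /rootP] := @poly_ivt R p (- M) M.
- lra.
- rewrite !pe; apply/andP; split.
    have -> : a * (- M) ^+ 3 + b * (- M) ^+ 2 + c * (- M) + d = - ((a + `|b| + `|c| + `|d|) * M ^+ 2) + b * M ^+ 2 - c * M + d.
      by rewrite -aM3; ring.
    nra.
  rewrite aM3; nra.
by rewrite pe => e; exists t.
Qed.

(** The product of r u + s v and P u^2 + Q u v + S v^2. *)
Definition prodform (R : comNzRingType) (r s P Q S : R) : cubic_form R :=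
  CubicForm (r * P) (r * Q + s * P) (r * S + s * Q) (s * S).

Lemma prodform_act (R : comNzRingType) (g : 'M[R]_2) (r s P Q S : R) :
  form_act g (prodform r s P Q S) =
  prodform (r * g 0 0 + s * g 0 1) (r * g 1 0 + s * g 1 1)
    (qval P Q S (g 0 0) (g 0 1)) (qpol P Q S (g 0 0) (g 0 1) (g 1 0) (g 1 1))
    (qval P Q S (g 1 0) (g 1 1)).
Proof.
by rewrite /prodform /form_act /qval /qpol; congr CubicForm; ring.
Qed.

(** The discriminant of the quadratic factor times the square of the resultant of the two
    factors. *)
Lemma prodform_disc (R : comNzRingType) (r s P Q S : R) :
  form_disc (prodform r s P Q S) =
  (Q ^+ 2 - 4%:R * P * S) * (P * s ^+ 2 - Q * s * r + S * r ^+ 2) ^+ 2.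
Proof. by rewrite /prodform /form_disc; ring. Qed.

Lemma real_factor (R : realType) (F : cubic_form R) :
  exists r s P Q S, F = prodform r s P Q S.
Proof.
case: F => a b c d; have [->|a0] := eqVneq a 0.
  by exists 0, 1, b, c, d; rewrite /prodform; congr CubicForm; ring.
have [t ht] := @cubic_real_root R a b c d a0.
exists 1, (- t), a, (b + a * t), (c + b * t + a * t ^+ 2).
rewrite /prodform; congr CubicForm; try ring.
by apply/eqP; rewrite -subr_eq0 -ht; apply/eqP; ring.
Qed.

Lemma map_form_act (R : comNzRingType) (g : 'M[int]_2) (f : cubic_form int) :
  map_form intr (form_act g f) = form_act (map_mx intr g) (map_form intr f) :> cubic_form R.
Proof.
case: f => a b c d; rewrite /map_form /form_act !mxE /=.
by congr CubicForm; ring.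
Qed.

Lemma map_form_disc (R : comNzRingType) (f : cubic_form int) :
  form_disc (map_form intr f : cubic_form R) = (form_disc f)%:~R.
Proof. by case: f => a b c d; rewrite /map_form /form_disc /=; ring. Qed.

(** One shape for both signs of the discriminant. A and C are quadratic in the coefficients and play
    the parts of (lam / t)^2 and (lam t)^2. The last condition comes from the middle coefficient of
    the reduced quadratic form: [ka] is 9 when this is the Hessian, and 1 when it is a definite
    factor. *)
Definition in_box (R : realType) (F : cubic_form R) (A C ka : R) : Prop :=
  [/\ ca F ^+ 2 * C <= 2%:R * A ^+ 2, cb F ^+ 2 <= 8%:R * A,
      cc F ^+ 2 <= 15%:R * C, cd F ^+ 2 * A <= 2%:R * C ^+ 2 &
      `|ka * ca F * cd F - cb F * cc F| <= 3%:R * A].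

(** The classical syzygy between a cubic, its Hessian and its cubic covariant, read on leading
    coefficients. The square on the left gives 27 a^2 Disc <= 4 A^3. *)
Lemma hess_syzygy (R : comNzRingType) (F : cubic_form R) :
  (2%:R * cb F ^+ 3 - 9%:R * ca F * cb F * cc F + 27%:R * ca F ^+ 2 * cd F) ^+ 2
   = 4%:R * hessA F ^+ 3 - 27%:R * ca F ^+ 2 * form_disc F.
Proof. by case: F => a b c d; rewrite /hessA /form_disc /=; ring. Qed.

Lemma hess_box (R : realType) (F : cubic_form R) :
  0 < form_disc F -> `|hessB F| <= hessA F -> hessA F <= hessC F ->
  [/\ 0 < hessA F, hessA F * hessC F <= form_disc F,
      in_box F (hessA F) (hessC F) 9%:R & ca F = 0 -> cc F ^+ 2 <= cb F ^+ 2].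
Proof.
move=> D0 hB hC; have hd := hess_disc F.
have B2 : hessB F ^+ 2 <= hessA F ^+ 2.
  by rewrite -real_normK ?num_real // lerXn2r ?nnegrE ?normr_ge0 // (le_trans (normr_ge0 _) hB).
have A0' : 0 <= hessA F by apply: le_trans hB; apply: normr_ge0.
have A0 : 0 < hessA F.
  rewrite lt_neqAle A0' andbT eq_sym; apply/eqP => z.
  move: hd B2; rewrite z mulr0 mul0r expr0n /= => hd; have := sqr_ge0 (hessB F); lra.
have AC : hessA F * hessC F <= form_disc F by nra.
have ida := hess_syzygy F.
have idd : (2%:R * cc F ^+ 3 - 9%:R * cd F * cc F * cb F + 27%:R * cd F ^+ 2 * ca F) ^+ 2
   = 4%:R * hessC F ^+ 3 - 27%:R * cd F ^+ 2 * form_disc F.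
  by case: F {hd B2 A0' A0 AC D0 hB hC ida} => a b c d; rewrite /hessC /form_disc /=; ring.
(* The second transvectant of a cubic and its Hessian vanishes; this relation bounds b and c once a
   is bounded. *)
have idl : cc F * hessA F = cb F * hessB F - 3%:R * ca F * hessC F.
  by case: F {hd B2 A0' A0 AC D0 hB hC ida idd} => a b c d; rewrite /hessA /hessB /hessC /=; ring.
have idA : cb F ^+ 2 = hessA F + 3%:R * ca F * cc F by rewrite /hessA; ring.
have idB : cb F * cc F = hessB F + 9%:R * ca F * cd F by rewrite /hessB; ring.
rewrite /in_box.
move: (hessA F) (hessB F) (hessC F) (form_disc F) (ca F) (cb F) (cc F) (cd F)
  D0 hB hC hd B2 A0' A0 AC ida idd idl idA idB => A B C D a b c d
  D0 hB hC hd B2 A0' A0 AC ida idd idl idA idB.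
have C0 : 0 < C by apply: lt_le_trans hC.
(* The syzygy gives 27 a^2 Disc <= 4 A^3, and A C <= Disc. *)
have a1 : 27%:R * a ^+ 2 * C <= 4%:R * A ^+ 2.
  rewrite -(ler_pM2l A0).
  have : 27%:R * a ^+ 2 * (A * C) <= 27%:R * a ^+ 2 * D by rewrite ler_wpM2l // mulr_ge0 // sqr_ge0.
  have := sqr_ge0 (2%:R * b ^+ 3 - 9%:R * a * b * c + 27%:R * a ^+ 2 * d); rewrite ida; nra.
have d1 : 27%:R * d ^+ 2 * A <= 4%:R * C ^+ 2.
  rewrite -(ler_pM2l C0).
  have : 27%:R * d ^+ 2 * (A * C) <= 27%:R * d ^+ 2 * D by rewrite ler_wpM2l // mulr_ge0 // sqr_ge0.
  have := sqr_ge0 (2%:R * c ^+ 3 - 9%:R * d * c * b + 27%:R * d ^+ 2 * a); rewrite idd; nra.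
have a2 : 27%:R * a ^+ 2 <= 4%:R * A.
  rewrite -(ler_pM2l A0); apply: le_trans (_ : 27%:R * a ^+ 2 * C <= _); last by nra.
  by rewrite mulrC ler_wpM2l // mulr_ge0 // sqr_ge0.
(* The weights come from (|b| - 3 |a|)^2 >= 0; the share of b^2 is small enough to be absorbed on
   the left in the bound for b. *)
have abB : a * b * B <= A * (b ^+ 2 / 6%:R + 3%:R / 2%:R * a ^+ 2).
  apply: le_trans (ler_norm _) _; rewrite normrM mulrC.
  apply: ler_pM => //; rewrite normrM.
  have := sqr_ge0 (`|b| - 3%:R * `|a|); have := real_normK (num_real a); have := real_normK (num_real b).
  nra.
have b2 : 3%:R * b ^+ 2 <= 10%:R * A.
  rewrite -(ler_pM2l A0).
  have e1 : A * b ^+ 2 = A ^+ 2 + 3%:R * (a * b * B) - 9%:R * a ^+ 2 * C.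
    rewrite idA; have -> : A * (A + 3%:R * a * c) = A ^+ 2 + 3%:R * a * (c * A) by ring.
    by rewrite idl; ring.
  have : 0 <= a ^+ 2 * C by rewrite mulr_ge0 ?sqr_ge0 // ltW.
  nra.
have c2 : c ^+ 2 <= 15%:R * C.
  have A20 : 0 < A ^+ 2 by rewrite exprn_gt0.
  rewrite -(ler_pM2l A20).
  have -> : A ^+ 2 * c ^+ 2 = (b * B - 3%:R * a * C) ^+ 2 by rewrite -idl; ring.
  have h1 : (b * B - 3%:R * a * C) ^+ 2 <= 2%:R * (b ^+ 2 * B ^+ 2) + 18%:R * (a ^+ 2 * C) * C.
    by have := sqr_ge0 (b * B + 3%:R * a * C); nra.
  have h2 : b ^+ 2 * B ^+ 2 <= 10%:R / 3%:R * A * A ^+ 2.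
    by apply: ler_pM; rewrite ?sqr_ge0 //; lra.
  have h3 : A * A ^+ 2 <= C * A ^+ 2 by rewrite ler_pM2r.
  have h4 : 27%:R * a ^+ 2 * C * C <= 4%:R * A ^+ 2 * C by rewrite ler_pM2r.
  nra.
split=> //; first split=> //.
- have : 0 <= a ^+ 2 * C by rewrite mulr_ge0 ?sqr_ge0 // ltW.
  lra.
- lra.
- have : 0 <= d ^+ 2 * A by rewrite mulr_ge0 ?sqr_ge0 // ltW.
  lra.
- have -> : 9%:R * a * d - b * c = - B by rewrite idB; ring.
  by rewrite normrN; apply: le_trans hB _; lra.
- move=> a0; rewrite a0 in idA idB idl *.
  have eA : A = b ^+ 2 by rewrite idA; ring.
  have eB : B = b * c by rewrite idB; ring.
  move: B2; rewrite eA eB exprMn -[(b ^+ 2) ^+ 2]/(b ^+ 2 * b ^+ 2) ler_pM2l; last by rewrite -eA.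
  by [].
Qed.

(** T is the value of the quadratic factor at the root (s : -r) of the linear one. Reduction gives
    Q^2 <= P S, hence |Disc| >= 3 P S T^2, and makes |Q s r| at most half of P s^2 + S r^2, so that
    T controls both of these squares. *)
Lemma prod_box (R : realType) (r s P Q S : R) (F := prodform r s P Q S)
    (T := P * s ^+ 2 - Q * s * r + S * r ^+ 2) :
  form_disc F != 0 -> 0 < P -> `|Q| <= P -> P <= S ->
  [/\ 0 < P * T, P * T <= S * T, P * T * (S * T) <= `|form_disc F|,
      in_box F (P * T) (S * T) 1 & ca F = 0 -> cc F ^+ 2 <= cb F ^+ 2].
Proof.
move=> D0 P0 hQ hS; have S0 : 0 < S by apply: lt_le_trans hS.
have Q2 : Q ^+ 2 <= P ^+ 2.
  by rewrite -real_normK ?num_real // lerXn2r ?nnegrE ?normr_ge0 // ltW.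
have Qsr : `|Q * s * r| <= (P * s ^+ 2 + S * r ^+ 2) / 2%:R.
  rewrite -mulrA normrM; apply: le_trans (_ : P * `|s * r| <= _).
    by rewrite ler_wpM2r ?normr_ge0.
  rewrite normrM; have h1 := real_normK (num_real s); have h2 := real_normK (num_real r).
  have h3 := sqr_ge0 (`|s| - `|r|).
  have : P * `|r| ^+ 2 <= S * `|r| ^+ 2 by rewrite ler_wpM2r ?sqr_ge0.
  rewrite -h1 -h2; nra.
have Q2PS : Q ^+ 2 <= P * S by apply: le_trans Q2 _; rewrite expr2 ler_pM2l.
move: Qsr; rewrite ler_norml => /andP[Q1 Q3].
have T2 : P * s ^+ 2 + S * r ^+ 2 <= 2%:R * T by rewrite /T; lra.
have Ps : 0 <= P * s ^+ 2 by rewrite mulr_ge0 ?sqr_ge0 // ltW.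
have Sr : 0 <= S * r ^+ 2 by rewrite mulr_ge0 ?sqr_ge0 // ltW.
have eD : form_disc F = (Q ^+ 2 - 4%:R * P * S) * T ^+ 2 by rewrite prodform_disc.
have T0 : 0 < T.
  rewrite lt_neqAle; apply/andP; split; last by lra.
  by rewrite eq_sym; apply: contraNneq D0 => e; rewrite eD e expr0n /= mulr0.
have PT : 0 < P * T by rewrite mulr_gt0.
have PS0 : 0 < P * S by rewrite mulr_gt0.
have s2 : P * s ^+ 2 <= 2%:R * T by lra.
have r2 : S * r ^+ 2 <= 2%:R * T by lra.
split=> //; first by rewrite ler_pM2r.
- rewrite eD normrM (ger0_norm (sqr_ge0 T)) ler0_norm; last by lra.
  have -> : P * T * (S * T) = (P * S) * T ^+ 2 by ring.
  by rewrite ler_pM2r ?exprn_gt0 //; lra.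
- have QPr : r ^+ 2 * Q ^+ 2 <= P * (S * r ^+ 2).
    have -> : P * (S * r ^+ 2) = r ^+ 2 * (P * S) by ring.
    by rewrite ler_wpM2l ?sqr_ge0.
  have QPs : s ^+ 2 * Q ^+ 2 <= S * (P * s ^+ 2).
    have -> : S * (P * s ^+ 2) = s ^+ 2 * (P * S) by ring.
    by rewrite ler_wpM2l ?sqr_ge0.
  rewrite /in_box /F /=; split.
  + have -> : (r * P) ^+ 2 * (S * T) = (S * r ^+ 2) * (P ^+ 2 * T) by ring.
    have -> : 2%:R * (P * T) ^+ 2 = 2%:R * T * (P ^+ 2 * T) by ring.
    by rewrite ler_pM2r // mulr_gt0 // exprn_gt0.
  + have h : (r * Q + s * P) ^+ 2 <= 2%:R * (r ^+ 2 * Q ^+ 2) + 2%:R * P * (P * s ^+ 2).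
      by have := sqr_ge0 (r * Q - s * P); nra.
    apply: le_trans h _; have : P * (S * r ^+ 2) + P * (P * s ^+ 2) <= P * (2%:R * T) by nra.
    nra.
  + have h : (r * S + s * Q) ^+ 2 <= 2%:R * S * (S * r ^+ 2) + 2%:R * (s ^+ 2 * Q ^+ 2).
      by have := sqr_ge0 (r * S - s * Q); nra.
    apply: le_trans h _; have : S * (S * r ^+ 2) + S * (P * s ^+ 2) <= S * (2%:R * T) by nra.
    have : 0 < S * T by rewrite mulr_gt0.
    nra.
  + have -> : (s * S) ^+ 2 * (P * T) = (P * s ^+ 2) * (S ^+ 2 * T) by ring.
    have -> : 2%:R * (S * T) ^+ 2 = 2%:R * T * (S ^+ 2 * T) by ring.
    by rewrite ler_pM2r // mulr_gt0 // exprn_gt0.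
  + have -> : 1 * (r * P) * (s * S) - (r * Q + s * P) * (r * S + s * Q) =
      - (Q * (S * r ^+ 2 + Q * s * r + P * s ^+ 2)) by ring.
    rewrite normrN normrM.
    have -> : 3%:R * (P * T) = P * (3%:R * T) by ring.
    apply: ler_pM; rewrite ?normr_ge0 // ler_norml; apply/andP; split; lra.
- rewrite /F /= => /eqP; rewrite mulf_eq0 (gt_eqF P0) orbF => /eqP ->.
  rewrite !mul0r !add0r !exprMn; have := sqr_ge0 s; nra.
Qed.

(** For positive discriminant the Hessian is definite and gets reduced; for negative discriminant a
    real linear factor is split off and the remaining quadratic factor is definite. *)
Lemma exists_box (R : realType) (f : cubic_form int) : form_disc f != 0 ->
  exists2 g : 'M[int]_2, \det g = 1 &
  exists A C ka : R, let F := map_form intr (form_act g f) in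
    [/\ 0 < A, A <= C, A * C <= `|(form_disc f)%:~R|, ka = 1 \/ ka = 9%:R &
     in_box F A C ka /\ (ca F = 0 -> cc F ^+ 2 <= cb F ^+ 2)].
Proof.
move=> D0; pose F0 : cubic_form R := map_form intr f.
have eD0 : form_disc F0 = (form_disc f)%:~R by rewrite map_form_disc.
have detR (g : 'M[int]_2) : \det g = 1 -> \det (map_mx intr g : 'M[R]_2) = 1.
  by move=> dg; rewrite det_map_mx dg.
have norm_int (z : int) : `|z%:~R| = `|z|%:~R :> R by rewrite intr_norm.
case: (ltgtP 0 (form_disc f)) => [Dp|Dn|D00]; last by rewrite -D00 eqxx in D0.
  have DR : 0 < form_disc F0 by rewrite eD0 ltr0z.
  have hd := hess_disc F0.
  have AC0 : 0 < hessA F0 * hessC F0 by have := sqr_ge0 (hessB F0); nra.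
  have A0 : 0 < hessA F0 \/ hessA F0 < 0.
    by case: (ltgtP 0 (hessA F0)) => h; [left|right|rewrite -h mul0r ltxx in AC0].
  (* A negative definite Hessian would make the square in the syzygy negative. *)
  have {}A0 : 0 < hessA F0.
    case: A0 => // An; exfalso.
    have := sqr_ge0 (2%:R * cb F0 ^+ 3 - 9%:R * ca F0 * cb F0 * cc F0 + 27%:R * ca F0 ^+ 2 * cd F0).
    rewrite hess_syzygy; have : 0 <= ca F0 ^+ 2 * form_disc F0 by rewrite mulr_ge0 ?sqr_ge0 // ltW.
    have : hessA F0 ^+ 3 < 0 by rewrite exprn_odd_lt0.
    lra.
  have hQ : hessB F0 ^+ 2 < 4%:R * hessA F0 * hessC F0 by lra.
  have [g dg /=] := quad_reduce A0 hQ; move=> /andP[h1 h2]; exists g => //.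
  have DR' : 0 < form_disc (map_form intr (form_act g f) : cubic_form R).
    by rewrite map_form_act form_disc_act detR // expr1n mul1r.
  have eA : hessA (map_form intr (form_act g f) : cubic_form R) =
      qval (hessA F0) (hessB F0) (hessC F0) (g 0 0)%:~R (g 0 1)%:~R.
    by rewrite map_form_act hessA_act detR // expr1n mul1r !mxE.
  have eC : hessC (map_form intr (form_act g f) : cubic_form R) =
      qval (hessA F0) (hessB F0) (hessC F0) (g 1 0)%:~R (g 1 1)%:~R.
    by rewrite map_form_act hessC_act detR // expr1n mul1r !mxE.
  have eB : hessB (map_form intr (form_act g f) : cubic_form R) =
      qpol (hessA F0) (hessB F0) (hessC F0) (g 0 0)%:~R (g 0 1)%:~R (g 1 0)%:~R (g 1 1)%:~R.
    by rewrite map_form_act hessB_act detR // expr1n mul1r !mxE.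
  rewrite -eA -eB -eC in h1 h2.
  have [p1 p2 p3 p4] := hess_box DR' h1 h2.
  exists (hessA (map_form intr (form_act g f))), (hessC (map_form intr (form_act g f))), 9%:R.
  split=> //; last by right.
  apply: le_trans p2 _; rewrite map_form_act form_disc_act detR // expr1n mul1r eD0.
  exact: ler_norm.
have DR : form_disc F0 < 0 by rewrite eD0 ltrz0.
have [r [s [P [Q [S eF]]]]] := real_factor F0.
wlog P0 : r s P Q S eF / 0 < P.
  move=> H; case: (ltgtP 0 P) => [P0|Pn|P0]; first exact: (H r s P Q S).
    apply: (H (- r) (- s) (- P) (- Q) (- S)); last by rewrite oppr_gt0.
    by rewrite eF /prodform; congr CubicForm; ring.
  exfalso; move: DR; rewrite eF prodform_disc -P0 mulr0 mul0r subr0 ltNge.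
  by rewrite mulr_ge0 // sqr_ge0.
have hQ : Q ^+ 2 < 4%:R * P * S.
  rewrite ltNge; apply/negP => h; move: DR; rewrite eF prodform_disc ltNge.
  by rewrite mulr_ge0 ?sqr_ge0 // subr_ge0.
have [g dg /=] := quad_reduce P0 hQ; move=> /andP[h1 h2]; exists g => //.
move: h1 h2; set P' := qval P Q S (g 0 0)%:~R _; set S' := qval P Q S (g 1 0)%:~R _; set Q' := qpol _ _ _ _ _ _ _ => h1 h2.
pose r' : R := r * (g 0 0)%:~R + s * (g 0 1)%:~R; pose s' : R := r * (g 1 0)%:~R + s * (g 1 1)%:~R.
have eF' : map_form intr (form_act g f) = prodform r' s' P' Q' S'.
  by rewrite map_form_act -/F0 eF prodform_act !mxE.
have eD' : form_disc (prodform r' s' P' Q' S') = (form_disc f)%:~R.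
  by rewrite -eF' map_form_act form_disc_act detR // expr1n mul1r.
have D0' : form_disc (prodform r' s' P' Q' S') != 0 by rewrite eD' intr_eq0.
have P'0 : 0 < P'.
  have := normr_ge0 Q'; rewrite le_eqVlt => /orP[/eqP e|]; last by move=> h; apply: lt_le_trans h h1.
  rewrite lt_neqAle (le_trans (normr_ge0 _) h1) andbT eq_sym; apply/eqP => Pz.
  move/eqP: D0'; apply; move/esym/eqP: e; rewrite normr_eq0 => /eqP Qz.
  by rewrite prodform_disc Pz Qz; ring.
have [p1 p2 p3 p4 p5] := prod_box D0' P'0 h1 h2.
eexists _, _, 1; split; [exact: p1|exact: p2|by rewrite -eD'|by left|].
by split; [rewrite eF'|move: p5; rewrite -eF'].
Qed.

(** * Counting reduced forms *)

Lemma size_le_fiber (R : realType) (T U : eqType) (f : T -> U) (s : seq T) (B : U -> R) :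
  (forall u, u \in map f s -> (count (fun x => f x == u) s)%:R <= B u) ->
  (size s)%:R <= \sum_(u <- undup (map f s)) B u.
Proof.
move=> h; have -> : size s = (\sum_(u <- undup (map f s)) count (fun x => f x == u) s)%N.
  under eq_bigr => u _ do rewrite -sum1_count big_mkcond.
  rewrite exchange_big /= -[LHS]sum1_size; apply: eq_big_seq => x xs.
  rewrite -big_mkcond /= sum1_count -[LHS]/(nat_of_bool true).
  transitivity (count_mem (f x) (undup (map f s))); last by apply: eq_count => u /=; rewrite eq_sym.
  by rewrite count_uniq_mem ?undup_uniq // mem_undup map_f.
rewrite natr_sum big_seq [leRHS]big_seq; apply: ler_sum => u.
by rewrite mem_undup; exact: h.
Qed.

Lemma size_le_fiber_const (R : realType) (T U : eqType) (f : T -> U) (s : seq T) (l : seq U) (B : R) :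
  0 <= B -> {subset map f s <= l} ->
  (forall u, u \in map f s -> (count (fun x => f x == u) s)%:R <= B) ->
  (size s)%:R <= (size l)%:R * B.
Proof.
move=> B0 sub h; apply: le_trans (@size_le_fiber R T U f s (fun=> B) h) _.
rewrite big_const_seq count_predT iter_addr_0 -[leLHS]mulr_natl; apply: ler_wpM2r => //; rewrite ler_nat.
by apply: uniq_leq_size; [exact: undup_uniq|move=> u; rewrite mem_undup => /sub].
Qed.

Lemma ler_sum_subset (R : realType) (T : eqType) (s l : seq T) (F : T -> R) :
  uniq s -> {subset s <= l} -> (forall x, 0 <= F x) ->
  \sum_(x <- s) F x <= \sum_(x <- l) F x.
Proof.
move=> us sub F0; apply: le_trans (_ : \sum_(x <- undup l) F x <= _).
  rewrite [leRHS](bigID (mem s)) /= -[X in _ <= X + _]big_filter.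
  rewrite [X in _ <= X + _](@perm_big _ _ _ _ _ s) /=; first by rewrite lerDl sumr_ge0.
  apply: uniq_perm; rewrite ?filter_uniq ?undup_uniq // => x.
  by rewrite mem_filter mem_undup /=; case xs: (x \in s) => //=; rewrite sub.
elim: l {sub} => [|x l IH] /=; first by rewrite big_nil.
by case: ifP => _; rewrite ?big_cons; [apply: ler_wpDl|rewrite lerD2l].
Qed.

Lemma int_seq_min (s : seq int) : s != [::] ->
  exists2 x0, x0 \in s & {in s, forall y, x0 <= y}.
Proof.
elim: s => // x s IH _; have [->|/IH[x0 x0s h]] := eqVneq s [::].
  by exists x; rewrite ?mem_head // => y; rewrite inE => /eqP ->.
case: (lerP x x0) => xx0.
  exists x; rewrite ?mem_head // => y; rewrite inE => /predU1P[->//|/h]; exact: le_trans.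
exists x0; first by rewrite inE x0s orbT.
by move=> y; rewrite inE => /predU1P[->|/h//]; apply: ltW.
Qed.

Lemma count_interval (R : realType) (s : seq int) (M : nat) (l : R) :
  (0 < M)%N -> uniq s -> 0 <= l ->
  {in s &, forall x y, (M %| (x - y)%R)%Z} ->
  {in s &, forall x y, `|(x - y)%:~R| <= l} ->
  (size s)%:R <= l / M%:R + 1.
Proof.
move=> M0 us l0 cong dist.
have lM : 0 <= l / M%:R by rewrite divr_ge0.
have [->|sn] := eqVneq s [::]; first by rewrite addr_ge0.
have [x0 x0s minx] := int_seq_min sn.
pose h (x : int) := absz ((x - x0) %/ M)%Z.
have hE x : x \in s -> x = x0 + (h x)%:Z * M%:Z.
  move=> xs; rewrite /h gez0_abs; last by rewrite divz_ge0 ?ltz_nat // subr_ge0 minx.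
  by rewrite divzK ?cong // addrC subrK.
have uh : uniq (map h s).
  by rewrite map_inj_in_uniq // => x y xs ys e; rewrite (hE _ xs) (hE _ ys) e.
have sub : {subset map h s <= iota 0 (Num.truncn (l / M%:R)).+1}.
  move=> _ /mapP[x xs ->]; rewrite mem_iota /= add0n ltnS truncn_ge_nat //.
  rewrite ler_pdivlMr ?ltr0n // -natrM.
  have := dist _ _ xs x0s; apply: le_trans.
  rewrite {2}(hE _ xs) addrC addKr -PoszM.
  by rewrite ger0_norm // ler0z.
have := uniq_leq_size uh sub; rewrite size_map size_iota -(ler_nat R) => /le_trans; apply.
by rewrite -natr1 lerD2r truncn_le.
Qed.

(** The condition at p says that at most two residue classes modulo p occur. Splitting by the class
    of one element leaves two sets, each in a single class modulo p, whence a factor 2 per prime. *)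
Lemma count_residues (R : realType) (ps : seq nat) (s : seq int) (M : nat) (l : R) :
  (0 < M)%N -> uniq ps -> all prime ps -> all (coprime M) ps -> uniq s -> 0 <= l ->
  {in s &, forall x y, (M %| (x - y)%R)%Z} ->
  {in s &, forall x y, `|(x - y)%:~R| <= l} ->
  (forall p, p \in ps -> {in s & &, forall x y z,
     [|| (p %| (x - y)%R)%Z, (p %| (x - z)%R)%Z | (p %| (y - z)%R)%Z]}) ->
  (size s)%:R <= 2 ^+ size ps * (l / (M * \prod_(p <- ps) p)%N%:R + 1).
Proof.
elim: ps s M => [|p ps IH] s M M0 ups pps cps us l0 cong dist res /=.
  by rewrite big_nil muln1 expr0 mul1r; exact: count_interval.
have [s0|sn] := eqVneq s [::].
  by rewrite s0 mulr_ge0 ?exprn_ge0 // addr_ge0 // divr_ge0.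
case: s sn us cong dist res => // x s' _; set s := x :: s' => us cong dist res.
move: ups pps cps => /= /andP[pps' ups] /andP[pp pps] /andP[cp cps].
have step (s1 : seq int) : uniq s1 -> {subset s1 <= s} -> {in s1 &, forall y z, (p %| (y - z)%R)%Z} ->
   (size s1)%:R <= 2 ^+ size ps * (l / (M * p * \prod_(p <- ps) p)%N%:R + 1).
  move=> us1 sub pd; apply: IH => //.
  - by rewrite muln_gt0 M0 prime_gt0.
  - apply/allP => r rps; rewrite coprimeMl (allP cps _ rps) /=.
    rewrite prime_coprime // dvdn_prime2 ?(allP pps _ rps) //.
    by apply: contraNneq pps' => ->.
  - move=> y z ys zs; rewrite PoszM Gauss_dvdz ?coprimezE //.
    by rewrite cong ?sub // pd.
  - by move=> y z ys zs; apply: dist; apply: sub.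
  - move=> r rps y z t ys zs ts; apply: res; rewrite ?sub //.
    by rewrite inE rps orbT.
rewrite big_cons mulnA exprS.
rewrite -[(size s').+1]/(size s) -(count_predC (fun y => (p %| (x - y)%R)%Z) s) -!size_filter natrD -mulrA [leRHS]mulr_natl mulr2n.
apply: lerD; apply: step; rewrite ?filter_uniq //.
- by move=> y; rewrite mem_filter => /andP[].
- move=> y z; rewrite !mem_filter => /andP[h1 _] /andP[h2 _].
  have -> : y - z = (x - z) - (x - y) by ring.
  by rewrite rpredB.
- by move=> y; rewrite mem_filter => /andP[].
- move=> y z; rewrite !mem_filter /= => /andP[h1 ys] /andP[h2 zs].
  have := res p (mem_head _ _) x y z (mem_head _ _) ys zs.
  by rewrite (negbTE h1) (negbTE h2).
Qed.

(** The factor 2 is for the two signs, on each of which the absolute value is injective. *)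
Lemma sum_multiples (R : realType) (s : seq int) (D : nat) (A : R) (F : nat -> R) :
  (0 < D)%N -> uniq s -> (forall n, 0 <= F n) ->
  {in s, forall a, [/\ a != 0, (D %| a)%Z & `|a%:~R| <= A]} ->
  \sum_(a <- s) F (absz a) <= 2 * \sum_(1 <= i < (Num.truncn (A / D%:R)).+1) F (D * i)%N.
Proof.
move=> D0 us F0 hs.
have half (s1 : seq int) : uniq s1 -> {subset s1 <= s} -> {in s1 &, injective absz} ->
   \sum_(a <- s1) F (absz a) <= \sum_(1 <= i < (Num.truncn (A / D%:R)).+1) F (D * i)%N.
  move=> u1 sub inj.
  rewrite -[leLHS](big_map absz predT F).
  rewrite -[leRHS](big_map (muln D) predT F).
  apply: ler_sum_subset => //; first by rewrite map_inj_in_uniq.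
  move=> _ /mapP[a as1 ->]; have [a0 Da aA] := hs _ (sub _ as1).
  have Da' : (D %| absz a)%N by rewrite -[D]/(absz D) -dvdzE.
  apply/mapP; exists (absz a %/ D)%N; last by rewrite mulnC divnK.
  have a0' : (0 < absz a)%N by rewrite absz_gt0.
  rewrite mem_index_iota ltnS divn_gt0 // dvdn_leq //= truncn_ge_nat; last first.
    by rewrite divr_ge0 // (le_trans _ aA).
  rewrite ler_pdivlMr ?ltr0n // -natrM divnK // natr_absz intr_norm //.
rewrite (bigID (fun a : int => 0 <= a)) /= [leRHS]mulr_natl mulr2n -[X in X + _]big_filter -[X in _ + X <= _]big_filter.
apply: lerD; apply: half; rewrite ?filter_uniq //.
- by move=> a; rewrite mem_filter => /andP[].
- by move=> a b; rewrite !mem_filter => /andP[h _] /andP[h' _] e; lia.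
- by move=> a; rewrite mem_filter => /andP[].
- by move=> a b; rewrite !mem_filter => /andP[h _] /andP[h' _] e; lia.
Qed.

Lemma sum_inv_sqrt (R : realType) n :
  \sum_(1 <= i < n.+1) (Num.sqrt i%:R)^-1 <= 2 * Num.sqrt n%:R :> R.
Proof.
elim: n => [|n IH]; first by rewrite big_geq // sqrtr0 mulr0.
rewrite big_nat_recr //=; apply: le_trans (lerD IH (lexx _)) _.
set x := Num.sqrt n%:R; set y := Num.sqrt n.+1%:R.
have x2 : x ^+ 2 = n%:R by rewrite sqr_sqrtr.
have y2 : y ^+ 2 = n%:R + 1 by rewrite sqr_sqrtr // natr1.
have y0 : 0 < y by rewrite sqrtr_gt0.
have x0 : 0 <= x by rewrite sqrtr_ge0.
have xy : x <= y by rewrite ler_wsqrtr // ler_nat.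
rewrite -(ler_pM2l y0) mulrDr mulfV ?gt_eqF //; nra.
Qed.

Lemma sum_inv_sq (R : realType) n :
  \sum_(1 <= i < n.+1) (i%:R ^+ 2)^-1 <= 2 :> R.
Proof.
case: n => [|n]; first by rewrite big_geq.
(* The subtracted term makes the induction go through: it telescopes. *)
have : \sum_(1 <= i < n.+2) (i%:R ^+ 2)^-1 <= 2 - (n.+1%:R)^-1 :> R.
  elim: n => [|n IH]; first by rewrite big_nat1 invr1 expr1n invr1; lra.
  rewrite big_nat_recr //=; apply: le_trans (lerD IH (lexx _)) _.
  rewrite -(natr1 n.+1); set x : R := n.+1%:R.
  have x0 : 0 < x by rewrite ltr0n.
  rewrite -subr_ge0.
  have -> : 2 - (x + 1)^-1 - (2 - x^-1 + ((x + 1) ^+ 2)^-1) =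
     (x * (x + 1) ^+ 2)^-1.
    by field; rewrite !gt_eqF //; lra.
  by rewrite invr_ge0 mulr_ge0 ?sqr_ge0 // ltW.
by move/le_trans; apply; rewrite gerBl invr_ge0.
Qed.

(** Products over the sublists of l: these are the possible values of [Dof l], and their number
    costs a factor 2 per prime. *)
Fixpoint subprods (l : seq nat) : seq nat :=
  if l is p :: l' then subprods l' ++ map (muln p) (subprods l') else [:: 1%N].

Lemma size_subprods l : size (subprods l) = (2 ^ size l)%N.
Proof. by elim: l => //= p l IH; rewrite size_cat size_map IH expnS mul2n addnn. Qed.

Lemma mem_subprods l (P : pred nat) : (\prod_(p <- l | P p) p)%N \in subprods l.
Proof.
elim: l => [|p l IH] /=; first by rewrite big_nil mem_head.
rewrite big_cons mem_cat; case: (P p); last by rewrite IH.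
by rewrite map_f ?orbT.
Qed.

Lemma prod_primes_dvd (l : seq nat) (x : int) : uniq l -> all prime l ->
  (forall p, p \in l -> (p %| x)%Z) -> ((\prod_(p <- l) p)%N %| x)%Z.
Proof.
elim: l => [|p l IH] /=; first by rewrite big_nil dvd1z.
move=> /andP[pl ul] /andP[pp al] h; rewrite big_cons PoszM Gauss_dvdz; last first.
  rewrite coprimezE /= prime_coprime //; apply/negP => /=.
  rewrite Euclid_dvd_prod // big_has => /hasP[r rl /=].
  by rewrite dvdn_prime2 ?(allP al _ rl) // => /eqP e; rewrite e rl in pl.
rewrite h ?mem_head //= IH // => r rl; apply: h; by rewrite inE rl orbT.
Qed.

Lemma prod_primes_gt0 (l : seq nat) : all prime l -> (0 < \prod_(p <- l) p)%N.
Proof.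
move=> h; rewrite big_seq prodn_cond_gt0 // => p /(allP h); exact: prime_gt0.
Qed.

Lemma sum_geom (R : realType) (s : seq nat) : uniq s ->
  \sum_(k <- s) (2 ^+ k)^-1 <= 2 :> R.
Proof.
move=> us; apply: le_trans (_ : \sum_(k <- iota 0 (\max_(k <- s) k).+1) (2 ^+ k)^-1 <= _).
  apply: ler_sum_subset => // k ks.
  by rewrite mem_iota /= add0n ltnS leq_bigmax_seq.
move: (_.+1) => n.
have -> : \sum_(k <- iota 0 n) (2 ^+ k)^-1 = 2 - 2 * (2 ^+ n)^-1 :> R.
  elim: n => [|n IH]; first by rewrite big_nil expr0 invr1 mulr1 subrr.
  rewrite -addn1 iotaD big_cat /= IH big_seq1 add0n addn1 exprS.
  by field; rewrite expf_neq0.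
by rewrite gerBl mulr_ge0 // invr_ge0 exprn_ge0.
Qed.

(* a d and b c can both be of size lam ^ 2: the last condition saves a factor t ^ 2 in the
   count of d. *)
Definition in_dbox (R : realType) (lam : R) (k : nat) (ka : bool) (x : cubic_form int) : Prop :=
  let t : R := 2 ^+ k in
  [/\ `|(ca x)%:~R| <= 12 * lam / t ^+ 3, `|(cb x)%:~R| <= 12 * lam / t,
      `|(cc x)%:~R| <= 12 * lam * t, `|(cd x)%:~R| <= 12 * lam * t ^+ 3 &
      `|((if ka then 9 else 1) * ca x * cd x - cb x * cc x)%:~R| <= 12 * lam ^+ 2 / t ^+ 2].

Lemma sqr_le_norm (R : realType) (x y : R) : 0 <= y -> x ^+ 2 <= y ^+ 2 -> `|x| <= y.
Proof. by move=> y0; rewrite -[x ^+ 2]real_normK ?num_real // ler_pXn2r. Qed.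

(** A difference of two values of d is O(lam t^3) by the box and O(lam^2 / (t^2 |a|)) by the
    condition on a d - b c. Their geometric mean is used because the sum over a of |a|^(-1/2) costs
    no logarithm, unlike that of 1 / |a|. *)
Lemma count_d (R : realType) (s : seq int) (ps : seq nat) (a : int) (ka : bool) (bc : int)
    (lam t : R) : 0 < lam -> 0 < t -> a != 0 -> uniq s ->
  uniq ps -> all prime ps ->
  {in s, forall d, `|d%:~R| <= 12 * lam * t ^+ 3} ->
  {in s, forall d, `|((if ka then 9 else 1) * a * d - bc)%:~R| <= 12 * lam ^+ 2 / t ^+ 2} ->
  (forall p, p \in ps -> {in s & &, forall x y z,
     [|| (p %| (x - y)%R)%Z, (p %| (x - z)%R)%Z | (p %| (y - z)%R)%Z]}) ->
  (size s)%:R <= 2 ^+ size ps *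
     (24 * Num.sqrt (lam ^+ 3 * t) / Num.sqrt (absz a)%:R / (\prod_(p <- ps) p)%N%:R + 1).
Proof.
move=> l0 t0 a0 us ups pps h1 h2 res.
rewrite -[(\prod_(p <- ps) p)%N]mul1n.
apply: count_residues => //; first by apply/allP => p _; rewrite coprime1n.
move=> x y xs ys.
have aR : 1 <= `|a%:~R| :> R by rewrite -intr_norm -[1]/(1%:~R) ler_int; lia.
set A : R := (absz a)%:R; have AE : A = `|a%:~R| by rewrite /A natr_absz intr_norm.
have A0 : 0 < A by rewrite AE; lra.
apply: sqr_le_norm; first by rewrite divr_ge0 ?mulr_ge0 ?sqrtr_ge0.
have e1 : `|(x - y)%:~R| <= 24 * lam * t ^+ 3 :> R.
  rewrite rmorphB /=; apply: le_trans (ler_normB _ _) _.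
  have := h1 _ xs; have := h1 _ ys; lra.
have e2 : `|(x - y)%:~R| * A <= 24 * lam ^+ 2 / t ^+ 2 :> R.
  apply: le_trans (_ : `|((if ka then 9 else 1) * a * x - bc - ((if ka then 9 else 1) * a * y - bc))%:~R| <= _).
    have -> : (if ka then 9 else 1) * a * x - bc - ((if ka then 9 else 1) * a * y - bc) =
       (if ka then 9 else 1) * (a * (x - y)) by ring.
    rewrite AE mulrC -normrM -rmorphM /= -!intr_norm ler_int; case: ka {h2}; lia.
  rewrite rmorphB; apply: le_trans (ler_normB _ _) _.
  have := h2 _ xs; have := h2 _ ys; lra.
rewrite !exprMn exprVn !sqr_sqrtr //; last by rewrite mulr_ge0 ?exprn_ge0 // ltW.
rewrite ler_pdivlMr // -real_normK ?num_real //.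
have -> : `|(x - y)%:~R| ^+ 2 * A = `|(x - y)%:~R| * (`|(x - y)%:~R| * A) :> R by ring.
apply: le_trans (_ : 24 * lam * t ^+ 3 * (24 * lam ^+ 2 / t ^+ 2) <= _).
  by apply: ler_pM => //; rewrite mulr_ge0 // ltW.
have -> : 24 * lam * t ^+ 3 * (24 * lam ^+ 2 / t ^+ 2) = 24 ^+ 2 * (lam ^+ 3 * t).
  by field; rewrite gt_eqF.
by [].
Qed.

Lemma exists_dyadic (R : realType) (x : R) : 1 <= x ->
  exists k : nat, 16 ^+ k <= x < 16 ^+ k.+1.
Proof.
move=> x1; have ex : exists k : nat, x < 16 ^+ k.+1.
  exists (Num.Def.archi_bound x); apply: lt_trans (archi_boundP _) _; first lra.
  rewrite -natrX ltr_nat; apply: leq_trans (ltn_expl _ (isT : 1 < 16)%N) _.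
  by rewrite leq_exp2l.
have := ex_minnP ex; case=> k hk mk; exists k; rewrite hk andbT.
case: k hk mk => [|k] hk mk; first by rewrite expr0.
by rewrite leNgt; apply/negP => /mk; rewrite ltnn.
Qed.

Lemma exists_dbox (R : realType) (lam : R) (f : cubic_form int) : 0 < lam ->
  form_disc f != 0 -> `|(form_disc f)%:~R| <= lam ^+ 4 ->
  exists2 g : 'M[int]_2, \det g = 1 & exists k ka,
    in_dbox lam k ka (form_act g f) /\
    (ca (form_act g f) = 0 -> `|cc (form_act g f)| <= `|cb (form_act g f)|).
Proof.
move=> l0 D0 Dl; have [g dg [A [C [ka [A0 AC ACl hka [[b1 b2 b3 b4 b5] b6]]]]]] := exists_box R D0.
exists g => //; have C0 : 0 < C by apply: lt_le_trans AC.
have CA : 1 <= C / A by rewrite ler_pdivlMr // mul1r.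
(* Powers of 16, because C / A has the size of t^4 with t = 2^k. *)
have [k /andP[k1 k2]] := exists_dyadic CA.
move: k1 k2; rewrite ler_pdivlMr // ltr_pdivrMr // => k1 k2.
have ACl' : A * C <= lam ^+ 4 by apply: le_trans ACl _.
set t : R := 2 ^+ k; have t0 : 0 < t by rewrite exprn_gt0.
have t1 : 1 <= t by rewrite exprn_ege1 // ler1n.
have e16 : 16 ^+ k = t ^+ 4 :> R by rewrite /t exprAC; congr (_ ^+ k); ring.
rewrite e16 in k1; move: k2; rewrite exprS e16 => k2.
have Al : A <= (lam / t) ^+ 2.
  rewrite -(ler_pXn2r (n := 2)) ?nnegrE ?sqr_ge0 ?(ltW A0) //.
  have -> : ((lam / t) ^+ 2) ^+ 2 = lam ^+ 4 / t ^+ 4 by field; rewrite gt_eqF.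
  rewrite ler_pdivlMr ?exprn_gt0 //; apply: le_trans ACl'.
  by rewrite expr2 -mulrA ler_pM2l // mulrC.
have Cl : C <= (2 * lam * t) ^+ 2.
  rewrite -(ler_pXn2r (n := 2)) ?nnegrE ?sqr_ge0 ?(ltW C0) //.
  have -> : ((2 * lam * t) ^+ 2) ^+ 2 = lam ^+ 4 * (16 * t ^+ 4) by ring.
  apply: le_trans (_ : (A * C) * (16 * t ^+ 4) <= _); last first.
    by rewrite ler_pM2r // mulr_gt0 // exprn_gt0.
  by rewrite expr2 -mulrA mulrCA ler_pM2l // mulrC ltW.
exists k, (ka == 9); split; last first.
  move=> a0; have := b6; rewrite /= a0 => /(_ erefl).
  by move=> h; rewrite -(ler_int R) !intr_norm; apply: sqr_le_norm; rewrite // real_normK ?num_real.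
rewrite /in_dbox -/t.
move: b1 b2 b3 b4 b5 b6; set x := form_act g f; rewrite /=.
set a : R := (ca x)%:~R; set b : R := (cb x)%:~R; set c : R := (cc x)%:~R; set d : R := (cd x)%:~R.
move=> b1 b2 b3 b4 b5 b6.
have t3 : 0 < t ^+ 3 by rewrite exprn_gt0.
split.
- apply: sqr_le_norm; first by rewrite divr_ge0 ?mulr_ge0 // ltW.
  have h : a ^+ 2 * t ^+ 4 <= 2 * A.
    rewrite -(ler_pM2r A0); apply: le_trans (_ : a ^+ 2 * C <= _); last by apply: le_trans b1 _; rewrite expr2 mulrA.
    by rewrite -mulrA ler_wpM2l ?sqr_ge0.
  have -> : (12 * lam / t ^+ 3) ^+ 2 = 144 * (lam / t) ^+ 2 / t ^+ 4 by field; rewrite gt_eqF.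
  rewrite ler_pdivlMr ?exprn_gt0 //; have := sqr_ge0 (lam / t); lra.
- apply: sqr_le_norm; first by rewrite divr_ge0 ?mulr_ge0 // ltW.
  have -> : (12 * lam / t) ^+ 2 = 144 * (lam / t) ^+ 2 by field; rewrite gt_eqF.
  have := sqr_ge0 (lam / t); lra.
- apply: sqr_le_norm; first by rewrite !mulr_ge0 // ltW.
  have -> : (12 * lam * t) ^+ 2 = 36 * (2 * lam * t) ^+ 2 by ring.
  have := sqr_ge0 (2 * lam * t); lra.
- apply: sqr_le_norm; first by rewrite !mulr_ge0 // ltW.
  have h : d ^+ 2 <= 2 * C * (16 * t ^+ 4).
    rewrite -(ler_pM2r A0); apply: le_trans b4 _.
    by rewrite expr2 mulrA -[leRHS]mulrA ler_pM2l ?mulr_gt0 // ltW.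
  have -> : (12 * lam * t ^+ 3) ^+ 2 = 36 * ((2 * lam * t) ^+ 2 * t ^+ 4) by ring.
  have : C * t ^+ 4 <= (2 * lam * t) ^+ 2 * t ^+ 4 by rewrite ler_pM2r // exprn_gt0.
  have : 0 <= (2 * lam * t) ^+ 2 * t ^+ 4 by rewrite mulr_ge0 ?sqr_ge0 // exprn_ge0 // ltW.
  lra.
- have -> : ((if ka == 9 then 9 else 1) * ca x * cd x - cb x * cc x)%:~R = ka * a * d - b * c.
    rewrite rmorphB !rmorphM /=; congr (_ * _ * _ - _).
    by case: hka => ->; case: eqP => //; lra.
  apply: le_trans b5 _; move: Al; rewrite expr_div_n => Al.
  have := sqr_ge0 (lam / t); rewrite expr_div_n; lra.
Qed.

(** * Congruence conditions on the coefficients, and the count in a box *)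

Definition hess_dvd (m : nat) (x : cubic_form int) : bool :=
  [&& (m %| hessA x)%Z, (m %| hessB x)%Z & (m %| hessC x)%Z].

(** At a prime dividing both a and b, neither the Hessian nor the discriminant restricts d modulo p.
    Forms are therefore counted for a fixed product D of such primes; in exchange, a and b are
    multiples of D. *)
Definition Dof (l : seq nat) (x : cubic_form int) : nat :=
  (\prod_(p <- l | (p %| ca x)%Z && (p %| cb x)%Z) p)%N.

Definition good_primes (l : seq nat) : Prop :=
  uniq l /\ (forall p, p \in l -> prime p /\ (5 <= p)%N).

Lemma ndvd_small (p : nat) (k : nat) : prime p -> (5 <= p)%N -> k \in [:: 2; 3; 4; 9; 27]%N -> ~~ (p %| Posz k)%Z.
Proof.
move=> pp p5; rewrite dvdzE /=.
have n2 : ~~ (p %| 2)%N by rewrite gtnNdvd //; lia.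
have n3 : ~~ (p %| 3)%N by rewrite gtnNdvd //; lia.
rewrite !inE => /orP[/eqP->//|/orP[/eqP->//|/orP[/eqP->|/orP[/eqP->|/eqP->]]]].
- by rewrite -[4%N]/(2 ^ 2)%N Euclid_dvdX // negb_and n2.
- by rewrite -[9%N]/(3 ^ 2)%N Euclid_dvdX // negb_and n3.
- by rewrite -[27%N]/(3 ^ 3)%N Euclid_dvdX // negb_and n3.
Qed.

(** The Hessian determines c modulo p from a and b: through b^2 - 3 a c if p does not divide a;
    otherwise p divides b, and then c^2 - 3 b d forces p to divide c. *)
Lemma hess_dvd_c (p : nat) (x y : cubic_form int) : prime p -> (5 <= p)%N ->
  hess_dvd p x -> hess_dvd p y -> ca x = ca y -> cb x = cb y ->
  (p %| (cc x - cc y)%R)%Z.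
Proof.
move=> pp p5; case: x => a b c d; case: y => a' b' c' d' /and3P[/= + _ +] /and3P[/= + _ +] e1 e2.
rewrite /hessA /hessC /=; rewrite -{}e1 -{}e2 => h1 h2 h3 h4.
have [pa|npa] := boolP (p %| a)%Z.
  have pb : (p %| b)%Z.
    rewrite -(@dvdzX_prime p b 2) //.
    have -> : b ^+ 2 = (b ^+ 2 - 3 * a * c) + 3 * c * a by ring.
    by rewrite rpredD // dvdz_mull.
  have pc (z w : int) : (p %| (z ^+ 2 - 3 * b * w)%R)%Z -> (p %| z)%Z.
    move=> h; rewrite -(@dvdzX_prime p z 2) //.
    have -> : z ^+ 2 = (z ^+ 2 - 3 * b * w) + 3 * w * b by ring.
    by rewrite rpredD // dvdz_mull.
  by rewrite rpredB ?(pc c d) ?(pc c' d').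
have : (p %| (3 * a * (c - c'))%R)%Z.
  have -> : 3 * a * (c - c') = (b ^+ 2 - 3 * a * c') - (b ^+ 2 - 3 * a * c) by ring.
  by rewrite rpredB.
rewrite dvdz_coprime // dvdzM_prime // negb_or npa andbT.
exact: (@ndvd_small p 3).
Qed.

Lemma hess_dvd_ab (p : nat) (x : cubic_form int) : prime p ->
  hess_dvd p x -> (p %| ca x)%Z -> (p %| cb x)%Z.
Proof.
move=> pp /and3P[+ _ _] pa; rewrite /hessA => h; rewrite -(@dvdzX_prime p (cb x) 2) //.
have -> : cb x ^+ 2 = (cb x ^+ 2 - 3 * ca x * cc x) + 3 * cc x * ca x by ring.
by rewrite rpredD // dvdz_mull.
Qed.

Lemma hess_dvd_d (p : nat) (a b c d1 d2 : int) : prime p -> (5 <= p)%N -> ~~ (p %| a)%Z ->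
  hess_dvd p (CubicForm a b c d1) -> hess_dvd p (CubicForm a b c d2) -> (p %| (d1 - d2)%R)%Z.
Proof.
move=> pp p5 na /and3P[_ + _] /and3P[_ + _]; rewrite /hessB /= => h1 h2.
have : (p %| (9 * a * (d1 - d2))%R)%Z.
  have -> : 9 * a * (d1 - d2) = (b * c - 9 * a * d2) - (b * c - 9 * a * d1) by ring.
  by rewrite rpredB.
rewrite dvdz_coprime // dvdzM_prime // negb_or na andbT.
exact: (@ndvd_small p 9).
Qed.

(** As a polynomial in d the discriminant has degree 2 with leading coefficient -27 a^2, and if p
    divides a it becomes linear modulo p with coefficient -4 b^3. Unless p divides a and b, it has
    at most two roots modulo p. *)
Lemma disc_dvd_d (p : nat) (a b c d1 d2 d3 : int) : prime p -> (5 <= p)%N ->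
  ~~ ((p %| a)%Z && (p %| b)%Z) ->
  (p %| form_disc (CubicForm a b c d1))%Z -> (p %| form_disc (CubicForm a b c d2))%Z ->
  (p %| form_disc (CubicForm a b c d3))%Z ->
  [|| (p %| (d1 - d2)%R)%Z, (p %| (d1 - d3)%R)%Z | (p %| (d2 - d3)%R)%Z].
Proof.
move=> pp p5 nab; rewrite /form_disc => h1 h2 h3.
have [pa|na] := boolP (p %| a)%Z.
  rewrite pa /= in nab; apply/orP; left.
  have : (p %| (4 * b ^+ 3 * (d1 - d2))%R)%Z.
    have -> : 4 * b ^+ 3 * (d1 - d2) =
      (b ^+ 2 * c ^+ 2 - 4 * a * c ^+ 3 - 4 * b ^+ 3 * d2
          - 27 * a ^+ 2 * d2 ^+ 2 + 18 * a * b * c * d2)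
       - (b ^+ 2 * c ^+ 2 - 4 * a * c ^+ 3 - 4 * b ^+ 3 * d1
          - 27 * a ^+ 2 * d1 ^+ 2 + 18 * a * b * c * d1)
       + (27 * a * (d2 ^+ 2 - d1 ^+ 2) - 18 * b * c * (d2 - d1)) * a by ring.
    by rewrite rpredD ?rpredB // dvdz_mull.
  rewrite dvdz_coprime // dvdzM_prime // negb_or dvdzX_prime // nab andbT.
  exact: (@ndvd_small p 4).
have [//|n12] := boolP (p %| (d1 - d2)%R)%Z.
have [//|n13] := boolP (p %| (d1 - d3)%R)%Z => /=.
have q (e : int) : ~~ (p %| (d1 - e)%R)%Z -> (p %| (b ^+ 2 * c ^+ 2 - 4 * a * c ^+ 3 - 4 * b ^+ 3 * e
          - 27 * a ^+ 2 * e ^+ 2 + 18 * a * b * c * e)%R)%Z ->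
     (p %| (- 27 * a ^+ 2 * (d1 + e) + 18 * a * b * c - 4 * b ^+ 3)%R)%Z.
  move=> ne he; rewrite -(@dvdz_coprime p (d1 - e)) //.
  have -> : (d1 - e) * (- 27 * a ^+ 2 * (d1 + e) + 18 * a * b * c - 4 * b ^+ 3) =
     (b ^+ 2 * c ^+ 2 - 4 * a * c ^+ 3 - 4 * b ^+ 3 * d1
          - 27 * a ^+ 2 * d1 ^+ 2 + 18 * a * b * c * d1) -
     (b ^+ 2 * c ^+ 2 - 4 * a * c ^+ 3 - 4 * b ^+ 3 * e
          - 27 * a ^+ 2 * e ^+ 2 + 18 * a * b * c * e) by ring.
  by rewrite rpredB.
have : (p %| (27 * a ^+ 2 * (d2 - d3))%R)%Z.
  have -> : 27 * a ^+ 2 * (d2 - d3) = (- 27 * a ^+ 2 * (d1 + d3) + 18 * a * b * c - 4 * b ^+ 3)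
    - (- 27 * a ^+ 2 * (d1 + d2) + 18 * a * b * c - 4 * b ^+ 3) by ring.
  by rewrite rpredB ?q.
rewrite dvdz_coprime // dvdzM_prime // negb_or dvdzX_prime // na andbT.
exact: (@ndvd_small p 27).
Qed.

Lemma dvd_prod_seq (l : seq nat) p : p \in l -> (p %| \prod_(q <- l) q)%N.
Proof. by move=> pl; rewrite (big_rem p) //= dvdn_mulr. Qed.

Lemma hess_dvd_trans (p m : nat) x : (p %| m)%N -> hess_dvd m x -> hess_dvd p x.
Proof.
move=> pm /and3P[h1 h2 h3]; have pm' : (p %| Posz m)%Z by rewrite dvdzE.
by apply/and3P; split; apply: dvdz_trans pm' _.
Qed.

Lemma Dof_dvd l x : good_primes l -> (Dof l x %| ca x)%Z /\ (Dof l x %| cb x)%Z.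
Proof.
move=> [ul pl]; rewrite /Dof -big_filter; split; apply: prod_primes_dvd; rewrite ?filter_uniq //.
- by apply/allP => p; rewrite mem_filter => /andP[_ /pl[]].
- by move=> p; rewrite mem_filter => /andP[/andP[]].
- by apply/allP => p; rewrite mem_filter => /andP[_ /pl[]].
- by move=> p; rewrite mem_filter => /andP[/andP[]].
Qed.

Lemma Dof_gt0 l x : good_primes l -> (0 < Dof l x)%N.
Proof.
move=> [ul pl]; rewrite /Dof -big_filter prod_primes_gt0 //.
by apply/allP => p; rewrite mem_filter => /andP[_ /pl[]].
Qed.

Definition good_form (R : realType) (lam : R) k ka (ms ns : seq nat) (D : nat) (x : cubic_form int) : Prop :=
  [/\ ca x != 0, in_dbox lam k ka x, hess_dvd (\prod_(p <- ms) p)%N x,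
      ((\prod_(p <- ns) p)%N %| form_disc x)%Z & Dof (ms ++ ns) x = D].

Lemma cubic_form_eta (A : Type) (x : cubic_form A) : x = CubicForm (ca x) (cb x) (cc x) (cd x).
Proof. by case: x. Qed.

Lemma stage_d (R : realType) (lam : R) k ka ms ns D S a b c : 0 < lam ->
  good_primes (ms ++ ns) -> uniq S ->
  {in S, forall x, good_form lam k ka ms ns D x} ->
  {in S, forall x, ca x = a} -> {in S, forall x, cb x = b} -> {in S, forall x, cc x = c} ->
  (size S)%:R <= 2 ^+ size (ms ++ ns) *
    (24 * Num.sqrt (lam ^+ 3 * 2 ^+ k) / Num.sqrt (absz a)%:R * D%:R
        / ((\prod_(p <- ms) p)%N%:R * (\prod_(p <- ns) p)%N%:R) + 1).
Proof.
move=> l0 gp uS gS ea eb ec; have [ul pl] := gp.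
have rhs0 : 0 <= 24 * Num.sqrt (lam ^+ 3 * 2 ^+ k) / Num.sqrt (absz a)%:R * D%:R
        / ((\prod_(p <- ms) p)%N%:R * (\prod_(p <- ns) p)%N%:R).
  by rewrite !mulr_ge0 ?sqrtr_ge0 ?invr_ge0 ?sqrtr_ge0 // mulr_ge0.
have [->|Sn] := eqVneq S [::].
  by rewrite mulr_ge0 ?exprn_ge0 // addr_ge0.
have [x0 x0S] : exists x0, x0 \in S by case: S Sn {uS gS ea eb ec} => // x S _; exists x; rewrite mem_head.
pose cond (p : nat) := (p %| a)%Z && (p %| b)%Z.
pose ps := [seq p <- ms ++ ns | ~~ cond p].
have eD : D = (\prod_(p <- ms ++ ns | cond p) p)%N.
  by have [_ _ _ _ <-] := gS _ x0S; rewrite /Dof (ea _ x0S) (eb _ x0S).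
(* Only the primes outside D restrict d, so the modulus for d is m n / D. *)
have mn : ((\prod_(p <- ms) p) * (\prod_(p <- ns) p) = D * \prod_(p <- ps) p)%N.
  by rewrite eD /ps big_filter -big_cat (bigID cond).
have pps : all prime ps by apply/allP => p; rewrite mem_filter => /andP[_ /pl[]].
have ups : uniq ps by rewrite filter_uniq.
have pp0 : (0 < \prod_(p <- ps) p)%N by apply: prod_primes_gt0.
have D0 : (0 < D)%N by have [_ _ _ _ <-] := gS _ x0S; apply: Dof_gt0.
have a0 : a != 0 by have [h _ _ _ _] := gS _ x0S; rewrite -(ea _ x0S).
have inj : {in S &, injective (@cd int)}.
  move=> x y xS yS e; rewrite (cubic_form_eta x) (cubic_form_eta y) e.
  by rewrite (ea _ xS) (ea _ yS) (eb _ xS) (eb _ yS) (ec _ xS) (ec _ yS).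
have xE x : x \in S -> x = CubicForm a b c (cd x).
  by move=> xS; rewrite [LHS]cubic_form_eta (ea _ xS) (eb _ xS) (ec _ xS).
rewrite -(size_map (@cd int)).
apply: le_trans (@count_d R (map (@cd int) S) ps a ka (b * c) lam (2 ^+ k) l0 _ a0 _ ups pps _ _ _) _.
- by rewrite exprn_gt0.
- by rewrite map_inj_in_uniq.
- by move=> _ /mapP[x xS ->]; have [_ [_ _ _ h _] _ _ _] := gS _ xS.
- move=> _ /mapP[x xS ->]; have [_ [_ _ _ _ h] _ _ _] := gS _ xS.
  by move: h; rewrite (ea _ xS) (eb _ xS) (ec _ xS).
- move=> p pps' _ _ _ /mapP[x xS ->] /mapP[y yS ->] /mapP[z zS ->].
  move: pps'; rewrite mem_filter => /andP[ncond pms]; have [pp p5] := pl _ pms.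
  have [_ _ hx nx _] := gS _ xS; have [_ _ hy ny _] := gS _ yS; have [_ _ hz nz _] := gS _ zS.
  move: pms; rewrite mem_cat => /orP[pm|pn].
    have pd := dvd_prod_seq pm.
    have {}hx := hess_dvd_trans pd hx; have {}hy := hess_dvd_trans pd hy.
    have npa : ~~ (p %| a)%Z.
      apply: contra ncond => pa; rewrite /cond pa /= -(eb _ xS).
      by apply: hess_dvd_ab hx _ => //; rewrite (ea _ xS).
    by rewrite (@hess_dvd_d p a b c) // -xE.
  have pd : (p %| Posz (\prod_(p <- ns) p)%N)%Z by rewrite dvdzE /= dvd_prod_seq.
  apply: (@disc_dvd_d p a b c) => //; rewrite -xE //; exact: dvdz_trans pd _.
apply: ler_pM.
- by rewrite exprn_ge0.
- by rewrite addr_ge0 // !mulr_ge0 ?sqrtr_ge0 ?invr_ge0 ?sqrtr_ge0.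
- by apply: ler_weXn2l; rewrite ?ler1n // size_filter count_size.
rewrite lerD2r -natrM mn natrM invfM mulrA [X in _ <= X * _]mulfK //.
by rewrite pnatr_eq0 -lt0n.
Qed.

(** By [hess_dvd_c] the values of c lie in a single class modulo m. *)
Lemma stage_c (R : realType) (lam : R) k ka ms ns D S a b (X : R) : 0 < lam ->
  good_primes (ms ++ ns) -> uniq S -> 0 <= X ->
  {in S, forall x, good_form lam k ka ms ns D x} ->
  {in S, forall x, ca x = a} -> {in S, forall x, cb x = b} ->
  (forall S' c, uniq S' -> {subset S' <= S} -> {in S', forall x, cc x = c} -> (size S')%:R <= X) ->
  (size S)%:R <= (24 * lam * 2 ^+ k / (\prod_(p <- ms) p)%N%:R + 1) * X.
Proof.
move=> l0 gp uS X0 gS ea eb hX; have [ul pl] := gp.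
have ulm : uniq ms by move: ul; rewrite cat_uniq => /and3P[].
have plm p : p \in ms -> prime p /\ (5 <= p)%N by move=> pm; apply: pl; rewrite mem_cat pm.
have allm : all prime ms by apply/allP => p /plm[].
apply: le_trans (@size_le_fiber_const R _ _ (@cc int) S (undup (map (@cc int) S)) X X0 _ _) _.
- by move=> u; rewrite mem_undup.
- move=> u _; rewrite -size_filter; apply: (hX _ u); rewrite ?filter_uniq //.
    by move=> x; rewrite mem_filter => /andP[].
  by move=> x; rewrite mem_filter => /andP[/eqP].
apply: ler_wpM2r => //; apply: count_interval.
- exact: prod_primes_gt0.
- exact: undup_uniq.
- by rewrite !mulr_ge0 ?exprn_ge0 // ltW.
- move=> u v; rewrite !mem_undup => /mapP[x xS ->] /mapP[y yS ->].
  apply: prod_primes_dvd => // p pm; have [pp p5] := plm _ pm.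
  have [_ _ hx _ _] := gS _ xS; have [_ _ hy _ _] := gS _ yS.
  apply: hess_dvd_c; rewrite ?(ea _ xS) ?(ea _ yS) ?(eb _ xS) ?(eb _ yS) //.
    exact: hess_dvd_trans (dvd_prod_seq pm) hx.
  exact: hess_dvd_trans (dvd_prod_seq pm) hy.
- move=> u v; rewrite !mem_undup => /mapP[x xS ->] /mapP[y yS ->].
  have [_ [_ _ hx _ _] _ _ _] := gS _ xS; have [_ [_ _ hy _ _] _ _ _] := gS _ yS.
  rewrite rmorphB /=; apply: le_trans (ler_normB _ _) _.
  by move: hx hy; set t := 2 ^+ k => hx hy; lra.
Qed.

Lemma stage_b (R : realType) (lam : R) k ka ms ns D S a (X : R) : 0 < lam ->
  good_primes (ms ++ ns) -> uniq S -> 0 <= X ->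
  {in S, forall x, good_form lam k ka ms ns D x} ->
  {in S, forall x, ca x = a} ->
  (forall S' b, uniq S' -> {subset S' <= S} -> {in S', forall x, cb x = b} -> (size S')%:R <= X) ->
  (size S)%:R <= (36 * lam / 2 ^+ k / D%:R) * X.
Proof.
move=> l0 gp uS X0 gS ea hX.
have t0 : 0 < 2 ^+ k :> R by rewrite exprn_gt0.
have [->|Sn] := eqVneq S [::].
  by rewrite !mulr_ge0 ?invr_ge0 ?exprn_ge0 // ltW.
have [x0 x0S] : exists x0, x0 \in S by case: S Sn {uS gS ea hX} => // x S _; exists x; rewrite mem_head.
have D0 : (0 < D)%N by have [_ _ _ _ <-] := gS _ x0S; apply: Dof_gt0.
have DR : 0 < D%:R :> R by rewrite ltr0n.
apply: le_trans (@size_le_fiber_const R _ _ (@cb int) S (undup (map (@cb int) S)) X X0 _ _) _.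
- by move=> u; rewrite mem_undup.
- move=> u _; rewrite -size_filter; apply: (hX _ u); rewrite ?filter_uniq //.
    by move=> x; rewrite mem_filter => /andP[].
  by move=> x; rewrite mem_filter => /andP[/eqP].
apply: ler_wpM2r => //.
(* D divides the nonzero a, so D is at most 12 lam / t^3; this absorbs the additive 1 of the count
   of the multiples b of D. *)
have Dl : 1 <= 12 * lam / 2 ^+ k / D%:R.
  rewrite ler_pdivlMr // mul1r.
  have [a0 [ha _ _ _ _] _ _ eD] := gS _ x0S; have [da _] := Dof_dvd x0 gp; rewrite eD in da.
  have : (D <= absz (ca x0))%N by apply: dvdn_leq; [rewrite absz_gt0|rewrite dvdzE in da].
  rewrite -(ler_nat R) natr_absz intr_norm => /le_trans; apply.
  apply: le_trans ha _; rewrite ler_pM2l ?mulr_gt0 // lef_pV2 ?posrE ?exprn_gt0 //.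
  by rewrite -[leLHS]expr1 ler_weXn2l // exprn_ege1 // ler1n.
apply: le_trans (_ : 24 * lam / 2 ^+ k / D%:R + 1 <= _); last first.
  have -> : 24 * lam / 2 ^+ k / D%:R = 2 * (12 * lam / 2 ^+ k / D%:R) by ring.
  have -> : 36 * lam / 2 ^+ k / D%:R = 3 * (12 * lam / 2 ^+ k / D%:R) by ring.
  lra.
apply: count_interval => //.
- exact: undup_uniq.
- by rewrite !mulr_ge0 ?invr_ge0 // ltW.
- move=> u v; rewrite !mem_undup => /mapP[x xS ->] /mapP[y yS ->].
  have [_ _ _ _ ex] := gS _ xS; have [_ _ _ _ ey] := gS _ yS.
  have [_ dx] := Dof_dvd x gp; have [_ dy] := Dof_dvd y gp.
  by rewrite ex in dx; rewrite ey in dy; rewrite rpredB.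
- move=> u v; rewrite !mem_undup => /mapP[x xS ->] /mapP[y yS ->].
  have [_ [_ hx _ _ _] _ _ _] := gS _ xS; have [_ [_ hy _ _ _] _ _ _] := gS _ yS.
  rewrite rmorphB /=; apply: le_trans (ler_normB _ _) _.
  by move: hx hy; set t := 2 ^+ k => hx hy; lra.
Qed.

Definition main_bound (R : realType) (lam m n : R) : R :=
  lam ^+ 4 / (m ^+ 2 * n) + lam ^+ 3 / m + lam ^+ 2.

(** The factor D lost in [stage_d] is regained because a runs over multiples of D: the sum of
    |a|^(-1/2) over them is O((lam / t^3)^(1/2) / D). The surviving 1 / t makes the sum over the
    dyadic boxes converge. *)
Lemma stage_a (R : realType) (lam : R) k ka ms ns D S : 0 < lam ->
  good_primes (ms ++ ns) -> uniq S ->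
  {in S, forall x, good_form lam k ka ms ns D x} ->
  (size S)%:R <= 2 ^+ size (ms ++ ns) * 10 ^+ 6 / 2 ^+ k *
    main_bound lam (\prod_(p <- ms) p)%N%:R (\prod_(p <- ns) p)%N%:R.
Proof.
move=> l0 gp uS gS.
set m : R := (\prod_(p <- ms) p)%N%:R; set n : R := (\prod_(p <- ns) p)%N%:R.
set t : R := 2 ^+ k; set w : R := 2 ^+ size (ms ++ ns).
have t0 : 0 < t by rewrite exprn_gt0.
have t1 : 1 <= t by rewrite exprn_ege1 // ler1n.
have w0 : 0 < w by rewrite exprn_gt0.
have [ul pl] := gp.
have m1 : 1 <= m.
  by rewrite ler1n prod_primes_gt0 //; apply/allP => p pm; have [] := pl p; rewrite ?mem_cat ?pm.
have n1 : 1 <= n.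
  by rewrite ler1n prod_primes_gt0 //; apply/allP => p pm; have [] := pl p; rewrite ?mem_cat ?pm ?orbT.
have m0 : 0 < m by lra.
have n0 : 0 < n by lra.
have mb0 : 0 <= main_bound lam m n.
  by rewrite /main_bound !addr_ge0 ?divr_ge0 ?mulr_ge0 ?exprn_ge0 // ltW.
have [->|Sn] := eqVneq S [::].
  by rewrite !mulr_ge0 ?invr_ge0 // ltW.
have [x0 x0S] : exists x0, x0 \in S by case: S Sn {uS gS} => // x S _; exists x; rewrite mem_head.
have D0 : (0 < D)%N by have [_ _ _ _ <-] := gS _ x0S; apply: Dof_gt0.
have DR : 0 < D%:R :> R by rewrite ltr0n.
have D1 : 1 <= D%:R :> R by rewrite ler1n.
pose G (a : nat) : R := 36 * lam / t / D%:R * ((24 * lam * t / m + 1) *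
   (w * (24 * Num.sqrt (lam ^+ 3 * t) / Num.sqrt a%:R * D%:R / (m * n) + 1))).
have ct0 : 0 <= 24 * lam * t / m + 1 by rewrite addr_ge0 // !mulr_ge0 ?invr_ge0 // ltW.
have cd0 (a : nat) : 0 <= 24 * Num.sqrt (lam ^+ 3 * t) / Num.sqrt a%:R * D%:R / (m * n) + 1.
  by rewrite addr_ge0 // !mulr_ge0 ?invr_ge0 ?sqrtr_ge0 // mulr_ge0 // ltW.
have G0 a : 0 <= G a.
  by rewrite /G; apply: mulr_ge0; [rewrite !mulr_ge0 ?invr_ge0 // ltW|apply: mulr_ge0 => //; apply: mulr_ge0 => //; rewrite ltW].
apply: le_trans (@size_le_fiber R _ _ (@ca int) S (fun a => G (absz a)) _) _.
  move=> a _; rewrite -size_filter.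
  have subf (T : eqType) (P : pred T) (l : seq T) : {subset seq.filter P l <= l}.
    by move=> x; rewrite mem_filter => /andP[].
  apply: (@stage_b R lam k ka ms ns D _ a) => //.
  - by rewrite filter_uniq.
  - by apply: mulr_ge0 => //; apply: mulr_ge0 => //; rewrite ltW.
  - by move=> x /subf; apply: gS.
  - by move=> x; rewrite mem_filter => /andP[/eqP].
  move=> S1 b uS1 sub1 eb.
  apply: (@stage_c R lam k ka ms ns D _ a b) => //.
  - by apply: mulr_ge0 => //; rewrite ltW.
  - by move=> x /sub1/subf; apply: gS.
  - by move=> x /sub1; rewrite mem_filter => /andP[/eqP].
  move=> S2 c uS2 sub2 ec.
  apply: (@stage_d R lam k ka ms ns D _ a b c) => //.
  - by move=> x /sub2/sub1/subf; apply: gS.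
  - by move=> x /sub2/sub1; rewrite mem_filter => /andP[/eqP].
  - by move=> x /sub2; apply: eb.
apply: le_trans (@sum_multiples R _ D (12 * lam / t ^+ 3) G D0 (undup_uniq _) G0 _) _.
  move=> a; rewrite mem_undup => /mapP[x xS ->].
  have [a0 [ha _ _ _ _] _ _ eD] := gS _ xS; have [da _] := Dof_dvd x gp; rewrite eD in da.
  by split.
set N := Num.truncn _.
have NE : N%:R <= 12 * lam / t ^+ 3 / D%:R by rewrite truncn_le // !mulr_ge0 ?invr_ge0 ?exprn_ge0 // ltW.
pose ta : R := Num.sqrt (lam ^+ 3 * t).
have sD : Num.sqrt D%:R ^+ 2 = D%:R :> R by rewrite sqr_sqrtr.
have sD0 : 0 < Num.sqrt D%:R :> R by rewrite sqrtr_gt0.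
have sumG : \sum_(1 <= i < N.+1) G (D * i)%N =
   36 * lam / t / D%:R * (24 * lam * t / m + 1) * w *
   (24 * ta / Num.sqrt D%:R * D%:R / (m * n) * (\sum_(1 <= i < N.+1) (Num.sqrt i%:R)^-1) + N%:R).
  transitivity (\sum_(1 <= i < N.+1) (36 * lam / t / D%:R * (24 * lam * t / m + 1) * w *
      (24 * ta / Num.sqrt D%:R * D%:R / (m * n) * (Num.sqrt i%:R)^-1 + 1))).
    apply: eq_bigr => i _; rewrite /G natrM sqrtrM // invfM -/ta; ring.
  rewrite -mulr_sumr big_split /= -mulr_sumr; congr (_ * (_ + _)).
  by rewrite sumr_const_nat subSS subn0.
rewrite sumG.
have s1 : \sum_(1 <= i < N.+1) (Num.sqrt i%:R)^-1 <= 2 * Num.sqrt (12 * lam / t ^+ 3 / D%:R) :> R.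
  apply: le_trans (sum_inv_sqrt _ _) _; rewrite ler_pM2l //; exact: ler_wsqrtr.
have s2 : ta * Num.sqrt (12 * lam / t ^+ 3 / D%:R) <= 4 * lam ^+ 2 / t / Num.sqrt D%:R.
  rewrite /ta -sqrtrM; last by rewrite mulr_ge0 ?exprn_ge0 // ltW.
  rewrite -[leRHS]ger0_norm; last by rewrite !mulr_ge0 ?invr_ge0 ?sqrtr_ge0 ?exprn_ge0 // ltW.
  rewrite -sqrtr_sqr ler_wsqrtr //.
  have -> : (4 * lam ^+ 2 / t / Num.sqrt D%:R) ^+ 2 = 16 * (lam ^+ 4 / t ^+ 2 / D%:R).
    by rewrite -[in RHS]sD; field; rewrite !gt_eqF.
  have -> : lam ^+ 3 * t * (12 * lam / t ^+ 3 / D%:R) = 12 * (lam ^+ 4 / t ^+ 2 / D%:R).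
    by field; rewrite !gt_eqF.
  have : 0 <= lam ^+ 4 / t ^+ 2 / D%:R by rewrite !mulr_ge0 ?invr_ge0 ?exprn_ge0 // ltW.
  lra.
have s3 : 24 * ta / Num.sqrt D%:R * D%:R / (m * n) * (\sum_(1 <= i < N.+1) (Num.sqrt i%:R)^-1)
   <= 192 * (lam ^+ 2 / (t * m * n)).
  apply: le_trans (_ : 24 * ta / Num.sqrt D%:R * D%:R / (m * n) * (2 * Num.sqrt (12 * lam / t ^+ 3 / D%:R)) <= _).
    by apply: ler_wpM2l => //; rewrite !mulr_ge0 ?invr_ge0 ?sqrtr_ge0 // mulr_ge0 // ltW.
  have -> : 24 * ta / Num.sqrt D%:R * D%:R / (m * n) * (2 * Num.sqrt (12 * lam / t ^+ 3 / D%:R)) =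
     (48 * Num.sqrt D%:R / (m * n)) * (ta * Num.sqrt (12 * lam / t ^+ 3 / D%:R)).
    by rewrite -[X in X / (m * n)]mulrA -{2}sD; field; rewrite !gt_eqF.
  apply: le_trans (_ : (48 * Num.sqrt D%:R / (m * n)) * (4 * lam ^+ 2 / t / Num.sqrt D%:R) <= _).
    by apply: ler_wpM2l => //; rewrite !mulr_ge0 ?invr_ge0 ?sqrtr_ge0 // mulr_ge0 // ltW.
  by rewrite le_eqVlt; apply/orP; left; apply/eqP; field; rewrite !gt_eqF.
have s4 : N%:R <= 12 * (lam / t ^+ 3).
  apply: le_trans NE _; by rewrite ler_pdivrMr // mulrA ler_peMr // !mulr_ge0 ?invr_ge0 ?exprn_ge0 // ltW.
have s5 : 36 * lam / t / D%:R <= 36 * (lam / t).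
  by rewrite ler_pdivrMr // mulrA ler_peMr // !mulr_ge0 ?invr_ge0 ?exprn_ge0 // ltW.
have s6 : 24 * lam * t / m + 1 <= 24 * (lam * t / m + 1).
  have : 0 <= lam * t / m by rewrite !mulr_ge0 ?invr_ge0 // ltW.
  have -> : 24 * lam * t / m = 24 * (lam * t / m) by ring.
  lra.
set Z := _ + N%:R.
have Z1 : Z <= 192 * (lam ^+ 2 / (t * m * n) + lam / t ^+ 3).
  rewrite /Z; have : 0 <= lam / t ^+ 3 by rewrite !mulr_ge0 ?invr_ge0 ?exprn_ge0 // ltW.
  lra.
apply: le_trans (_ : 2 * (36 * (lam / t) * (24 * (lam * t / m + 1)) * w * (192 * (lam ^+ 2 / (t * m * n) + lam / t ^+ 3))) <= _).
  rewrite ler_pM2l //; apply: ler_pM => //.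
  - by rewrite !mulr_ge0 ?invr_ge0 // ltW.
  - rewrite /Z addr_ge0 // mulr_ge0 //; last by apply: sumr_ge0 => i _; rewrite invr_ge0 sqrtr_ge0.
    by rewrite !mulr_ge0 ?invr_ge0 ?sqrtr_ge0 // mulr_ge0 // ltW.
  rewrite ler_pM2r //; apply: ler_pM => //; by rewrite !mulr_ge0 ?invr_ge0 // ltW.
have -> : 2 * (36 * (lam / t) * (24 * (lam * t / m + 1)) * w * (192 * (lam ^+ 2 / (t * m * n) + lam / t ^+ 3)))
  = (w / t) * (2 * 36 * 24 * 192 * (lam ^+ 4 / (m ^+ 2 * n) + lam ^+ 3 / m / t ^+ 2 + lam ^+ 3 / m / t / n + lam ^+ 2 / t ^+ 3)).
  by field; rewrite !gt_eqF.
have -> : w * 10 ^+ 6 / t * main_bound lam m n = (w / t) * (10 ^+ 6 * main_bound lam m n).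
  by move: (10 ^+ 6) (main_bound lam m n) => K M; ring.
rewrite ler_pM2l ?divr_gt0 //.
have i1 : lam ^+ 3 / m / t ^+ 2 <= lam ^+ 3 / m.
  rewrite ler_pdivrMr ?exprn_gt0 // ler_peMr //; first by rewrite !mulr_ge0 ?invr_ge0 ?exprn_ge0 // ltW.
  by rewrite exprn_ege1.
have i2 : lam ^+ 3 / m / t / n <= lam ^+ 3 / m.
  rewrite -mulrA -invfM ler_pdivrMr ?mulr_gt0 // ler_peMr //; first by rewrite !mulr_ge0 ?invr_ge0 ?exprn_ge0 // ltW.
  by rewrite mulr_ege1.
have i3 : lam ^+ 2 / t ^+ 3 <= lam ^+ 2.
  by rewrite ler_pdivrMr ?exprn_gt0 // ler_peMr ?sqr_ge0 // exprn_ege1.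
have i4 : 0 <= lam ^+ 4 / (m ^+ 2 * n) by rewrite divr_ge0 ?mulr_ge0 ?exprn_ge0 // ltW.
have i5 : 0 <= lam ^+ 2 by apply: sqr_ge0.
(* The outer 2 is there because two of the four terms are bounded by the same lam^3 / m. *)
have K6 : 2 * (2 * 36 * 24 * 192) <= 10 ^+ 6 :> R by lra.
apply: le_trans (ler_wpM2r mb0 K6); rewrite /main_bound; lra.
Qed.

(** The base 4 is a factor 2 per prime for the value of [Dof] and another for the residues of d. The
    constant 4 comes from the two values of [ka] and from the geometric series over k. *)
Lemma count_anz (R : realType) (lam : R) ms ns (S : seq (cubic_form int)) : 0 < lam ->
  good_primes (ms ++ ns) -> uniq S ->
  {in S, forall x, [/\ ca x != 0, exists k ka, in_dbox lam k ka x,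
     hess_dvd (\prod_(p <- ms) p)%N x & ((\prod_(p <- ns) p)%N %| form_disc x)%Z]} ->
  (size S)%:R <= 4 ^+ size (ms ++ ns) * (4 * 10 ^+ 6) *
    main_bound lam (\prod_(p <- ms) p)%N%:R (\prod_(p <- ns) p)%N%:R.
Proof.
move=> l0 gp uS gS.
set m : R := (\prod_(p <- ms) p)%N%:R; set n : R := (\prod_(p <- ns) p)%N%:R.
set w : R := 2 ^+ size (ms ++ ns); set mb := main_bound lam m n.
have w0 : 0 <= w by rewrite exprn_ge0.
have mb0 : 0 <= mb.
  by rewrite /mb /main_bound !addr_ge0 ?divr_ge0 ?mulr_ge0 ?exprn_ge0 // ltW.
have [|kf hk] := @choice _ _ (fun x (y : nat * bool) => x \in S -> in_dbox lam y.1 y.2 x).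
  move=> x.
  have [xS|nxS] := boolP (x \in S); last by exists (0%N, true).
  by have [_ [k [ka h]] _ _] := gS _ xS; exists (k, ka).
have subf (T : eqType) (P : pred T) (l : seq T) : {subset seq.filter P l <= l}.
  by move=> x; rewrite mem_filter => /andP[].
have -> : 4 ^+ size (ms ++ ns) * (4 * 10 ^+ 6) * mb = (size (subprods (ms ++ ns)))%:R * (2%:R * (2 * (w * 10 ^+ 6 * mb))).
  have -> : (4 : R) = 2 * 2 by ring.
  by rewrite size_subprods natrX exprMn -/w; ring.
have B0 : 0 <= w * 10 ^+ 6 * mb by rewrite !mulr_ge0 ?exprn_ge0.
apply: (@size_le_fiber_const R _ _ (Dof (ms ++ ns)) S) => //; first by rewrite !mulr_ge0.
  by move=> _ /mapP[x xS ->]; apply: mem_subprods.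
move=> D _; rewrite -size_filter -[X in X%:R * _]/(size [:: true; false]).
set S1 := seq.filter _ _.
apply: (@size_le_fiber_const R _ _ (fun x => (kf x).2) S1) => //; first by rewrite !mulr_ge0.
  by move=> b _; rewrite !inE; case: b.
move=> ka _; rewrite -size_filter; set S2 := seq.filter _ _.
apply: le_trans (@size_le_fiber R _ _ (fun x => (kf x).1) S2 (fun k => (2 ^+ k)^-1 * (w * 10 ^+ 6 * mb)) _) _.
  move=> k _; rewrite -size_filter; set S3 := seq.filter _ _.
  have -> : (2 ^+ k)^-1 * (w * 10 ^+ 6 * mb) = w * 10 ^+ 6 / 2 ^+ k * mb by rewrite mulrC mulrAC.
  apply: (@stage_a R lam k ka ms ns D S3) => //; first by rewrite !filter_uniq.
  move=> x; rewrite !mem_filter => /andP[/eqP ek /andP[/eqP eka /andP[/eqP eD xS]]].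
  have [a0 _ h1 h2] := gS _ xS; split=> //.
  by have := hk _ xS; rewrite ek eka.
rewrite -mulr_suml; apply: ler_wpM2r => //; apply: sum_geom; exact: undup_uniq.
Qed.

Lemma int_dist_le (b c c' : int) : `|c| <= `|b| -> `|c'| <= `|b| ->
  `|c - c'| <= (2 * absz b)%N.
Proof. lia. Qed.

Lemma coprime_prods (l l' : seq nat) :
  (forall p r, p \in l -> r \in l' -> [/\ prime p, prime r & p != r]) ->
  coprime (\prod_(p <- l) p) (\prod_(p <- l') p).
Proof.
move=> h; rewrite big_seq; elim/big_ind: _; first exact: coprime1n.
  by move=> x y hx hy; rewrite coprimeMl hx.
move=> p pl; rewrite big_seq; elim/big_ind: _; first exact: coprimen1.
  by move=> x y hx hy; rewrite coprimeMr hx.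
by move=> r rl; have [pp pr ne] := h _ _ pl rl; rewrite prime_coprime // dvdn_prime2.
Qed.

(* The forms with a = 0 are the cuspidal ones: for them the discriminant b^2 (c^2 - 4 b d)
   itself bounds d. *)
Lemma count_az (R : realType) (lam : R) ms ns (S : seq (cubic_form int)) : 0 < lam ->
  good_primes (ms ++ ns) -> uniq S ->
  {in S, forall x, [/\ ca x = 0, `|(cb x)%:~R| <= 12 * lam, `|cc x| <= `|cb x|,
     form_disc x != 0 /\ `|(form_disc x)%:~R| <= lam ^+ 4 &
     hess_dvd (\prod_(p <- ms) p)%N x /\ ((\prod_(p <- ns) p)%N %| form_disc x)%Z]} ->
  (size S)%:R <= 4 ^+ size (ms ++ ns) * 10 ^+ 3 *
    main_bound lam (\prod_(p <- ms) p)%N%:R (\prod_(p <- ns) p)%N%:R.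
Proof.
move=> l0 gp uS gS; have [ul pl] := gp.
set mn := (\prod_(p <- ms) p)%N; set nn := (\prod_(p <- ns) p)%N.
set m : R := mn%:R; set n : R := nn%:R; set mb := main_bound lam m n.
set w : R := 2 ^+ size (ms ++ ns).
have w0 : 0 <= w by rewrite exprn_ge0.
have plm p : p \in ms -> prime p /\ (5 <= p)%N by move=> pm; apply: pl; rewrite mem_cat pm.
have pln p : p \in ns -> prime p /\ (5 <= p)%N by move=> pm; apply: pl; rewrite mem_cat pm orbT.
have ulm : uniq ms by move: ul; rewrite cat_uniq => /and3P[].
have uln : uniq ns by move: ul; rewrite cat_uniq => /and3P[].
have allm : all prime ms by apply/allP => p /plm[].
have alln : all prime ns by apply/allP => p /pln[].
have mn0 : (0 < mn)%N by apply: prod_primes_gt0.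
have nn0 : (0 < nn)%N by apply: prod_primes_gt0.
have m0 : 0 < m by rewrite ltr0n.
have n0 : 0 < n by rewrite ltr0n.
have m1 : 1 <= m by rewrite ler1n.
have n1 : 1 <= n by rewrite ler1n.
have mb0 : 0 <= mb.
  by rewrite /mb /main_bound !addr_ge0 ?divr_ge0 ?mulr_ge0 ?exprn_ge0 // ltW.
have discE x : ca x = 0 -> form_disc x = cb x ^+ 2 * (cc x ^+ 2 - 4 * cb x * cd x).
  by case: x => a b c d /= ->; ring.
have bn0 x : x \in S -> cb x != 0.
  move=> xS; have [a0 _ _ [d0 _] _] := gS _ xS; apply: contraNneq d0 => b0.
  by rewrite discE // b0 expr0n /= mul0r.
have mb_dvd x : x \in S -> (mn %| cb x)%Z.
  move=> xS; have [a0 _ _ _ [hx _]] := gS _ xS.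
  apply: prod_primes_dvd => // p pm; have [pp p5] := plm _ pm.
  by apply: hess_dvd_ab (hess_dvd_trans (dvd_prod_seq pm) hx) _ => //; rewrite a0 dvdz0.
have mc_dvd x y : x \in S -> y \in S -> cb x = cb y -> (mn %| (cc x - cc y)%R)%Z.
  move=> xS yS eb; have [ax _ _ _ [hx _]] := gS _ xS; have [ay _ _ _ [hy _]] := gS _ yS.
  apply: prod_primes_dvd => // p pm; have [pp p5] := plm _ pm.
  apply: hess_dvd_c; rewrite ?ax ?ay //.
    exact: hess_dvd_trans (dvd_prod_seq pm) hx.
  exact: hess_dvd_trans (dvd_prod_seq pm) hy.
have subf (T : eqType) (P : pred T) (l : seq T) : {subset seq.filter P l <= l}.
  by move=> x; rewrite mem_filter => /andP[].
have b1 x : x \in S -> 1 <= (absz (cb x))%:R :> R by move=> xS; rewrite ler1n absz_gt0 bn0.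
pose Db x := (\prod_(p <- ns | (p %| cb x)%Z) p)%N.
have szn : (size (subprods ns))%:R <= w.
  by rewrite size_subprods natrX; apply: ler_weXn2l; rewrite ?ler1n // size_cat leq_addl.
apply: le_trans (_ : (size (subprods ns))%:R * (w * (10 ^+ 3 * mb)) <= _); last first.
  have -> : 4 ^+ size (ms ++ ns) * 10 ^+ 3 * mb = w * (w * (10 ^+ 3 * mb)).
    have -> : (4 : R) = 2 * 2 by ring.
    by rewrite exprMn -/w !mulrA.
  by apply: ler_wpM2r => //; rewrite !mulr_ge0 // exprn_ge0.
apply: (@size_le_fiber_const R _ _ Db S); first by rewrite !mulr_ge0 // exprn_ge0.
  by move=> _ /mapP[x xS ->]; apply: mem_subprods.
move=> D /mapP[x0 x0S eD0]; rewrite -size_filter; set S1 := seq.filter _ _.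
have uS1 : uniq S1 by rewrite filter_uniq.
have S1P x : x \in S1 -> Db x = D /\ x \in S by rewrite mem_filter => /andP[/eqP].
have DbE x : Db x = (\prod_(p <- [seq p : nat <- ns | (p %| cb x)%Z]) p)%N by rewrite big_filter.
have Dpos : (0 < D)%N.
  by rewrite eD0 DbE prod_primes_gt0 //; apply/allP => p /subf/(allP alln).
have DR : 0 < D%:R :> R by rewrite ltr0n.
have D1 : 1 <= D%:R :> R by rewrite ler1n.
have Ddvd x : x \in S1 -> (D %| cb x)%Z.
  move=> /S1P[<- xS]; rewrite DbE; apply: prod_primes_dvd.
  - by rewrite filter_uniq.
  - by apply/allP => p /subf/(allP alln).
  - by move=> p; rewrite mem_filter => /andP[].
have cop : coprime mn D.
  rewrite eD0 DbE; apply: coprime_prods => p r pm rn.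
  split; [exact: (allP allm)|exact: (allP alln _ (subf _ _ _ _ rn))|].
  move: ul; rewrite cat_uniq => /and3P[_ /hasPn h _]; apply/eqP => e.
  by have := h _ (subf _ _ _ _ rn); rewrite /= -e pm.
have mD x : x \in S1 -> ((mn * D)%N %| cb x)%Z.
  move=> xS1; rewrite PoszM Gauss_dvdz ?coprimezE //.
  by rewrite mb_dvd ?Ddvd //; have [] := S1P _ xS1.
(* Bound for the pairs (c, d) over a given b. From |c| <= |b| there are at most 2 |b| / m + 1 values
   of c, and m <= |b|. Two discriminants with equal b and c differ by 4 b^3 (d - d'), which confines
   d to length lam^4 / (2 |b|^3). *)
pose G (b : nat) : R := 3 * b%:R / m * (w * (lam ^+ 4 / (2 * b%:R ^+ 3) * D%:R / n + 1)).
have G0 b : 0 <= G b.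
  rewrite /G mulr_ge0 //; first by rewrite !mulr_ge0 ?invr_ge0 // ltW.
  rewrite mulr_ge0 // addr_ge0 // !mulr_ge0 ?invr_ge0 ?exprn_ge0 // ?mulr_ge0 ?exprn_ge0 // ltW //.
apply: le_trans (@size_le_fiber R _ _ (@cb int) S1 (fun b => G (absz b)) _) _.
  move=> b /mapP[x1 x1S1 eb1]; rewrite -size_filter; set S2 := seq.filter _ _.
  have S2P x : x \in S2 -> cb x = b /\ x \in S1 by rewrite mem_filter => /andP[/eqP].
  have bR : 1 <= (absz b)%:R :> R by rewrite eb1 b1 //; have [] := S1P _ x1S1.
  have X0 : 0 <= w * (lam ^+ 4 / (2 * (absz b)%:R ^+ 3) * D%:R / n + 1).
    rewrite mulr_ge0 // addr_ge0 // !mulr_ge0 ?invr_ge0 ?exprn_ge0 // ?mulr_ge0 ?exprn_ge0 // ltW //.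
  apply: le_trans (@size_le_fiber_const R _ _ (@cc int) S2 (undup (map (@cc int) S2)) _ X0 _ _) _.
  - by move=> u; rewrite mem_undup.
  - move=> c _; rewrite -size_filter; set S3 := seq.filter _ _.
    have S3P x : x \in S3 -> [/\ cc x = c, cb x = b, ca x = 0, Db x = D & x \in S].
      rewrite mem_filter => /andP[/eqP ec /S2P[eb /S1P[eD xS]]].
      by have [a0 _ _ _ _] := gS _ xS.
    have uS3 : uniq S3 by rewrite !filter_uniq.
    have xE x : x \in S3 -> x = CubicForm 0 b c (cd x).
      by move=> /S3P[ec eb ea _ _]; rewrite [LHS]cubic_form_eta ec eb ea.
    rewrite -(size_map (@cd int)).
    pose ps := [seq p : nat <- ns | ~~ (p %| b)%Z].
    have nE : nn = (D * \prod_(p <- ps) p)%N.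
      have [<- _] := S1P _ x1S1.
      by rewrite /Db /ps big_filter /nn (bigID (fun p : nat => (p %| b)%Z)) /= eb1.
    have pps0 : (0 < \prod_(p <- ps) p)%N by apply: prod_primes_gt0; apply/allP => p /subf/(allP alln).
    apply: le_trans (@count_residues R ps (map (@cd int) S3) 1 (lam ^+ 4 / (2 * (absz b)%:R ^+ 3)) _ _ _ _ _ _ _ _ _) _ => //.
    + by rewrite filter_uniq.
    + by apply/allP => p /subf/(allP alln).
    + by apply/allP => p _; rewrite coprime1n.
    + by rewrite map_inj_in_uniq // => x y xS3 yS3 e; rewrite (xE _ xS3) (xE _ yS3) e.
    + by rewrite divr_ge0 ?mulr_ge0 ?exprn_ge0 // ltW.
    + move=> _ _ /mapP[x xS3 ->] /mapP[y yS3 ->].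
      have [ecx ebx eax _ xS] := S3P _ xS3; have [ecy eby eay _ yS] := S3P _ yS3.
      have [_ _ _ [_ dx] _] := gS _ xS; have [_ _ _ [_ dy] _] := gS _ yS.
      have aE : (absz b)%:R = `|b%:~R| :> R by rewrite natr_absz intr_norm.
      rewrite ler_pdivlMr; last by rewrite mulr_gt0 // exprn_gt0 //; lra.
      have : `|(form_disc x - form_disc y)%:~R| <= 2 * lam ^+ 4 :> R.
        by rewrite rmorphB /=; apply: le_trans (ler_normB _ _) _; lra.
      rewrite !discE // ebx eby ecx ecy.
      have -> : b ^+ 2 * (c ^+ 2 - 4 * b * cd x) - b ^+ 2 * (c ^+ 2 - 4 * b * cd y) =
         - (4 * b ^+ 3 * (cd x - cd y)) by ring.
      have -> : (- (4 * b ^+ 3 * (cd x - cd y)))%:~R = - (4 * b%:~R ^+ 3 * (cd x - cd y)%:~R) :> R by ring.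
      have e4 : `|4| = 4 :> R by rewrite ger0_norm.
      rewrite normrN normrM (normrM 4) normrX -aE e4.
      lra.
    + move=> p; rewrite mem_filter => /andP[nb pn] _ _ _ /mapP[x xS3 ->] /mapP[y yS3 ->] /mapP[z zS3 ->].
      have [pp p5] := pln _ pn.
      have pd : (p %| Posz nn)%Z by rewrite dvdzE /= dvd_prod_seq.
      have hd u : u \in S3 -> (p %| form_disc (CubicForm 0 b c (cd u)))%Z.
        by move=> uS3'; rewrite -xE //; have [_ _ _ _ /gS[_ _ _ _ [_ h]]] := S3P _ uS3'; apply: dvdz_trans pd h.
      by apply: (@disc_dvd_d p 0 b c) => //; rewrite ?hd // negb_and nb orbT.
    apply: ler_pM.
    + by rewrite exprn_ge0.
    + by rewrite addr_ge0 // divr_ge0 // divr_ge0 ?mulr_ge0 ?exprn_ge0 // ltW.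
    + by apply: ler_weXn2l; rewrite ?ler1n // size_cat; apply: leq_trans (leq_addl _ _); rewrite size_filter count_size.
    rewrite mul1n lerD2r /n nE natrM.
    set Z : R := (\prod_(p <- ps) p)%N%:R; set V := lam ^+ 4 / _.
    have Z0 : Z != 0 by rewrite pnatr_eq0 -lt0n.
    have -> : V * D%:R / (D%:R * Z) = V / Z by field; rewrite Z0 gt_eqF.
    by [].
  apply: ler_wpM2r => //.
  apply: le_trans (_ : 2 * (absz b)%:R / m + 1 <= _).
    apply: count_interval => //; first exact: undup_uniq.
      move=> u v; rewrite !mem_undup => /mapP[x xS2 ->] /mapP[y yS2 ->].
      have [ebx /S1P[_ xS]] := S2P _ xS2; have [eby /S1P[_ yS]] := S2P _ yS2.
      by apply: mc_dvd => //; rewrite ebx eby.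
    move=> u v; rewrite !mem_undup => /mapP[x xS2 ->] /mapP[y yS2 ->].
    have [ebx /S1P[_ /gS[_ _ hx _ _]]] := S2P _ xS2; have [eby /S1P[_ /gS[_ _ hy _ _]]] := S2P _ yS2.
    rewrite -[2 * _]natrM -[X in _ <= X]/((2 * absz b)%N%:Z%:~R) -intr_norm ler_int.
    by rewrite ebx in hx; rewrite eby in hy; exact: int_dist_le.
  have h : 1 <= (absz b)%:R / m.
    rewrite ler_pdivlMr // mul1r /m ler_nat; apply: dvdn_leq.
      by rewrite -(ltr_nat R); lra.
    by have := mb_dvd x1; rewrite -eb1 dvdzE; apply; have [] := S1P _ x1S1.
  have -> : 3 * (absz b)%:R / m = 3 * ((absz b)%:R / m) by ring.
  have -> : 2 * (absz b)%:R / m = 2 * ((absz b)%:R / m) by ring.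
  lra.
have mD0 : (0 < mn * D)%N by rewrite muln_gt0 mn0.
apply: le_trans (@sum_multiples R _ (mn * D) (12 * lam) G mD0 (undup_uniq _) G0 _) _.
  move=> a; rewrite mem_undup => /mapP[x xS1 ->]; have [_ xS] := S1P _ xS1.
  by have [_ h _ _ _] := gS _ xS; split; rewrite ?bn0 ?mD.
set N := Num.truncn _.
have NE : N%:R <= 12 * lam / (mn * D)%N%:R by rewrite truncn_le // !mulr_ge0 ?invr_ge0 // ltW.
(* The part linear in b is bounded by its largest value 12 lam; the other part decays like 1 /
   i^2. *)
have t1 : \sum_(1 <= i < N.+1) G (mn * D * i)%N <=
   w * (3 / m * (lam ^+ 4 / (2 * n) / (m ^+ 2 * D%:R) * 2 + N%:R * (12 * lam))).
  apply: le_trans (_ : \sum_(1 <= i < N.+1) (w * (3 / m * (lam ^+ 4 / (2 * n) / (m ^+ 2 * D%:R) * (i%:R ^+ 2)^-1 + 12 * lam))) <= _).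
    rewrite big_nat_cond [leRHS]big_nat_cond; apply: ler_sum => i; rewrite andbT ltnS => /andP[i1 iN].
    have iR : 0 < i%:R :> R by rewrite ltr0n.
    have hi : m * D%:R * i%:R <= 12 * lam.
      have : i%:R <= 12 * lam / (mn * D)%N%:R by apply: le_trans NE; rewrite ler_nat.
      rewrite ler_pdivlMr ?ltr0n // natrM; lra.
    rewrite /G !natrM -/m.
    have -> : 3 * (m * D%:R * i%:R) / m * (w * (lam ^+ 4 / (2 * (m * D%:R * i%:R) ^+ 3) * D%:R / n + 1)) =
       w * (3 / m * (lam ^+ 4 / (2 * n) / (m ^+ 2 * D%:R) * (i%:R ^+ 2)^-1 + m * D%:R * i%:R)).
      by field; rewrite !gt_eqF.
    apply: ler_wpM2l => //; apply: ler_wpM2l; first by rewrite divr_ge0 // ltW.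
    by rewrite lerD2l.
  rewrite -mulr_sumr; apply: ler_wpM2l => //; rewrite -mulr_sumr.
  apply: ler_wpM2l; first by rewrite divr_ge0 // ltW.
  rewrite big_split /= -mulr_sumr sumr_const_nat subSS subn0 -[X in _ + X <= _]mulr_natl lerD2r.
  apply: ler_wpM2l; last exact: sum_inv_sq.
  by rewrite !divr_ge0 ?mulr_ge0 ?exprn_ge0 // ltW.
apply: le_trans (_ : 2 * (w * (3 / m * (lam ^+ 4 / (2 * n) / (m ^+ 2 * D%:R) * 2 + N%:R * (12 * lam)))) <= _).
  by rewrite ler_pM2l.
have -> : 2 * (w * (3 / m * (lam ^+ 4 / (2 * n) / (m ^+ 2 * D%:R) * 2 + N%:R * (12 * lam)))) =
   w * (6 * (lam ^+ 4 / (m ^+ 2 * n) / (m * D%:R)) + 72 * (N%:R * lam / m)).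
  by field; rewrite !gt_eqF.
apply: ler_wpM2l => //.
have i1 : lam ^+ 4 / (m ^+ 2 * n) / (m * D%:R) <= lam ^+ 4 / (m ^+ 2 * n).
  rewrite ler_pdivrMr ?mulr_gt0 // ler_peMr //; last by rewrite mulr_ege1.
  by rewrite divr_ge0 ?mulr_ge0 ?exprn_ge0 // ltW.
have i2 : N%:R * lam / m <= 12 * lam ^+ 2.
  have N1 : N%:R <= 12 * lam.
    by apply: le_trans NE _; rewrite ler_pdivrMr ?ltr0n // ler_peMr ?mulr_ge0 ?ler1n // ltW.
  rewrite ler_pdivrMr //; apply: le_trans (_ : 12 * lam * lam <= _); first by rewrite ler_pM2r.
  by rewrite -mulrA -expr2 ler_peMr // mulr_ge0 ?sqr_ge0.
have i3 : 0 <= lam ^+ 4 / (m ^+ 2 * n) by rewrite divr_ge0 ?mulr_ge0 ?exprn_ge0 // ltW.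
have i4 : 0 <= lam ^+ 3 / m by rewrite divr_ge0 ?exprn_ge0 // ltW.
have i5 : 0 <= lam ^+ 2 by apply: sqr_ge0.
rewrite /mb /main_bound; lra.
Qed.

(** * Classes and local weights *)

Definition eqv (x y : cubic_form int) : Prop := exists2 g : 'M[int]_2, \det g = 1 & y = form_act g x.

Lemma eqv_refl x : eqv x x.
Proof. by exists 1%:M; rewrite ?det1 ?form_act1. Qed.

Lemma eqv_sym x y : eqv x y -> eqv y x.
Proof. by move=> [g dg ->]; exists (adj22 g); rewrite ?det_adj22 // form_act_adj1. Qed.

Lemma eqv_trans y x z : eqv x y -> eqv y z -> eqv x z.
Proof.
move=> [g dg ->] [h dh ->]; exists (h *m g); last by rewrite form_actM.
by rewrite det_mulmx dg dh mulr1.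
Qed.

Lemma eqv_disc x y : eqv x y -> form_disc y = form_disc x.
Proof. by move=> [g dg ->]; rewrite form_disc_act dg expr1n mul1r. Qed.

Definition eqv_rep (x : cubic_form int) : cubic_form int :=
  xget (CubicForm 0 0 0 0) (eqv x : set _).

Lemma eqv_repP x : eqv x (eqv_rep x).
Proof. by rewrite /eqv_rep; case: xgetP => [y -> //|/(_ x)]; case; apply: eqv_refl. Qed.

Lemma eqv_rep_eq x y : eqv x y -> eqv_rep x = eqv_rep y.
Proof.
move=> exy; rewrite /eqv_rep; congr xget; apply/funext => z; apply/propext; split.
  exact: eqv_trans (eqv_sym exy).
exact: eqv_trans exy.
Qed.

Definition inequiv (s : seq (cubic_form int)) : Prop :=
  uniq s /\ {in s &, forall x y, eqv x y -> x = y}.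

(** Quantifying over finite lists of inequivalent forms bounds a sum over classes without first
    proving that the classes are finite in number. *)
Definition class_bound (R : realType) (w : cubic_form int -> R) (Y B : R) : Prop :=
  forall s, inequiv s ->
    {in s, forall x, form_disc x != 0 /\ `|(form_disc x)%:~R| <= Y} ->
    \sum_(x <- s) w x <= B.

(* Equivalence over the localization of Z at m: the local conditions at m only depend on
   it. *)
Definition sim (m : int) (x y : cubic_form int) : Prop :=
  exists (k : int) (h : 'M[int]_2),
    [/\ coprimez m k, coprimez m (\det h) & fscale k x = form_act h y].

(** The scalar matrix k acts as multiplication by k^3 = k^2 k. *)
Lemma sim_scale m k x : coprimez m k -> sim m (fscale k x) x.
Proof.
move=> c; exists (k ^+ 2), (mx22 k 0 0 k); split; first by rewrite coprimezXr.
  by rewrite det22 !mx22E mulr0 subr0 coprimezMr c.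
case: x => a b c' d; rewrite /form_act /fscale /map_form !mx22E /=.
by congr CubicForm; ring.
Qed.

Lemma pdiv_form_sim m x y : sim m x y -> pdiv_form m x -> pdiv_form m y.
Proof.
move=> [k [h [ck ch e]]] /pdiv_formP[z ez].
rewrite -(pdiv_form_actK _ ch) -e ez; apply/pdiv_formP; exists (fscale k z).
by case: z {ez} => a b c d; rewrite /fscale /map_form /= ![k * (m * _)]mulrCA.
Qed.

Lemma hessA_scale (A : comNzRingType) k (f : cubic_form A) : hessA (fscale k f) = k ^+ 2 * hessA f.
Proof. by rewrite /hessA /fscale /=; ring. Qed.

Lemma hessB_scale (A : comNzRingType) k (f : cubic_form A) : hessB (fscale k f) = k ^+ 2 * hessB f.
Proof. by rewrite /hessB /fscale /=; ring. Qed.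

Lemma hessC_scale (A : comNzRingType) k (f : cubic_form A) : hessC (fscale k f) = k ^+ 2 * hessC f.
Proof. by rewrite /hessC /fscale /=; ring. Qed.

Lemma hess_dvd_act m (g : 'M[int]_2) x : hess_dvd m x -> hess_dvd m (form_act g x).
Proof.
move=> /and3P[/dvdzP[a ea] /dvdzP[b eb] /dvdzP[c ec]].
apply/and3P; rewrite hessA_act hessB_act hessC_act ea eb ec; split.
- have -> : a * m * g 0 0 ^+ 2 + b * m * g 0 0 * g 0 1 + c * m * g 0 1 ^+ 2 =
    (a * g 0 0 ^+ 2 + b * g 0 0 * g 0 1 + c * g 0 1 ^+ 2) * m by ring.
  by rewrite mulrA dvdz_mull.
- have -> : 2%:R * (a * m) * g 0 0 * g 1 0 + b * m * (g 0 0 * g 1 1 + g 0 1 * g 1 0)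
     + 2%:R * (c * m) * g 0 1 * g 1 1 = (2%:R * a * g 0 0 * g 1 0 + b * (g 0 0 * g 1 1 + g 0 1 * g 1 0)
     + 2%:R * c * g 0 1 * g 1 1) * m by ring.
  by rewrite mulrA dvdz_mull.
- have -> : a * m * g 1 0 ^+ 2 + b * m * g 1 0 * g 1 1 + c * m * g 1 1 ^+ 2 =
    (a * g 1 0 ^+ 2 + b * g 1 0 * g 1 1 + c * g 1 1 ^+ 2) * m by ring.
  by rewrite mulrA dvdz_mull.
Qed.

Lemma hess_dvd_scale (m : nat) k x : coprimez m k -> hess_dvd m (fscale k x) -> hess_dvd m x.
Proof.
move=> c; have c2 : coprimez m (k ^+ 2) by rewrite coprimezXr.
by rewrite /hess_dvd hessA_scale hessB_scale hessC_scale !(Gauss_dvdzr _ c2).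
Qed.

Lemma hess_dvd_sim (m : nat) x y : sim m x y -> hess_dvd m x -> hess_dvd m y.
Proof.
move=> [k [h [ck ch e]]] hx.
have : hess_dvd m (fscale k x).
  move: hx; rewrite /hess_dvd hessA_scale hessB_scale hessC_scale => /and3P[h1 h2 h3].
  by rewrite !dvdz_mull.
rewrite e => /(hess_dvd_act (adj22 h)); rewrite form_act_adj; apply: hess_dvd_scale.
by rewrite coprimezXr.
Qed.

Lemma disc_dvd_sim (m : nat) x y : sim m x y -> (m %| form_disc x)%Z -> (m %| form_disc y)%Z.
Proof.
move=> [k [h [ck ch e]]] hx.
have : (m %| form_disc (fscale k x))%Z by rewrite form_disc_scale dvdz_mull.
by rewrite e form_disc_act Gauss_dvdzr // coprimezXr.
Qed.

Definition has_type (P : nat -> pred (cubic_form int)) (p : nat) (x : cubic_form int) : bool :=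
  [exists r : option 'I_p, P p (form_act (proj_mx r) x)].

Definition scale_closed (P : pred (cubic_form int)) := forall k x, P x -> P (fscale k x).

Lemma has_type_sim P p x y : prime p -> lower_stable p (P p) -> scale_closed (P p) ->
  sim p x y -> has_type P p x -> has_type P p y.
Proof.
move=> pp st sc [k [h [ck ch e]]] /existsP[r hr].
have [||r' hr'] := @lower_stable_lift p (P p) (proj_mx r *m h) y pp st.
- by rewrite det_mulmx det_proj_mx mul1r -coprimez_prime.
- by rewrite form_actM -e form_act_scale; apply: sc.
by apply/existsP; exists r'.
Qed.

Lemma isBd_scale p : scale_closed (isBd p).
Proof. by move=> k x /and3P[h1 h2 h3]; rewrite /isBd /fscale /= !dvdz_mull. Qed.

Lemma isTd_scale p : scale_closed (isTd p).
Proof. by move=> k x /and3P[h1 h2 h3]; rewrite /isTd /fscale /= !dvdz_mull. Qed.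

Lemma isBd_isTd p x : isBd p x -> isTd p x.
Proof.
move=> /and3P[h1 h2 h3]; apply/and3P; split=> //.
by apply: dvdz_trans h2; rewrite PoszX2 dvdz_mull.
Qed.

(* Local majorant of the Fourier transform at p; nothing is needed at 2 and 3. *)
Definition weight (R : realType) (p : nat) (x : cubic_form int) : R :=
  if (p < 5)%N then 1 else
  8 / p%:R ^+ 3 * (pdiv_form p x)%:R + 8 / p%:R ^+ 2 * (pdiv_form (p ^ 2)%N x)%:R
  + (has_type isBd p x)%:R / p%:R ^+ 3 + (has_type isTd p x)%:R / p%:R ^+ 4.

Lemma weight_ge0 (R : realType) p x : 0 <= weight R p x.
Proof.
by rewrite /weight; case: ifP.
Qed.

Lemma ler_nat_bool (R : realType) (b b' : bool) : (b -> b') -> b%:R <= b'%:R :> R.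
Proof. by case: b; case: b' => // h; have := h isT. Qed.

Lemma weight_sim (R : realType) p x y : prime p -> sim p x y -> weight R p x <= weight R p y.
Proof.
move=> pp sxy; rewrite /weight; case: ifP => // _.
have sxy2 : sim (p ^ 2)%N x y.
  move: sxy => [k [h [ck ch e]]]; exists k, h; split=> //.
    by move: ck; rewrite !coprimezE /= => ck; rewrite coprimeXl.
  by move: ch; rewrite !coprimezE /= => ch; rewrite coprimeXl.
have p0 : 0 < p%:R :> R by rewrite ltr0n prime_gt0.
rewrite !lerD // ?ler_pM2l ?ler_pM2r ?divr_gt0 ?invr_gt0 ?exprn_gt0 //; apply: ler_nat_bool.
- exact: pdiv_form_sim.
- exact: pdiv_form_sim.
- by apply: has_type_sim => //; [exact: isBd_stable|exact: isBd_scale].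
- by apply: has_type_sim => //; [exact: isTd_stable|exact: isTd_scale].
Qed.

(** State of the induction over the primes: L holds those still to be removed, while m and n collect
    the removed ones that left a condition on the Hessian or on the discriminant. *)
Definition tweight (R : realType) (L : seq nat) (m n : nat) (x : cubic_form int) : R :=
  (\prod_(p <- L) weight R p x) * (hess_dvd m x)%:R * (n %| form_disc x)%Z%:R.

Lemma tweight_ge0 (R : realType) L m n x : 0 <= tweight R L m n x.
Proof. by rewrite /tweight !mulr_ge0 // prodr_ge0 // => p _; apply: weight_ge0. Qed.

Lemma tweight_sim (R : realType) L (m n : nat) x y : all prime L ->
  (forall p : nat, p \in L -> sim p x y) -> sim m x y -> sim n x y ->
  tweight R L m n x <= tweight R L m n y.
Proof.
move=> aL sL sm sn; rewrite /tweight.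
have w0 z : 0 <= \prod_(p <- L) weight R p z by rewrite prodr_ge0 // => p _; apply: weight_ge0.
apply: ler_pM; rewrite ?mulr_ge0 //; last by apply: ler_nat_bool; exact: disc_dvd_sim.
apply: ler_pM => //; last by apply: ler_nat_bool; exact: hess_dvd_sim.
rewrite big_seq [leRHS]big_seq; apply: ler_prod => p pL.
by rewrite weight_ge0 weight_sim ?(allP aL _ pL) //; apply: sL.
Qed.

Lemma class_bound_le (R : realType) (w w' : cubic_form int -> R) Y B B' :
  (forall x, w x <= w' x) -> B <= B' -> class_bound w' Y B -> class_bound w Y B'.
Proof.
move=> ww BB h s is_ hs; apply: le_trans (le_trans _ (h s is_ hs)) BB.
by apply: ler_sum.
Qed.

Lemma class_boundD (R : realType) (w w' : cubic_form int -> R) Y B B' :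
  class_bound w Y B -> class_bound w' Y B' -> class_bound (fun x => w x + w' x) Y (B + B').
Proof. by move=> h h' s is_ hs; rewrite big_split /= lerD ?h ?h'. Qed.

Lemma class_boundZ (R : realType) (w : cubic_form int -> R) (k Y B : R) : 0 <= k ->
  class_bound w Y B -> class_bound (fun x => k * w x) Y (k * B).
Proof. by move=> k0 h s is_ hs; rewrite -mulr_sumr ler_wpM2l // h. Qed.

(** * Descent at a prime p *)

Lemma class_bound_scale (R : realType) (w w' : cubic_form int -> R) (p : nat) (Y B : R) :
  (0 < p)%N -> (forall x, w (fscale p%:Z x) <= w' x) ->
  class_bound w' (Y / p%:R ^+ 4) B -> class_bound (fun x => (pdiv_form p x)%:R * w x) Y B.
Proof.
move=> p0 hw h s [us is_] hs.
pose dv (x : cubic_form int) := map_form (fun a => (a %/ p)%Z) x.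
have dvK x : pdiv_form p x -> fscale p%:Z (dv x) = x.
  move=> /and4P[h1 h2 h3 h4]; rewrite /fscale /dv /map_form /=.
  by rewrite ![Posz p * _]mulrC !divzK // -cubic_form_eta.
rewrite (bigID (pdiv_form p)) /= [X in _ + X]big1 ?addr0; last first.
  by move=> x /negbTE ->; rewrite mul0r.
pose s' := [seq dv x | x <- s & pdiv_form p x].
have s'P y : y \in s' -> exists2 x, x \in s & x = fscale p%:Z y.
  by move=> /mapP[x]; rewrite mem_filter => /andP[px xs ->]; exists x; rewrite ?dvK.
have is' : inequiv s'.
  split.
    rewrite map_inj_in_uniq ?filter_uniq // => x y; rewrite !mem_filter => /andP[px _] /andP[py _] e.
    by rewrite -(dvK _ px) -(dvK _ py) e.
  move=> y y' ys ys' [g dg ey].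
  have [x xs ex] := s'P _ ys; have [x' xs' ex'] := s'P _ ys'.
  have e : x = x'.
    by apply: is_ => //; exists g => //; rewrite ex ex' ey form_act_scale.
  move: ex'; rewrite -e ex => [[]] e1 e2 e3 e4.
  have pz : p%:Z != 0 by rewrite eqz_nat -lt0n.
  by rewrite (cubic_form_eta y) (cubic_form_eta y'); congr CubicForm; apply: (mulfI pz).
apply: le_trans (h _ is' _); last first.
  move=> y /s'P[x xs ex]; have [d0 dY] := hs _ xs.
  move: d0 dY; rewrite ex form_disc_scale => d0 dY; split.
    by apply: contraNneq d0 => ->; rewrite mulr0.
  rewrite ler_pdivlMr ?exprn_gt0 ?ltr0n //; apply: le_trans dY.
  by rewrite rmorphM rmorphXn /= normrM mulrC normrX ger0_norm // lexx.
rewrite /s' big_map big_filter; apply: ler_sum => x px; rewrite px mul1r.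
by rewrite -{1}(dvK _ px).
Qed.

(* p x(u / p, v): this divides the discriminant by p^2. *)
Definition reduceT (p : nat) (x : cubic_form int) : cubic_form int :=
  CubicForm (ca x %/ (p ^ 2)%N)%Z (cb x %/ p)%Z (cc x) (p%:Z * cd x).

Definition Tpoint (P : nat -> pred (cubic_form int)) (p : nat) (x : cubic_form int) : option 'I_p :=
  odflt None [pick r | P p (form_act (proj_mx r) x)].

Definition Tmap (P : nat -> pred (cubic_form int)) (p : nat) (x : cubic_form int) :=
  reduceT p (form_act (proj_mx (Tpoint P p x)) x).

Lemma TpointP P p x : has_type P p x -> P p (form_act (proj_mx (Tpoint P p x)) x).
Proof.
by rewrite /Tpoint => /existsP[r hr]; case: pickP => [//|/(_ r)]; rewrite hr.
Qed.

Definition diagp (p : nat) : 'M[int]_2 := mx22 p%:Z 0 0 1.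

Lemma det_diagp p : \det (diagp p) = p%:Z.
Proof. by rewrite det22 /diagp !mx22E; ring. Qed.

(** The last two divisibilities say that [Tmap P p x] has a double root at (0 : 1) modulo p; this is
    what controls the fibres of [Tmap]. *)
Lemma Tmap_spec (P : nat -> pred (cubic_form int)) p x : (0 < p)%N -> (forall z, P p z -> isTd p z) -> has_type P p x ->
  [/\ form_act (diagp p) (Tmap P p x) = fscale p%:Z (form_act (proj_mx (Tpoint P p x)) x),
      (p %| cc (Tmap P p x))%Z & (p %| cd (Tmap P p x))%Z].
Proof.
move=> p0 PT /TpointP/PT; rewrite /Tmap; set z := form_act _ _; case: z => a b c d.
rewrite /isTd PoszX2 => /and3P[/= /dvdzP[a' ->] /dvdzP[b' ->] pc].
have pz : p%:Z != 0 by rewrite eqz_nat -lt0n.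
rewrite /reduceT /= PoszX2 !mulzK ?mulf_neq0 //; split=> //; last exact: dvdz_mulr.
by rewrite /form_act /diagp /fscale /map_form !mx22E /=; congr CubicForm; ring.
Qed.

Lemma Tmap_disc (P : nat -> pred (cubic_form int)) p x : (0 < p)%N -> (forall z, P p z -> isTd p z) -> has_type P p x ->
  form_disc x = p%:Z ^+ 2 * form_disc (Tmap P p x).
Proof.
move=> p0 PT hx; have [e _ _] := Tmap_spec p0 PT hx.
have pz : p%:Z != 0 by rewrite eqz_nat -lt0n.
apply: (mulfI (expf_neq0 4 pz)); rewrite mulrA -exprD.
have := congr1 (@form_disc int) e; rewrite form_disc_act form_disc_scale form_disc_act det_diagp det_proj_mx expr1n mul1r.
by move=> <-.
Qed.

Lemma Tmap_sim (P : nat -> pred (cubic_form int)) p m x : (0 < p)%N -> (forall z, P p z -> isTd p z) -> coprimez m p -> has_type P p x -> sim m x (Tmap P p x).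
Proof.
move=> p0 PT c hx; have [e _ _] := Tmap_spec p0 PT hx.
exists p%:Z, (adj22 (proj_mx (Tpoint P p x)) *m diagp p); split=> //.
  by rewrite det_mulmx det_adj22 det_proj_mx det_diagp mul1r.
by rewrite form_actM e form_act_scale form_act_adj1 // det_proj_mx.
Qed.

Lemma diagp_comm p (r : 'M[int]_2) (f : int) : r 1 0 = f * p%:Z ->
  diagp p *m r = mx22 (r 0 0) (p%:Z * r 0 1) f (r 1 1) *m diagp p.
Proof.
move=> ef; apply: mx22_eqP; rewrite !mulmx22E /diagp !mx22E ?ef; [ring|ring|ring|ring].
Qed.

(** The last hypothesis says that k and k' have the same lower row in P^1(F_p), so p divides the
    lower left entry of k' k^-1. Conjugation by diag(p, 1) then keeps this matrix integral, and the
    conjugate relates x to x'. *)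
Lemma Tmap_inj (P : nat -> pred (cubic_form int)) p (x x' y : cubic_form int) (k k' : 'M[int]_2) : (0 < p)%N ->
  (forall z, P p z -> isTd p z) ->
  has_type P p x -> has_type P p x' -> \det k = 1 -> \det k' = 1 ->
  Tmap P p x = form_act k y -> Tmap P p x' = form_act k' y ->
  (p %| (k' 1 0 * k 1 1 - k' 1 1 * k 1 0)%R)%Z -> eqv x x'.
Proof.
move=> p0 PT hx hx' dk dk' ex ex' pd.
have [e _ _] := Tmap_spec p0 PT hx; have [e' _ _] := Tmap_spec p0 PT hx'.
have pz : p%:Z != 0 by rewrite eqz_nat -lt0n.
pose r := k' *m adj22 k.
have dr : \det r = 1 by rewrite det_mulmx det_adj22 dk dk' mulr1.
have er : Tmap P p x' = form_act r (Tmap P p x) by rewrite ex ex' /r form_actM form_act_adj1.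
have r10 : r 1 0 = k' 1 0 * k 1 1 - k' 1 1 * k 1 0.
  by rewrite /r mulmx22E /adj22 !mx22E; ring.
move: pd; rewrite -r10 => /dvdzP[f ef].
pose r' := mx22 (r 0 0) (p%:Z * r 0 1) f (r 1 1).
have dr' : \det r' = 1 by rewrite -dr !det22 /r' !mx22E ef; ring.
have comm : diagp p *m r = r' *m diagp p by apply: diagp_comm.
move: e'; rewrite er -form_actM comm form_actM e form_act_scale.
set u := form_act r' _; set v := form_act _ x' => [[]] e1 e2 e3 e4.
have uv : u = v.
  by rewrite (cubic_form_eta u) (cubic_form_eta v); congr CubicForm; apply: (mulfI pz).
apply: (@eqv_trans v).
  rewrite -uv; apply: (@eqv_trans (form_act (proj_mx (Tpoint P p x)) x)).
    by exists (proj_mx (Tpoint P p x)); rewrite ?det_proj_mx.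
  by exists r'.
by apply: eqv_sym; exists (proj_mx (Tpoint P p x')); rewrite ?det_proj_mx.
Qed.

(** Exchanging the variables takes (0 : 1) to (1 : 0), the case of [double_root_uniq]. *)
Lemma double_root_uniq' (p : nat) (g : 'M[int]_2) f : prime p -> \det g = 1 ->
  (p %| cc f)%Z -> (p %| cd f)%Z ->
  (p %| cc (form_act g f))%Z -> (p %| cd (form_act g f))%Z ->
  ~~ (p %| (g 1 0)%R)%Z -> pdiv_form p f.
Proof.
move=> pp dg hc hd hc' hd' ng.
pose J : 'M[int]_2 := mx22 0 1 1 0.
have JE h : form_act J h = CubicForm (cd h) (cc h) (cb h) (ca h).
  by case: h => a b c d; rewrite /form_act /J !mx22E /=; congr CubicForm; ring.
have dJ : \det J = -1 by rewrite det22 /J !mx22E; ring.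
have JJ : J *m J = 1%:M by apply: mx22_eqP; rewrite mulmx22E /J !mx22E !mxE /=; ring.
have eJ : form_act (J *m g *m J) (form_act J f) = form_act J (form_act g f).
  by rewrite -[LHS]form_actM -!mulmxA JJ mulmx1 form_actM.
have := @double_root_uniq p (J *m g *m J) (form_act J f) pp.
rewrite eJ !JE /= => H.
have : pdiv_form p (CubicForm (cd f) (cc f) (cb f) (ca f)).
  apply: H => //.
    by rewrite !det_mulmx dJ dg mulr1 mulrN1 opprK dvdzE /= dvdn1 neq_ltn prime_gt1 ?orbT.
  by rewrite !mulmx22E /J !mx22E !mul0r !mul1r !add0r !mulr1 !mulr0 addr0.
by move=> /and4P[/= h1 h2 h3 h4]; apply/and4P.
Qed.

Lemma sim_eqvr m x y z : sim m x y -> eqv y z -> sim m x z.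
Proof.
move=> [k [h [ck ch e]]] /eqv_sym[g dg ey]; exists k, (h *m g); split=> //.
  by rewrite det_mulmx dg mulr1.
by rewrite e ey form_actM.
Qed.

Lemma sum_fiber (R : realType) (T U : eqType) (f : T -> U) (s : seq T) (F : U -> R) :
  \sum_(x <- s) F (f x) =
  \sum_(y <- undup (map f s)) (count (fun x => f x == y) s)%:R * F y.
Proof.
transitivity (\sum_(y <- undup (map f s)) \sum_(x <- s) (if f x == y then F y else 0)).
  rewrite exchange_big /=; apply: eq_big_seq => x xs.
  rewrite -big_mkcond /= (eq_bigl (pred1 (f x))); last by move=> y; rewrite /= eq_sym.
  by rewrite -big_filter filter_pred1_uniq ?undup_uniq ?mem_undup ?map_f // big_seq1.
apply: eq_bigr => y _; rewrite -big_mkcond /= big_const_seq iter_addr_0.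
by rewrite mulr_natl.
Qed.

(** The weight 1 + p [p | y] bounds the fibre of x -> class of [Tmap P p x] over y. By [Tmap_inj] a
    fibre embeds in P^1(F_p), of size p + 1; if p does not divide y, its double root modulo p is
    unique and the fibre has at most one class. *)
Lemma class_bound_push (R : realType) (p : nat) (P : nat -> pred (cubic_form int)) (w w' : cubic_form int -> R) (Y B : R) :
  prime p -> (forall z, P p z -> isTd p z) ->
  (forall x y, has_type P p x -> eqv (Tmap P p x) y -> w x <= w' y) ->
  (forall y, 0 <= w' y) ->
  class_bound (fun y => (1 + p%:R * (pdiv_form p y)%:R) * w' y) (Y / p%:R ^+ 2) B ->
  class_bound (fun x => (has_type P p x)%:R * w x) Y B.
Proof.
move=> pp PT ww w'0 h s [us is_] hs.
have p0 := prime_gt0 pp.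
rewrite (bigID (has_type P p)) /= [X in _ + X]big1 ?addr0; last first.
  by move=> x /negbTE ->; rewrite mul0r.
rewrite -big_filter; set s1 := [seq x <- s | has_type P p x].
have us1 : uniq s1 by rewrite filter_uniq.
have s1P x : x \in s1 -> has_type P p x /\ x \in s by rewrite mem_filter => /andP.
pose f x := eqv_rep (Tmap P p x).
pose s' := undup (map f s1).
have is' : inequiv s'.
  split; first exact: undup_uniq.
  move=> y y'; rewrite !mem_undup => /mapP[x xs ->] /mapP[x' xs' ->] e.
  apply: eqv_rep_eq; apply: eqv_trans (eqv_repP _) _.
  by apply: eqv_trans e _; apply: eqv_sym; apply: eqv_repP.
apply: le_trans (h s' is' _); last first.
  move=> y; rewrite mem_undup => /mapP[x xs1 ->].
  have [hx xs] := s1P _ xs1; have [d0 dY] := hs _ xs.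
  move: d0 dY; rewrite (Tmap_disc p0 PT hx) /f (eqv_disc (eqv_repP _)) => d0 dY; split.
    by apply: contraNneq d0 => ->; rewrite mulr0.
  rewrite ler_pdivlMr ?exprn_gt0 ?ltr0n //; apply: le_trans dY.
  by rewrite rmorphM rmorphXn /= normrM mulrC normrX ger0_norm // lexx.
apply: le_trans (_ : \sum_(x <- s1) w' (f x) <= _).
  rewrite big_seq [leRHS]big_seq; apply: ler_sum => x xs1; have [hx _] := s1P _ xs1.
  by rewrite hx mul1r; apply: ww => //; exact: eqv_repP.
rewrite sum_fiber -/s' big_seq [leRHS]big_seq; apply: ler_sum => y ys'.
apply: ler_wpM2r => //; rewrite -size_filter; set l := seq.filter _ _.
have lP x : x \in l -> [/\ f x = y, has_type P p x & x \in s].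
  by rewrite mem_filter => /andP[/eqP fx /s1P[]].
have ul : uniq l by rewrite filter_uniq.
have [|kf hk] := @choice _ _ (fun x (g : 'M[int]_2) => x \in l -> \det g = 1 /\ Tmap P p x = form_act g y).
  move=> x; have [xl|nxl] := boolP (x \in l); last by exists 1%:M.
  have [fx _ _] := lP _ xl; have := eqv_sym (eqv_repP (Tmap P p x)); rewrite -/(f x) fx => -[g dg e].
  by exists g.
have inj x x' : x \in l -> x' \in l ->
    (p %| (kf x' 1%R 0%R * kf x 1%R 1%R - kf x' 1%R 1%R * kf x 1%R 0%R)%R)%Z -> x = x'.
  move=> xl xl' pd; have [fx hx xs] := lP _ xl; have [fx' hx' xs'] := lP _ xl'.
  have [dk ek] := hk _ xl; have [dk' ek'] := hk _ xl'.
  by apply: is_ => //; apply: (Tmap_inj p0 PT hx hx' dk dk' ek ek' pd).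
have [py|npy] := boolP (pdiv_form p y).
  rewrite mulr1.
  have rx x := cid (@exists_proj_row p (kf x 1 0) (kf x 1 1) pp).
  pose rf x := sval (rx x).
  have rinj : {in l &, injective rf}.
    move=> x x' xl xl' e; apply: inj => //.
    have := svalP (rx x); have := svalP (rx x'); rewrite -/(rf x) -/(rf x') -e.
    case: (rf x) => [j|] /=; rewrite ?mx22E ?mxE /=.
      rewrite !mul1r => h1 h2.
      have -> : kf x' 1 0 * kf x 1 1 - kf x' 1 1 * kf x 1 0 =
        (kf x' 1 0 - j%:Z * kf x' 1 1) * kf x 1 1 - kf x' 1 1 * (kf x 1 0 - j%:Z * kf x 1 1) by ring.
      by apply: rpredB; [exact: dvdz_mulr|exact: dvdz_mull].
    rewrite !mul0r !sub0r !mul1r !rpredN => h1 h2.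
    by apply: rpredB; [exact: dvdz_mull|exact: dvdz_mulr].
  have : uniq (map rf l) by rewrite map_inj_in_uniq.
  move/card_uniqP; rewrite size_map => <-.
  rewrite -[1]/(1%:R) -natrD ler_nat; apply: leq_trans (max_card _) _.
  by rewrite card_option card_ord add1n.
rewrite mulr0 addr0.
case: l lP ul hk inj => [|x [|x' l]] lP ul hk inj //.
exfalso; move: ul => /= /andP[]; rewrite inE negb_or => /andP[/eqP ne _] _; apply: ne.
have xl : x \in [:: x, x' & l] by rewrite !inE eqxx.
have xl' : x' \in [:: x, x' & l] by rewrite !inE eqxx orbT.
apply: inj => //; apply/negPn/negP => nd.
have [fx hx xs] := lP _ xl; have [fx' hx' xs'] := lP _ xl'.
have [dk ek] := hk _ xl; have [dk' ek'] := hk _ xl'.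
have [_ c1 d1] := Tmap_spec p0 PT hx; have [_ c2 d2] := Tmap_spec p0 PT hx'.
pose r := kf x' *m adj22 (kf x).
have er : Tmap P p x' = form_act r (Tmap P p x) by rewrite ek ek' /r form_actM form_act_adj1.
have : pdiv_form p (Tmap P p x).
  apply: (@double_root_uniq' p r) => //; rewrite -?er //.
    by rewrite det_mulmx det_adj22 dk dk' mulr1.
  by apply: contra nd; rewrite /r mulmx22E /adj22 !mx22E mulrN.
by rewrite ek pdiv_form_actK ?dk ?(negbTE npy) // coprimezE coprimen1.
Qed.

(** Here b / p, c and p d are multiples of p, so the reduced form is a u^3 modulo p, and a cube has
    zero Hessian. *)
Lemma Tmap_B_hess p x : (0 < p)%N -> has_type isBd p x -> hess_dvd p (Tmap isBd p x).
Proof.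
move=> p0 /TpointP; rewrite /Tmap; set z := form_act _ _; case: z => a b c d.
rewrite /isBd PoszX2 => /and3P[/= /dvdzP[a' ->] /dvdzP[b' ->] /dvdzP[c' ->]].
have pz : p%:Z != 0 by rewrite eqz_nat -lt0n.
rewrite /reduceT /= PoszX2 (mulzK _ (mulf_neq0 pz pz)) (mulrA b') mulzK //.
rewrite /hess_dvd /hessA /hessB /hessC /=; apply/and3P; split; apply/dvdzP.
- by exists (b' ^+ 2 * p%:Z - 3%:R * a' * c'); ring.
- by exists (b' * c' * p%:Z - 9%:R * a' * d); ring.
- by exists (c' ^+ 2 * p%:Z - 3%:R * b' * d * p%:Z); ring.
Qed.

(** Modulo p the reduced form is u^2 (a u + b v), with a double root. *)
Lemma Tmap_T_disc p x : (0 < p)%N -> has_type isTd p x -> (p %| form_disc (Tmap isTd p x))%Z.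
Proof.
move=> p0 /(Tmap_spec p0 (fun _ h => h))[_]; case: (Tmap _ _ _) => a b c d /=.
move=> /dvdzP[c' ->] /dvdzP[d' ->]; apply/dvdzP.
exists (b ^+ 2 * c' ^+ 2 * p%:Z - 4%:R * a * c' ^+ 3 * p%:Z ^+ 2 - 4%:R * b ^+ 3 * d'
  - 27%:R * a ^+ 2 * d' ^+ 2 * p%:Z + 18%:R * a * b * c' * d' * p%:Z); ring.
Qed.

Lemma hess_dvdM (p m : nat) x : coprime p m -> hess_dvd (p * m)%N x = hess_dvd p x && hess_dvd m x.
Proof.
move=> c; rewrite /hess_dvd PoszM !Gauss_dvdz ?coprimezE //.
by do ![case: (_ \in _)].
Qed.

Lemma hess_dvd_eqv m x y : eqv x y -> hess_dvd m x -> hess_dvd m y.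
Proof. by move=> [g _ ->]; exact: hess_dvd_act. Qed.

Lemma coprimez_nat (m p : nat) : coprimez m p = coprime m p.
Proof. by rewrite coprimezE. Qed.

(** One bound per term of the weight at p: [B1] and [B2] for x divisible by p and p^2, [B3] and [B5]
    for the types [isBd] and [isTd]. [B4] serves the forms y = [Tmap] divisible by p, where p^2 and
    then p^4 have left the discriminant and the new condition at p is dropped. *)
Lemma tweight_step (R : realType) (p : nat) L (m n : nat) (Y B1 B2 B3 B4 B5 : R) :
  prime p -> (5 <= p)%N -> all prime L -> p \notin L -> coprime p m -> coprime p n ->
  class_bound (tweight R L m n) (Y / p%:R ^+ 4) B1 ->
  class_bound (tweight R L m n) (Y / p%:R ^+ 8) B2 ->
  class_bound (tweight R L (p * m) n) (Y / p%:R ^+ 2) B3 ->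
  class_bound (tweight R L m n) (Y / p%:R ^+ 6) B4 ->
  class_bound (tweight R L m (p * n)) (Y / p%:R ^+ 2) B5 ->
  class_bound (tweight R (p :: L) m n) Y
    (8 / p%:R ^+ 3 * B1 + 8 / p%:R ^+ 2 * B2 + (p%:R ^+ 3)^-1 * (B3 + p%:R * B4)
     + (p%:R ^+ 4)^-1 * (B5 + p%:R * B4)).
Proof.
move=> pp p5 aL pL cm cn h1 h2 h3 h4 h5.
have p0 := prime_gt0 pp; have pR : 0 < p%:R :> R by rewrite ltr0n.
have cL (l : nat) : l \in L -> coprimez l p.
  move=> lL; rewrite coprimez_nat prime_coprime ?(allP aL _ lL) // dvdn_prime2 ?(allP aL _ lL) //.
  by apply: contraNneq pL => <-.
have cmz : coprimez m p by rewrite coprimez_nat coprime_sym.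
have cnz : coprimez n p by rewrite coprimez_nat coprime_sym.
have sc k x : (forall l : nat, coprimez l p -> coprimez l k) ->
    tweight R L m n (fscale k x) <= tweight R L m n x.
  move=> ck; apply: tweight_sim => //; [move=> l lL| |]; apply: sim_scale; apply: ck => //.
  exact: cL.
have e1 x : tweight R (p :: L) m n x =
   8 / p%:R ^+ 3 * ((pdiv_form p x)%:R * tweight R L m n x)
   + 8 / p%:R ^+ 2 * ((pdiv_form (p ^ 2)%N x)%:R * tweight R L m n x)
   + (p%:R ^+ 3)^-1 * ((has_type isBd p x)%:R * tweight R L m n x)
   + (p%:R ^+ 4)^-1 * ((has_type isTd p x)%:R * tweight R L m n x).
  by rewrite /tweight big_cons /weight ltnNge p5 /=; ring.
rewrite (funext e1).
have iv k : 0 <= (p%:R ^+ k)^-1 :> R by rewrite invr_ge0 exprn_ge0.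
apply: class_boundD; [apply: class_boundD; [apply: class_boundD|]|].
- apply: class_boundZ; first by rewrite mulr_ge0.
  by apply: class_bound_scale h1 => // x; apply: sc.
- apply: class_boundZ; first by rewrite mulr_ge0.
  apply: (@class_bound_scale R _ (tweight R L m n)).
  + by rewrite expn_gt0 p0.
  + by move=> x; apply: sc => l cl; rewrite PoszX2 coprimezMr cl.
  + by rewrite natrX -exprM.
- apply: class_boundZ => //.
  apply: (@class_bound_push R p isBd _ (tweight R L (p * m) n)) => //.
  + exact: isBd_isTd.
  + move=> x y hx exy.
    have sx l : coprimez l p -> sim l x y.
      by move=> cl; apply: sim_eqvr exy; apply: Tmap_sim => //; exact: isBd_isTd.
    apply: le_trans (_ : tweight R L m n y <= _).
      by apply: tweight_sim => // [l lL||]; apply: sx => //; apply: cL.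
    have hp : hess_dvd p y by apply: hess_dvd_eqv exy _; exact: Tmap_B_hess.
    by rewrite /tweight hess_dvdM // hp.
  + exact: tweight_ge0.
  apply: (@class_bound_le R _ (fun y => tweight R L (p * m) n y +
       p%:R * ((pdiv_form p y)%:R * tweight R L (p * m) n y)) _ _ _ _ (lexx _)).
    by move=> y; rewrite mulrDl mul1r mulrA.
  apply: class_boundD => //; apply: class_boundZ; first exact: ltW.
  apply: (@class_bound_scale R _ (tweight R L m n)) => //.
    move=> x; apply: le_trans (_ : tweight R L m n (fscale p%:Z x) <= _); last exact: sc.
    rewrite /tweight; apply: ler_wpM2r => //; apply: ler_wpM2l.
      by apply: prodr_ge0 => l _; apply: weight_ge0.
    by apply: ler_nat_bool; apply: hess_dvd_trans; apply: dvdn_mull.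
  by rewrite -mulrA -invfM -exprD.
- apply: class_boundZ => //.
  apply: (@class_bound_push R p isTd _ (tweight R L m (p * n))) => //.
  + move=> x y hx exy.
    have sx l : coprimez l p -> sim l x y.
      by move=> cl; apply: sim_eqvr exy; apply: Tmap_sim.
    apply: le_trans (_ : tweight R L m n y <= _).
      by apply: tweight_sim => // [l lL||]; apply: sx => //; apply: cL.
    rewrite /tweight PoszM Gauss_dvdz ?coprimezE //.
    by rewrite (eqv_disc exy) Tmap_T_disc.
  + exact: tweight_ge0.
  apply: (@class_bound_le R _ (fun y => tweight R L m (p * n) y +
       p%:R * ((pdiv_form p y)%:R * tweight R L m (p * n) y)) _ _ _ _ (lexx _)).
    by move=> y; rewrite mulrDl mul1r mulrA.
  apply: class_boundD => //; apply: class_boundZ; first exact: ltW.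
  apply: (@class_bound_scale R _ (tweight R L m n)) => //.
    move=> x; apply: le_trans (_ : tweight R L m n (fscale p%:Z x) <= _); last exact: sc.
    rewrite /tweight; apply: ler_wpM2l.
      by rewrite mulr_ge0 //; apply: prodr_ge0 => l _; apply: weight_ge0.
    by apply: ler_nat_bool; apply: dvdz_trans; rewrite PoszM dvdz_mull.
  by rewrite -mulrA -invfM -exprD.
Qed.

Lemma tweight_step_small (R : realType) (p : nat) L (m n : nat) (Y B : R) : (p < 5)%N ->
  class_bound (tweight R L m n) Y B -> class_bound (tweight R (p :: L) m n) Y B.
Proof.
move=> p5; apply: class_bound_le => // x.
by rewrite /tweight big_cons /weight p5 mul1r.
Qed.

(** The recursion of [tweight_step] as an inequality on the bounding function. Each 4 pays for one
    more prime in m or n, since the count has a factor 4 per prime. The factor 3^7 covers the primes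
    2 and 3, where the weight saves nothing while up to p^7 is claimed. *)
Definition stable_bound (R : realType) (bf : R -> R -> R -> R -> R) : Prop :=
  (forall Q m n Y : R, 1 <= Q -> 1 <= m -> 1 <= n -> 0 <= Y -> 0 <= bf Q m n Y) /\
  (forall (p Q m n Y : R), 2 <= p -> 1 <= Q -> 1 <= m -> 1 <= n -> 0 <= Y ->
   8 / p ^+ 3 * bf Q m n (Y / p ^+ 4) + 8 / p ^+ 2 * bf Q m n (Y / p ^+ 8)
   + (p ^+ 3)^-1 * (4 * bf Q (p * m) n (Y / p ^+ 2) + p * bf Q m n (Y / p ^+ 6))
   + (p ^+ 4)^-1 * (4 * bf Q m (p * n) (Y / p ^+ 2) + p * bf Q m n (Y / p ^+ 6))
   <= 3 ^+ 7 * bf (p * Q) m n Y) /\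
  (forall (p Q m n Y : R), 1 <= p <= 3 -> 1 <= Q -> 1 <= m -> 1 <= n -> 0 <= Y ->
   bf Q m n Y <= 3 ^+ 7 * bf (p * Q) m n Y).

(** Induction on L. A prime that leaves it is either forgotten or moved to [ms] or [ns], with a
    smaller Y, so all three must vary. *)
Lemma tweight_bound (R : realType) (bf : R -> R -> R -> R -> R) (C : R) : 0 <= C -> stable_bound bf ->
  (forall ms ns Y, good_primes (ms ++ ns) -> 0 <= Y ->
     class_bound (tweight R [::] (\prod_(p <- ms) p) (\prod_(p <- ns) p)) Y
       (C * 4 ^+ size (ms ++ ns) * bf 1 (\prod_(p <- ms) p)%N%:R (\prod_(p <- ns) p)%N%:R Y)) ->
  forall L ms ns Y, uniq (L ++ ms ++ ns) -> all prime L -> good_primes (ms ++ ns) -> 0 <= Y ->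
    class_bound (tweight R L (\prod_(p <- ms) p) (\prod_(p <- ns) p)) Y
      (C * (3 ^+ 7) ^+ size L * 4 ^+ size (ms ++ ns) *
       bf (\prod_(p <- L) p)%N%:R (\prod_(p <- ms) p)%N%:R (\prod_(p <- ns) p)%N%:R Y).
Proof.
move=> C0 [bf0 [step small]] base; elim=> [|p L IH] ms ns Y.
  move=> _ _ gp Y0; rewrite big_nil expr0 mulr1; exact: base.
rewrite cat_cons cons_uniq /= => /andP[pn uL] /andP[pp aL] gp Y0.
have [ugp pgp] := gp.
have amn : all prime (ms ++ ns) by apply/allP => q /pgp[].
have am : all prime ms by move: amn; rewrite all_cat => /andP[].
have an : all prime ns by move: amn; rewrite all_cat => /andP[].
set m : R := (\prod_(p <- ms) p)%N%:R; set n : R := (\prod_(p <- ns) p)%N%:R.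
set Q : R := (\prod_(p <- L) p)%N%:R.
have m1 : 1 <= m by rewrite ler1n prod_primes_gt0.
have n1 : 1 <= n by rewrite ler1n prod_primes_gt0.
have Q1 : 1 <= Q by rewrite ler1n prod_primes_gt0.
have KS : (3 ^+ 7) ^+ size (p :: L) = 3 ^+ 7 * (3 ^+ 7) ^+ size L :> R by rewrite [LHS]exprS.
rewrite big_cons natrM -/Q KS.
set K := (3 ^+ 7) ^+ size L; set w := 4 ^+ size (ms ++ ns).
have CK0 : 0 <= C * K * w by rewrite !mulr_ge0 // ?exprn_ge0 // exprn_ge0.
have [p5|p5] := ltnP p 5.
  apply: tweight_step_small => //.
  have := IH ms ns Y uL aL gp Y0; apply: class_bound_le => //; rewrite -/m -/n -/Q -/K -/w.
  have -> : C * (3 ^+ 7 * K) * w * bf (p%:R * Q) m n Y = C * K * w * (3 ^+ 7 * bf (p%:R * Q) m n Y).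
    by move: (3 ^+ 7) => z; ring.
  apply: ler_wpM2l => //; apply: small => //.
  rewrite ler1n prime_gt0 //= ler_nat.
  by move: pp p5; case: p {pn KS} => [|[|[|[|[|]]]]].
have pL : p \notin L by apply: contra pn => h; rewrite mem_cat h.
have pm : p \notin ms by apply: contra pn => h; rewrite !mem_cat h orbT.
have pn' : p \notin ns by apply: contra pn => h; rewrite !mem_cat h !orbT.
have cpr (l : seq nat) : all prime l -> p \notin l -> coprime p (\prod_(q <- l) q).
  move=> al pl; have := @coprime_prods [:: p] l; rewrite big_seq1; apply=> q r.
  rewrite inE => /eqP -> rl; split; rewrite ?(allP al _ rl) //.
  by apply: contraNneq pl => ->.
have Yk k : 0 <= Y / p%:R ^+ k by rewrite divr_ge0 // exprn_ge0.
have gp1 : good_primes ((p :: ms) ++ ns).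
  split; first by rewrite cat_cons cons_uniq ugp andbT mem_cat negb_or pm.
  by move=> q; rewrite cat_cons inE => /predU1P[->//|/pgp].
have gp2 : good_primes (ms ++ p :: ns).
  split.
    by rewrite (perm_uniq (permEl (perm_catCA ms [:: p] ns))); have [] := gp1.
  by move=> q; rewrite mem_cat inE orbCA -mem_cat => /predU1P[->//|/pgp].
have u1 : uniq (L ++ (p :: ms) ++ ns).
  by rewrite (perm_uniq (permEl (perm_catCA L [:: p] (ms ++ ns)))) /= pn.
have u2 : uniq (L ++ ms ++ p :: ns).
  by rewrite catA (perm_uniq (permEl (perm_catCA (L ++ ms) [:: p] ns))) /= -catA pn.
have b1 := IH ms ns _ uL aL gp (Yk 4); have b2 := IH ms ns _ uL aL gp (Yk 8).
have b4 := IH ms ns _ uL aL gp (Yk 6).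
have b3 := IH (p :: ms) ns _ u1 aL gp1 (Yk 2); have b5 := IH ms (p :: ns) _ u2 aL gp2 (Yk 2).
rewrite big_cons natrM in b3; rewrite big_cons natrM in b5.
have := tweight_step pp p5 aL pL (cpr _ am pm) (cpr _ an pn') b1 b2 b3 b4 b5.
apply: class_bound_le => //; rewrite -/m -/n -/Q -/K -/w.
have -> : 4 ^+ size ((p :: ms) ++ ns) = 4 * w by rewrite /w /= exprS.
have -> : 4 ^+ size (ms ++ p :: ns) = 4 * w by rewrite /w !size_cat /= addnS exprS.
have -> : C * (3 ^+ 7 * K) * w * bf (p%:R * Q) m n Y = C * K * w * (3 ^+ 7 * bf (p%:R * Q) m n Y).
  by move: (3 ^+ 7) => z; ring.
apply: le_trans (ler_wpM2l CK0 (step p%:R Q m n Y _ Q1 m1 n1 Y0)); last first.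
  by rewrite ler_nat; apply: leq_trans p5.
by rewrite le_eqVlt; apply/orP; left; apply/eqP; ring.
Qed.

(** Here and in [bound2], the exponent of Q in the term containing Y is the largest for which the
    recursion closes up to a bounded factor. *)
Definition bound1 (R : realType) (Q m n Y : R) : R := Y / (Q ^+ 6 * m).

Definition bound2 (R : realType) (Q m n Y : R) : R := Y / (Q ^+ 7 * m ^+ 2 * n) + m ^+ 2 * n ^+ 3 / Q.

Lemma bound1_stable (R : realType) : stable_bound (@bound1 R).
Proof.
have i0 (x : R) k : 1 <= x -> 0 <= (x ^+ k)^-1 <= 1.
  move=> x1; have x0 : 0 < x by lra.
  apply/andP; split; first by rewrite invr_ge0 exprn_ge0 // ltW.
  by rewrite invf_le1 ?exprn_gt0 // exprn_ege1.
split; first by move=> Q m n Y Q1 m1 n1 Y0; rewrite /bound1 divr_ge0 // mulr_ge0 ?exprn_ge0 //; lra.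
split=> p Q m n Y p1 Q1 m1 n1 Y0; rewrite /bound1.
  have [pz Qz mz] : [/\ p != 0, Q != 0 & m != 0] by rewrite !gt_eqF //; lra.
  set E := Y / ((p * Q) ^+ 6 * m).
  have E0 : 0 <= E by rewrite divr_ge0 // mulr_ge0 ?exprn_ge0 ?mulr_ge0 //; lra.
  have -> : 8 / p ^+ 3 * (Y / p ^+ 4 / (Q ^+ 6 * m)) + 8 / p ^+ 2 * (Y / p ^+ 8 / (Q ^+ 6 * m)) +
     (p ^+ 3)^-1 * (4 * (Y / p ^+ 2 / (Q ^+ 6 * (p * m))) + p * (Y / p ^+ 6 / (Q ^+ 6 * m))) +
     (p ^+ 4)^-1 * (4 * (Y / p ^+ 2 / (Q ^+ 6 * m)) + p * (Y / p ^+ 6 / (Q ^+ 6 * m))) =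
     E * (8 * (p ^+ 1)^-1 + 8 * (p ^+ 4)^-1 + 4 + (p ^+ 2)^-1 + 4 + (p ^+ 3)^-1).
    by rewrite /E; field; rewrite pz Qz mz.
  rewrite [leRHS]mulrC; apply: ler_wpM2l => //.
  have := i0 p 1%N; have := i0 p 2%N; have := i0 p 3%N; have := i0 p 4%N.
  lra.
have p0 : 0 < p by lra.
have -> : 3 ^+ 7 * (Y / ((p * Q) ^+ 6 * m)) = Y / (Q ^+ 6 * m) * (3 ^+ 7 / p ^+ 6).
  have [pz Qz mz] : [/\ p != 0, Q != 0 & m != 0] by rewrite !gt_eqF //; lra.
  by field; rewrite pz Qz mz.
rewrite ler_peMr //; first by rewrite divr_ge0 // mulr_ge0 ?exprn_ge0 //; lra.
rewrite ler_pdivlMr ?exprn_gt0 // mul1r; apply: le_trans (_ : 3 ^+ 6 <= _); last lra.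
by rewrite lerXn2r ?nnegrE //; lra.
Qed.

Lemma bound2_stable (R : realType) : stable_bound (@bound2 R).
Proof.
have i0 (x : R) k : 1 <= x -> 0 <= (x ^+ k)^-1 <= 1.
  move=> x1; have x0 : 0 < x by lra.
  apply/andP; split; first by rewrite invr_ge0 exprn_ge0 // ltW.
  by rewrite invf_le1 ?exprn_gt0 // exprn_ege1.
have E0 (Q m n Y : R) : 1 <= Q -> 1 <= m -> 1 <= n -> 0 <= Y -> 0 <= Y / (Q ^+ 7 * m ^+ 2 * n).
  by move=> Q1 m1 n1 Y0; rewrite divr_ge0 // !mulr_ge0 ?exprn_ge0 //; lra.
have F0 (Q m n : R) : 1 <= Q -> 1 <= m -> 1 <= n -> 0 <= m ^+ 2 * n ^+ 3 / Q.
  by move=> Q1 m1 n1; rewrite divr_ge0 ?mulr_ge0 ?exprn_ge0 //; lra.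
split; first by move=> Q m n Y Q1 m1 n1 Y0; rewrite /bound2 addr_ge0 ?E0 ?F0.
split=> p Q m n Y p1 Q1 m1 n1 Y0; rewrite /bound2.
  have [pz Qz mz nz] : [/\ p != 0, Q != 0, m != 0 & n != 0] by rewrite !gt_eqF //; lra.
  have pQ1 : 1 <= p * Q by rewrite mulr_ege1 //; lra.
  have hE := E0 _ _ _ _ pQ1 m1 n1 Y0; have hF := F0 _ _ _ pQ1 m1 n1.
  set E := Y / ((p * Q) ^+ 7 * m ^+ 2 * n) in hE *; set F := m ^+ 2 * n ^+ 3 / (p * Q) in hF *.
  have -> : 8 / p ^+ 3 * (Y / p ^+ 4 / (Q ^+ 7 * m ^+ 2 * n) + m ^+ 2 * n ^+ 3 / Q) +
     8 / p ^+ 2 * (Y / p ^+ 8 / (Q ^+ 7 * m ^+ 2 * n) + m ^+ 2 * n ^+ 3 / Q) +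
     (p ^+ 3)^-1 * (4 * (Y / p ^+ 2 / (Q ^+ 7 * (p * m) ^+ 2 * n) + (p * m) ^+ 2 * n ^+ 3 / Q)
       + p * (Y / p ^+ 6 / (Q ^+ 7 * m ^+ 2 * n) + m ^+ 2 * n ^+ 3 / Q)) +
     (p ^+ 4)^-1 * (4 * (Y / p ^+ 2 / (Q ^+ 7 * m ^+ 2 * (p * n)) + m ^+ 2 * (p * n) ^+ 3 / Q)
       + p * (Y / p ^+ 6 / (Q ^+ 7 * m ^+ 2 * n) + m ^+ 2 * n ^+ 3 / Q)) =
     E * (8 + 8 * (p ^+ 3)^-1 + 4 + (p ^+ 1)^-1 + 4 + (p ^+ 2)^-1) +
     F * (8 * (p ^+ 2)^-1 + 8 * (p ^+ 1)^-1 + 4 + (p ^+ 1)^-1 + 4 + (p ^+ 2)^-1).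
    by rewrite /E /F; field; rewrite pz Qz mz nz.
  rewrite [leRHS]mulrDr; apply: lerD; rewrite [leRHS]mulrC; apply: ler_wpM2l => //;
  have := i0 p 1%N; have := i0 p 2%N; have := i0 p 3%N; lra.
have [pz Qz mz nz] : [/\ p != 0, Q != 0, m != 0 & n != 0] by rewrite !gt_eqF //; lra.
have p0 : 0 < p by lra.
have -> : 3 ^+ 7 * (Y / ((p * Q) ^+ 7 * m ^+ 2 * n) + m ^+ 2 * n ^+ 3 / (p * Q)) =
   Y / (Q ^+ 7 * m ^+ 2 * n) * (3 ^+ 7 / p ^+ 7) + m ^+ 2 * n ^+ 3 / Q * (3 ^+ 7 / p).
  by field; rewrite pz Qz mz nz.
apply: lerD; rewrite ler_peMr ?E0 ?F0 // ler_pdivlMr ?exprn_gt0 // mul1r.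
  by rewrite lerXn2r ?nnegrE //; lra.
apply: le_trans (_ : 3 <= _); lra.
Qed.

(** * Finite Fourier transforms *)

Definition chi (R : realType) (M : nat) (k : int) : R[i] :=
  expi (2 * pi * k%:~R / M%:R).

Lemma expiD (R : realType) (x y : R) : expi (x + y) = expi x * expi y.
Proof. by rewrite /expi cosD sinD; apply/eqP; rewrite eq_complex /= !eqxx [sin x * _ + _]addrC eqxx. Qed.

Lemma expi0 (R : realType) : expi (0 : R) = 1.
Proof. by rewrite /expi cos0 sin0. Qed.

Lemma expi_norm (R : realType) (x : R) : Normc.normc (expi x) = 1.
Proof. by rewrite /Normc.normc /expi cos2Dsin2 sqrtr1. Qed.

Lemma expi_2pi (R : realType) (k : int) : expi (2 * pi * k%:~R : R) = 1.
Proof.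
have nat_case (n : nat) : expi (2 * pi * n%:R : R) = 1.
  elim: n => [|n IH]; first by rewrite mulr0 expi0.
  have -> : 2 * pi * n.+1%:R = 2 * pi * n%:R + pi *+ 2 :> R by rewrite -natr1; ring.
  by rewrite expiD IH mul1r /expi cos2pi sin2pi.
case: k => n; first exact: nat_case.
rewrite NegzE rmorphN mulrN.
have := expiD (2 * pi * n.+1%:R : R) (- (2 * pi * n.+1%:R)); rewrite subrr expi0 nat_case mul1r.
by move=> ->.
Qed.

Lemma chiD (R : realType) M (j k : int) : chi R M (j + k) = chi R M j * chi R M k.
Proof. by rewrite /chi -expiD; congr expi; rewrite rmorphD /= mulrDr mulrDl. Qed.

Lemma chi0 (R : realType) M : chi R M 0 = 1.
Proof. by rewrite /chi mulr0 mul0r expi0. Qed.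

Lemma chiM_period (R : realType) (M : nat) (j : int) : (0 < M)%N -> chi R M (M%:Z * j) = 1.
Proof.
move=> M0; rewrite /chi -(expi_2pi R j); congr expi.
by rewrite rmorphM /=; field; rewrite pnatr_eq0 -lt0n.
Qed.

Lemma chi_norm (R : realType) M k : Normc.normc (chi R M k) = 1.
Proof. exact: expi_norm. Qed.

Lemma chiX (R : realType) M (j : int) n : chi R M (j * n%:Z) = chi R M j ^+ n.
Proof.
elim: n => [|n IH]; first by rewrite mulr0 chi0.
by rewrite -addn1 PoszD mulrDr mulr1 chiD IH exprD expr1.
Qed.

Lemma chi_scale (R : realType) (M N : nat) (k : int) : (0 < M)%N -> (0 < N)%N ->
  chi R (M * N) (M%:Z * k) = chi R N k.
Proof.
move=> M0 N0; rewrite /chi; congr expi; rewrite natrM rmorphM /=.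
by field; rewrite !pnatr_eq0 -!lt0n M0 N0.
Qed.

(** With r the residue of k and y = pi r / M, strictly between 0 and pi, the real part is 1 - 2
    sin^2 y < 1. *)
Lemma chi_neq1 (R : realType) (M : nat) (k : int) : (0 < M)%N -> ~~ (M %| k)%Z -> chi R M k != 1.
Proof.
move=> M0 nd; have M0' : (M : int) != 0 by rewrite eqz_nat -lt0n.
rewrite (divz_eq k M) chiD [(_ %/ _)%Z * _]mulrC chiM_period // mul1r.
set r := (k %% M)%Z.
have r0 : 0 < r.
  rewrite lt_neqAle modz_ge0 // andbT eq_sym; apply: contra nd => /eqP h.
  by apply/dvdz_mod0P.
have rM : r < M by apply: ltz_pmod; rewrite ltz_nat.
apply/eqP => /(congr1 (@complex.Re R)); rewrite /chi /expi /= => e.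
pose y : R := pi * r%:~R / M%:R.
have MR : 0 < M%:R :> R by rewrite ltr0n.
have y0 : 0 < y by rewrite divr_gt0 // mulr_gt0 ?pi_gt0 // ltr0z.
have ypi : y < pi.
  rewrite /y ltr_pdivrMr // ltr_pM2l ?pi_gt0 //.
  by rewrite -[M%:R]/(M%:Z%:~R) ltr_int.
have s0 : 0 < sin y by apply: sin_gt0_pi; rewrite y0 ypi.
have : cos (2 * pi * r%:~R / M%:R) = 1 - 2 * sin y ^+ 2 :> R.
  have -> : 2 * pi * r%:~R / M%:R = y + y :> R by rewrite /y; ring.
  rewrite cosD; have := cos2Dsin2 y; set c := cos y; set s := sin y => h.
  have -> : c * c = 1 - s ^+ 2 by rewrite -h; ring.
  by ring.
rewrite e => h; have : 0 < sin y ^+ 2 by rewrite exprn_gt0.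
lra.
Qed.

Lemma sum_chi (R : realType) (M : nat) (k : int) : (0 < M)%N ->
  \sum_(a < M) chi R M (k * (a : nat)%:Z) = (M%:R * ((M %| k)%Z)%:R).
Proof.
move=> M0; under eq_bigr => a _ do rewrite chiX.
have [/dvdzP[j ->]|nd] := boolP (M %| k)%Z.
  rewrite mulrC chiM_period //; under eq_bigr => a _ do rewrite expr1n.
  by rewrite sumr_const card_ord mulr1.
rewrite mulr0; set z := chi R M k.
have zM : z ^+ M = 1 by rewrite /z -chiX mulrC chiM_period.
have := subrX1 z M; rewrite zM subrr => /esym/eqP.
by rewrite mulf_eq0 subr_eq0 (negbTE (chi_neq1 _ M0 nd)) /= => /eqP.
Qed.

Lemma sum_dvd_nat (A : comNzRingType) (d e : nat) (F : nat -> A) : (0 < d)%N ->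
  \sum_(0 <= i < d * e) (d %| i)%N%:R * F i = \sum_(0 <= j < e) F (d * j)%N.
Proof.
move=> d0; elim: e => [|e IH]; first by rewrite muln0 !big_geq.
rewrite (@big_cat_nat _ _ _ (d * e)) //=; last by rewrite leq_mul2l leqnSn orbT.
rewrite IH big_nat_recr //=; congr (_ + _).
rewrite big_ltn; last by rewrite ltn_mul2l d0 ltnSn.
rewrite dvdn_mulr // mul1r big_nat_cond big1 ?addr0 // => i /andP[/andP[h1 h2] _].
rewrite -(subnKC h1) addSn -addnS dvdn_addr ?dvdn_mulr // gtnNdvd ?mul0r //.
by rewrite mulnS in h2; lia.
Qed.

Lemma sum_chi_mult (R : realType) (d e : nat) (k : int) : (0 < d)%N -> (0 < e)%N ->
  \sum_(a < d * e) ((d %| (a : nat))%N)%:R * chi R (d * e) (k * (a : nat)%:Z) =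
  e%:R * ((e %| k)%Z)%:R.
Proof.
move=> d0 e0; rewrite -sum_chi // -(big_mkord xpredT (fun a => (d %| a)%N%:R * chi R (d * e) (k * a%:Z))).
rewrite -(big_mkord xpredT (fun a => chi R e (k * a%:Z))) sum_dvd_nat //.
by apply: eq_bigr => j _; rewrite PoszM mulrCA chi_scale.
Qed.

Definition cform (M : nat) (t : 'I_M * 'I_M * 'I_M * 'I_M) : cubic_form int :=
  CubicForm (t.1.1.1 : nat)%:Z (t.1.1.2 : nat)%:Z (t.1.2 : nat)%:Z (t.2 : nat)%:Z.

Definition fsum (R : realType) (M : nat) (G : cubic_form int -> R[i]) : R[i] :=
  \sum_(t : 'I_M * 'I_M * 'I_M * 'I_M) G (cform t).

Lemma fsumE (R : realType) M (G : cubic_form int -> R[i]) :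
  fsum M G = \sum_(a < M) \sum_(b < M) \sum_(c < M) \sum_(d < M)
    G (CubicForm (a : nat)%:Z (b : nat)%:Z (c : nat)%:Z (d : nat)%:Z).
Proof. by rewrite /fsum !pair_bigA. Qed.

Definition fcong (M : nat) (x y : cubic_form int) : bool :=
  [&& (M %| (ca x - ca y)%R)%Z, (M %| (cb x - cb y)%R)%Z,
      (M %| (cc x - cc y)%R)%Z & (M %| (cd x - cd y)%R)%Z].

Definition periodic (R : realType) (M : nat) (G : cubic_form int -> R[i]) : Prop :=
  forall x y, fcong M x y -> G x = G y.

Lemma fcong_refl M x : fcong M x x.
Proof. by rewrite /fcong !subrr !dvdz0. Qed.

Lemma fcong_sym M x y : fcong M x y -> fcong M y x.
Proof.
move=> /and4P[h1 h2 h3 h4]; apply/and4P.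
by split; rewrite -opprB rpredN.
Qed.

Lemma fcong_trans M y x z : fcong M x y -> fcong M y z -> fcong M x z.
Proof.
move=> /and4P[h1 h2 h3 h4] /and4P[k1 k2 k3 k4]; apply/and4P; split.
- by rewrite -(subrK (ca y) (ca x)) -addrA rpredD.
- by rewrite -(subrK (cb y) (cb x)) -addrA rpredD.
- by rewrite -(subrK (cc y) (cc x)) -addrA rpredD.
- by rewrite -(subrK (cd y) (cd x)) -addrA rpredD.
Qed.

Definition fadd (x y : cubic_form int) : cubic_form int :=
  CubicForm (ca x + ca y) (cb x + cb y) (cc x + cc y) (cd x + cd y).

Lemma fcong_add M x y : fcong M x y -> exists h, x = fadd y (fscale M%:Z h).
Proof.
case: x y => a b c d [a' b' c' d'] /and4P[/= /dvdzP[e1 h1] /dvdzP[e2 h2] /dvdzP[e3 h3] /dvdzP[e4 h4]].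
exists (CubicForm e1 e2 e3 e4); rewrite /fadd /fscale /map_form /=.
by rewrite ![M%:Z * _]mulrC -h1 -h2 -h3 -h4 ![_ + (_ - _)]addrC !subrK.
Qed.

Lemma form_actD g x y : form_act g (fadd x y) = fadd (form_act g x) (form_act g y).
Proof.
case: x y => a b c d [a' b' c' d']; rewrite /form_act /fadd /=.
by congr CubicForm; ring.
Qed.

Lemma fcong_scale M x h : fcong M (fadd x (fscale M%:Z h)) x.
Proof.
rewrite /fcong /fadd /fscale /map_form /=.
by rewrite ![_ + M%:Z * _ - _]addrAC !subrr !add0r !dvdz_mulr.
Qed.

Lemma fcong_act M g x y : fcong M x y -> fcong M (form_act g x) (form_act g y).
Proof.
by move=> /fcong_add[h ->]; rewrite form_actD form_act_scale fcong_scale.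
Qed.

Lemma mod_lt (M : nat) (z : int) : (0 < M)%N -> (absz (z %% M)%Z < M)%N.
Proof.
move=> M0; have := ltz_pmod z (d := M); have := modz_ge0 z (d := M); lia.
Qed.

Definition cred (M : nat) (M0 : (0 < M)%N) (x : cubic_form int) : 'I_M * 'I_M * 'I_M * 'I_M :=
  (Ordinal (mod_lt (ca x) M0), Ordinal (mod_lt (cb x) M0), Ordinal (mod_lt (cc x) M0),
   Ordinal (mod_lt (cd x) M0)).

Lemma absz_mod (M : nat) (z : int) : (0 < M)%N -> Posz (absz (z %% M)%Z) = (z %% M)%Z.
Proof. by move=> M0; rewrite gez0_abs // modz_ge0 // eqz_nat -lt0n. Qed.

Lemma cform_red M (M0 : (0 < M)%N) x : fcong M (cform (cred M0 x)) x.
Proof.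
rewrite /fcong /cform /cred /= !absz_mod //.
by apply/and4P; split; rewrite -eqz_mod_dvd modz_mod.
Qed.

Lemma cform_inj M (t t' : 'I_M * 'I_M * 'I_M * 'I_M) : fcong M (cform t) (cform t') -> t = t'.
Proof.
case: t t' => [[[a b] c] d] [[[a' b'] c'] d'] /and4P[/=].
have small (u v : 'I_M) : (M %| ((u : nat)%:Z - (v : nat)%:Z)%R)%Z -> u = v.
  rewrite -eqz_mod_dvd !modz_nat eqz_nat !modn_small // => /eqP h.
  exact: val_inj.
by move=> /small -> /small -> /small -> /small ->.
Qed.

Lemma fsum_act (R : realType) M (G : cubic_form int -> R[i]) (g : 'M[int]_2) : (0 < M)%N ->
  periodic M G -> \det g = 1 -> fsum M (fun y => G (form_act g y)) = fsum M G.
Proof.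
move=> M0 pG dg; rewrite /fsum.
pose h (t : 'I_M * 'I_M * 'I_M * 'I_M) := cred M0 (form_act g (cform t)).
pose h' (t : 'I_M * 'I_M * 'I_M * 'I_M) := cred M0 (form_act (adj22 g) (cform t)).
have hK : cancel h h'.
  move=> t; apply: cform_inj; apply: fcong_trans (cform_red M0 _) _.
  apply: fcong_trans (fcong_act _ (cform_red M0 _)) _.
  by rewrite form_act_adj1 // fcong_refl.
rewrite [RHS](reindex h) /=; last by apply: onW_bij; apply: injF_bij; exact: can_inj hK.
by apply: eq_bigr => t _; apply: pG; apply: fcong_sym; exact: cform_red.
Qed.

(** Chinese remainders in the form N y1 + M y2 rather than with idempotents: the character modulo M
    N then splits into those modulo M and N without inverses, at the price that the functions have
    to be invariant under scaling. *)
Lemma fsum_crt (R : realType) M N (G : cubic_form int -> R[i]) : (0 < M)%N -> (0 < N)%N ->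
  coprime M N -> periodic (M * N) G ->
  fsum (M * N) G = fsum M (fun y1 => fsum N (fun y2 =>
     G (fadd (fscale N%:Z y1) (fscale M%:Z y2)))).
Proof.
move=> M0 N0 cMN pG; have MN0 : (0 < M * N)%N by rewrite muln_gt0 M0.
rewrite /fsum pair_bigA /=.
pose h (t : ('I_M * 'I_M * 'I_M * 'I_M) * ('I_N * 'I_N * 'I_N * 'I_N)) :=
  cred MN0 (fadd (fscale N%:Z (cform t.1)) (fscale M%:Z (cform t.2))).
have hi : injective h.
  move=> [t u] [t' u'] e.
  have := cform_red MN0 (fadd (fscale N%:Z (cform t)) (fscale M%:Z (cform u))).
  rewrite -[cred _ _]/(h (t, u)) e => /fcong_sym h1.
  have := fcong_trans h1 (cform_red MN0 (fadd (fscale N%:Z (cform t')) (fscale M%:Z (cform u')))).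
  rewrite /fcong /fadd /fscale /map_form /=.
  have key (x y x' y' : int) : ((M * N)%N %| (N%:Z * x + M%:Z * y - (N%:Z * x' + M%:Z * y'))%R)%Z ->
     (M %| (x - x')%R)%Z /\ (N %| (y - y')%R)%Z.
    rewrite PoszM => d; split.
      rewrite -(@Gauss_dvdzr M N) ?coprimezE //.
      have -> : N%:Z * (x - x') = (N%:Z * x + M%:Z * y - (N%:Z * x' + M%:Z * y')) + M%:Z * (y' - y) by ring.
      by apply: rpredD; [apply: dvdz_trans d; apply: dvdz_mulr|apply: dvdz_mulr].
    rewrite -(@Gauss_dvdzr N M) ?coprimezE 1?coprime_sym //.
    have -> : M%:Z * (y - y') = (N%:Z * x + M%:Z * y - (N%:Z * x' + M%:Z * y')) + N%:Z * (x' - x) by ring.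
    by apply: rpredD; [apply: dvdz_trans d; apply: dvdz_mull|apply: dvdz_mulr].
  move=> /and4P[/key[a1 a2] /key[b1 b2] /key[c1 c2] /key[d1 d2]].
  by congr pair; apply: cform_inj; apply/and4P.
have hb : bijective h.
  apply: inj_card_bij => //; rewrite !card_prod !card_ord; lia.
rewrite (reindex h) /=; last exact: onW_bij.
by apply: eq_bigr => t _; apply: pG; exact: cform_red.
Qed.

Lemma normcD (R : realType) (x y : R[i]) :
  Normc.normc (x + y) <= Normc.normc x + Normc.normc y.
Proof. by rewrite -lecR rmorphD /=; exact: (@ler_normD _ R[i]). Qed.

Lemma normc_sum (R : realType) (I : Type) (s : seq I) (F : I -> R[i]) :
  Normc.normc (\sum_(i <- s) F i) <= \sum_(i <- s) Normc.normc (F i).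
Proof.
elim: s => [|x s IH]; first by rewrite !big_nil Normc.normc0.
rewrite !big_cons; apply: le_trans (normcD _ _) _.
by rewrite lerD2l.
Qed.

Lemma normc_nat (R : realType) n : Normc.normc (n%:R : R[i]) = n%:R.
Proof.
rewrite -(rmorph_nat (real_complex R)) /Normc.normc /= expr0n /= addr0 sqrtr_sqr.
by rewrite ger0_norm.
Qed.

(* The pairing, integral on [hatV]. *)
Definition upz (x y : cubic_form int) : int :=
  cd x * ca y - (cc x %/ 3)%Z * cb y + (cb x %/ 3)%Z * cc y - ca x * cd y.

Lemma pairing_upz (R : realType) x y : hatV x -> pairing R x y = (upz x y)%:~R.
Proof.
move=> [/dvdzP[b eb] /dvdzP[c ec]]; rewrite /pairing /upz eb ec !mulzK // !rmorphD !rmorphN !rmorphM /=.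
by field.
Qed.

Lemma pairing_act (R : realType) (g : 'M[int]_2) x y :
  pairing R (form_act g x) (form_act g y) = (\det g)%:~R ^+ 3 * pairing R x y.
Proof.
case: x y => a b c d [a' b' c' d']; rewrite /pairing /form_act det22 /=.
by field.
Qed.

Lemma hatV_act (g : 'M[int]_2) x : hatV x -> hatV (form_act g x).
Proof.
case: x => a b c d [/= /dvdzP[b' ->] /dvdzP[c' ->]]; rewrite /form_act /hatV /=.
set k := g 0 0; set l := g 0 1; set m := g 1 0; set n := g 1 1.
split; apply/dvdzP.
  by exists (a * k ^+ 2 * m + b' * (k ^+ 2 * n + 2%:R * k * l * m)
        + c' * (2%:R * k * l * n + l ^+ 2 * m) + d * l ^+ 2 * n); ring.
by exists (a * k * m ^+ 2 + b' * (2%:R * k * m * n + l * m ^+ 2)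
        + c' * (k * n ^+ 2 + 2%:R * l * m * n) + d * l * n ^+ 2); ring.
Qed.

Lemma upz_act (R : realType) (g : 'M[int]_2) x y : \det g = 1 -> hatV x ->
  upz (form_act g x) (form_act g y) = upz x y.
Proof.
move=> dg hx; have := pairing_act R g x y; rewrite dg expr1n mul1r.
by rewrite !pairing_upz //; [move/intr_inj|exact: hatV_act].
Qed.

Lemma upzD x y z : upz x (fadd y z) = upz x y + upz x z.
Proof. by rewrite /upz /fadd /=; ring. Qed.

Lemma upzZ x k y : upz x (fscale k y) = k * upz x y.
Proof. by rewrite /upz /fscale /map_form /=; ring. Qed.

Lemma chi_upz_periodic (R : realType) M x : (0 < M)%N -> periodic M (fun y => chi R M (upz x y)).
Proof.
move=> M0 y z /fcong_add[h ->].
by rewrite upzD upzZ chiD chiM_period // mulr1.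
Qed.

Definition FT (R : realType) (M : nat) (phi : cubic_form int -> R[i]) (x : cubic_form int) : R[i] :=
  (M%:R ^+ 4)^-1 * fsum M (fun y => phi y * chi R M (upz x y)).

(** Substituting in the sum, since the pairing is invariant when g acts on both arguments. Only the
    lattices at the point (1 : 0) need then be transformed. *)
Lemma FT_act (R : realType) M (phi : cubic_form int -> R[i]) g x : (0 < M)%N -> periodic M phi ->
  \det g = 1 -> hatV x -> FT M (fun y => phi (form_act g y)) x = FT M phi (form_act g x).
Proof.
move=> M0 per dg hx; rewrite /FT; congr (_ * _).
rewrite -(fsum_act (G := fun y => phi y * chi R M (upz (form_act g x) y)) M0 _ dg); last first.
  by move=> y z yz; rewrite (per _ _ yz) (chi_upz_periodic R (form_act g x) M0 yz).
by apply: eq_bigr => t _; rewrite (upz_act R).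
Qed.

Lemma FTD (R : realType) M (f g : cubic_form int -> R[i]) x :
  FT M (fun y => f y + g y) x = FT M f x + FT M g x.
Proof.
rewrite /FT -mulrDr; congr (_ * _); rewrite /fsum -big_split /=.
by apply: eq_bigr => t _; rewrite mulrDl.
Qed.

Lemma FTZ (R : realType) M k (f : cubic_form int -> R[i]) x :
  FT M (fun y => k * f y) x = k * FT M f x.
Proof.
rewrite /FT mulrCA; congr (_ * _); rewrite /fsum mulr_sumr.
by apply: eq_bigr => t _; rewrite mulrA.
Qed.

Lemma FT_sum (R : realType) M (I : Type) (s : seq I) (f : I -> cubic_form int -> R[i]) x :
  FT M (fun y => \sum_(i <- s) f i y) x = \sum_(i <- s) FT M (f i) x.
Proof.
elim: s => [|i s IH].
  rewrite big_nil /FT /fsum big1 ?mulr0 // => t _; by rewrite big_nil mul0r.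
rewrite big_cons -IH -FTD /FT; congr (_ * _); apply: eq_bigr => t _; by rewrite big_cons.
Qed.

Lemma FT_ext (R : realType) M (f g : cubic_form int -> R[i]) x : f =1 g -> FT M f x = FT M g x.
Proof. by move=> e; congr FT; apply/funext. Qed.

Arguments FT_ext [R M f g x] _.

Lemma sum4_prod (A : comNzRingType) n (f1 f2 f3 f4 : 'I_n -> A) :
  \sum_a \sum_b \sum_c \sum_d (f1 a * f2 b * f3 c * f4 d) =
  (\sum_a f1 a) * (\sum_b f2 b) * (\sum_c f3 c) * (\sum_d f4 d).
Proof.
transitivity (\sum_a \sum_b \sum_c f1 a * f2 b * f3 c * \sum_d f4 d).
  by do 3! [apply: eq_bigr => ? _]; rewrite -mulr_sumr.
transitivity (\sum_a \sum_b f1 a * f2 b * (\sum_c f3 c) * \sum_d f4 d).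
  by do 2! [apply: eq_bigr => ? _]; rewrite -mulr_suml -mulr_sumr.
transitivity (\sum_a f1 a * (\sum_b f2 b) * (\sum_c f3 c) * \sum_d f4 d).
  by apply: eq_bigr => ? _; rewrite -!mulr_suml -mulr_sumr.
by rewrite -!mulr_suml.
Qed.

Definition box_ind (d1 d2 d3 d4 : nat) (y : cubic_form int) : bool :=
  [&& (d1 %| ca y)%Z, (d2 %| cb y)%Z, (d3 %| cc y)%Z & (d4 %| cd y)%Z].

(** The sum factors over the four coefficients. The pairing matches a with d and b with c / 3, so
    the divisors appear in reverse order. *)
Lemma FT_box (R : realType) (M d1 d2 d3 d4 e1 e2 e3 e4 : nat) x : (0 < M)%N ->
  (d1 * e1 = M)%N -> (d2 * e2 = M)%N -> (d3 * e3 = M)%N -> (d4 * e4 = M)%N ->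
  FT M (fun y => (box_ind d1 d2 d3 d4 y)%:R : R[i]) x =
  (M%:R ^+ 4)^-1 * ((e1 * e2 * e3 * e4)%N%:R *
   [&& (e1 %| cd x)%Z, (e2 %| (cc x %/ 3)%Z)%Z, (e3 %| (cb x %/ 3)%Z)%Z & (e4 %| ca x)%Z]%:R).
Proof.
move=> M0 h1 h2 h3 h4; rewrite /FT; congr (_ * _); rewrite fsumE.
pose f (d : nat) (k : int) (a : 'I_M) : R[i] := ((d %| (a : nat))%N)%:R * chi R M (k * (a : nat)%:Z).
transitivity (\sum_a \sum_b \sum_c \sum_d
   (f d1 (cd x) a * f d2 (- (cc x %/ 3)%Z) b * f d3 (cb x %/ 3)%Z c * f d4 (- ca x) d)).
  apply: eq_bigr => a _; apply: eq_bigr => b _; apply: eq_bigr => c _; apply: eq_bigr => d _.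
  rewrite /f /box_ind /upz /= !dvdzE /=.
  have -> : cd x * (a : nat)%:Z - (cc x %/ 3)%Z * (b : nat)%:Z + (cb x %/ 3)%Z * (c : nat)%:Z - ca x * (d : nat)%:Z
    = cd x * (a : nat)%:Z + (- (cc x %/ 3)%Z) * (b : nat)%:Z + (cb x %/ 3)%Z * (c : nat)%:Z + (- ca x) * (d : nat)%:Z by ring.
  rewrite !chiD.
  have mb (b1 b2 : bool) : (b1 && b2)%:R = b1%:R * b2%:R :> R[i] by case: b1; case: b2; rewrite ?mulr0 ?mul0r ?mulr1.
  by rewrite !mb; ring.
have fs d e k : (d * e = M)%N -> \sum_a f d k a = e%:R * ((e %| k)%Z)%:R.
  move=> de; have d0 : (0 < d)%N by move: M0; rewrite -de muln_gt0 => /andP[].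
  have e0 : (0 < e)%N by move: M0; rewrite -de muln_gt0 => /andP[].
  by rewrite /f; move: M0 de => _ <-; rewrite sum_chi_mult.
rewrite sum4_prod (fs _ _ _ h1) (fs _ _ _ h2) (fs _ _ _ h3) (fs _ _ _ h4) !rpredN.
have mb (b1 b2 : bool) : (b1 && b2)%:R = b1%:R * b2%:R :> R[i] by case: b1; case: b2; rewrite ?mulr0 ?mul0r ?mulr1.
by rewrite !mb !natrM; ring.
Qed.

(** * The complement of [V_] at p, described by [bad_at], and its transform *)

Definition bad_at (p : nat) (y : cubic_form int) : bool :=
  [exists r : option 'I_p, isB p (form_act (proj_mx r) y) || isE p (form_act (proj_mx r) y)].

Lemma proj_mx_cross (p : nat) (r r' : option 'I_p) : prime p -> r != r' ->
  ~~ (p %| ((proj_mx r' *m adj22 (proj_mx r)) 0 1)%R)%Z.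
Proof.
move=> pp ne; have p1 := prime_gt1 pp.
have n1 (z : int) : absz z = 1%N -> ~~ (p %| z)%Z by move=> h; rewrite dvdzE h dvdn1; lia.
rewrite mulmx22E /adj22 !mx22E; case: r r' ne => [j|] [i|] //= ne; rewrite ?mx22E ?mxE /=.
- apply/negP; rewrite mulrN1 mul1r addrC -eqz_mod_dvd !modz_nat eqz_nat !modn_small // => /eqP e.
  by case/eqP: ne; congr Some; apply: val_inj; exact: e.
- by apply: n1; rewrite mulrN1 mul0r addr0.
- by rewrite oppr0 mulr0 add0r mul1r; apply: n1.
Qed.

Lemma double_root_proj (p : nat) (r r' : option 'I_p) y : prime p -> r != r' ->
  (p %| ca (form_act (proj_mx r) y))%Z -> (p %| cb (form_act (proj_mx r) y))%Z ->
  (p %| ca (form_act (proj_mx r') y))%Z -> (p %| cb (form_act (proj_mx r') y))%Z ->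
  pdiv_form p y.
Proof.
move=> pp ne a1 b1 a2 b2.
have c1 (g : 'M[int]_2) : \det g = 1 -> coprimez p (\det g) by move=> ->; rewrite coprimezE coprimen1.
pose g := proj_mx r' *m adj22 (proj_mx r).
have dg : \det g = 1 by rewrite det_mulmx det_adj22 !det_proj_mx mulr1.
have eg : form_act g (form_act (proj_mx r) y) = form_act (proj_mx r') y.
  by rewrite /g form_actM form_act_adj1 // det_proj_mx.
rewrite -(pdiv_form_actK y (c1 _ (det_proj_mx r))).
apply: (@double_root_uniq p g); rewrite ?eg //.
  by rewrite -coprimez_prime // c1.
exact: proj_mx_cross.
Qed.

Lemma isB_ab p y : isB p y -> (p %| ca y)%Z && (p %| cb y)%Z.
Proof. by move=> /andP[h ->]; rewrite andbT; apply: dvdz_trans h; rewrite PoszX2 dvdz_mull. Qed.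

Lemma isE_ab p y : isE p y -> (p %| ca y)%Z && (p %| cb y)%Z.
Proof. by move=> /and3P[-> ->]. Qed.

(** A bad point is a double root modulo p, so two distinct ones force p to divide y. In that case
    all p + 1 points are bad and the sum exceeds the indicator by p, which the last term removes. *)
Lemma bad_at_identity (A : comNzRingType) (p : nat) y : prime p ->
  (bad_at p y)%:R = \sum_(r : option 'I_p)
     ((isB p (form_act (proj_mx r) y))%:R + (isE p (form_act (proj_mx r) y))%:R
      - (isB p (form_act (proj_mx r) y) && isE p (form_act (proj_mx r) y))%:R)
     - p%:R * (pdiv_form p y)%:R :> A.
Proof.
move=> pp.
have bE (b1 b2 : bool) : b1%:R + b2%:R - (b1 && b2)%:R = (b1 || b2)%:R :> A.
  by case: b1; case: b2 => /=; ring.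
under eq_bigr => r _ do rewrite bE.
have [py|npy] := boolP (pdiv_form p y).
  have hE (r : option 'I_p) : isE p (form_act (proj_mx r) y).
    by have /and4P[h1 h2 h3 _] := pdiv_form_act (proj_mx r) py; apply/and3P.
  under eq_bigr => r _ do rewrite hE orbT.
  rewrite sumr_const card_option card_ord mulr1 -natr1 addrAC subrr add0r.
  suff -> : bad_at p y by [].
  by apply/existsP; exists None; rewrite hE orbT.
rewrite mulr0 subr0; have [/existsP[r hr]|/existsPn nb] := boolP (bad_at p y); last first.
  by rewrite big1 // => r _; rewrite (negbTE (nb r)).
rewrite (bigD1 r) //= hr big1 ?addr0 // => r' ne.
have [hr'|//] := boolP (isB p (form_act (proj_mx r') y) || isE p (form_act (proj_mx r') y)).
exfalso; case/negP: npy.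
have ab z : isB p z || isE p z -> (p %| ca z)%Z && (p %| cb z)%Z by case/orP => [/isB_ab|/isE_ab].
have /andP[a1 b1] := ab _ hr; have /andP[a2 b2] := ab _ hr'.
by apply: (@double_root_proj p r r') => //; rewrite eq_sym.
Qed.

Lemma fcong_dvd (M d : nat) x y : (d %| M)%N -> fcong M x y ->
  [/\ (d %| ca x)%Z = (d %| ca y)%Z, (d %| cb x)%Z = (d %| cb y)%Z,
      (d %| cc x)%Z = (d %| cc y)%Z & (d %| cd x)%Z = (d %| cd y)%Z].
Proof.
move=> dM /and4P[h1 h2 h3 h4].
have dM' : (d %| Posz M)%Z by rewrite dvdzE.
have key (u v : int) : (M %| (u - v)%R)%Z -> (d %| u)%Z = (d %| v)%Z.
  by move=> h; rewrite -(subrK v u) rpredDl // (dvdz_trans dM').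
by split; apply: key.
Qed.

Lemma isB_cong p x y : fcong (p ^ 2)%N x y -> isB p x = isB p y.
Proof.
move=> h; have [e1 _ _ _] := fcong_dvd (dvdnn _) h.
have [_ e2 _ _] := fcong_dvd (dvdn_exp2l p (isT : 1 <= 2)%N) h.
by move: e2; rewrite expn1 /isB e1 => ->.
Qed.

Lemma isE_cong p x y : fcong (p ^ 2)%N x y -> isE p x = isE p y.
Proof.
move=> h; have := fcong_dvd (dvdn_exp2l p (isT : 1 <= 2)%N) h; rewrite expn1.
by move=> [e1 e2 e3 _]; rewrite /isE e1 e2 e3.
Qed.

Lemma bad_at_cong p x y : fcong (p ^ 2)%N x y -> bad_at p x = bad_at p y.
Proof.
move=> h; apply: eq_existsb => r.
by rewrite (isB_cong (fcong_act _ h)) (isE_cong (fcong_act _ h)).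
Qed.

Lemma bad_at_scale p k x : prime p -> ~~ (p %| k)%Z -> bad_at p (fscale k x) = bad_at p x.
Proof.
move=> pp nk; apply: eq_existsb => r; rewrite form_act_scale.
by rewrite /isB /isE /fscale /map_form /= dvdz_sq_coprime // !dvdz_coprime.
Qed.

Definition row_root (p : nat) (x : cubic_form int) (r : option 'I_p) : bool :=
  (p %| ca (form_act (proj_mx r) x))%Z.

(** At most three roots (j : 1) of a nonzero cubic, plus [None]. *)
Lemma card_row_root (p : nat) x : prime p -> ~~ pdiv_form p x ->
  (#|[pred r | @row_root p x r]| <= 4)%N.
Proof.
move=> pp npx.
have chr := pchar_Fp pp; have dvF (z : int) : (p %| z)%Z = (z%:~R == 0 :> 'F_p) by rewrite (dvdz_pcharf chr).
pose q : {poly 'F_p} := (cd x)%:~R%:P + (cc x)%:~R *: 'X + (cb x)%:~R *: 'X^2 + (ca x)%:~R *: 'X^3.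
have q0 : q != 0.
  apply: contra npx => /eqP e; rewrite /pdiv_form !dvF.
  have cf i : q`_i = 0 by rewrite e coef0.
  have := cf 0%N; have := cf 1%N; have := cf 2%N; have := cf 3%N.
  rewrite /q !coefD !coefZ !coefC !coefX !coefXn /= !mulr0 !mulr1 !addr0 !add0r.
  by move=> -> -> -> ->; rewrite eqxx.
have sq : (size q <= 4)%N.
  apply/leq_sizeP => i hi; rewrite /q !coefD !coefZ coefC coefX !coefXn.
  by case: i hi => [|[|[|[|i]]]] //= _; rewrite !mulr0 !addr0.
pose s := [seq j <- enum 'I_p | @row_root p x (Some j)].
have ss : (size s <= 3)%N.
  rewrite -ltnS; apply: leq_trans sq; rewrite -(size_map (fun j : 'I_p => (j : nat)%:R : 'F_p)).
  apply: max_poly_roots => //.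
    apply/allP => _ /mapP[j + ->]; rewrite mem_filter => /andP[hj _].
    move: hj; rewrite /row_root /= dvF /root /q !hornerE /=; case: (x) => a b c d.
    rewrite /form_act !mx22E /= => /eqP e; apply/eqP; rewrite -[RHS]e.
    by rewrite (pmulrn 1 j); ring.
  rewrite map_inj_in_uniq; first by apply: filter_uniq; exact: enum_uniq.
  move=> j k _ _ e.
  apply: val_inj => /=; move/eqP: e; rewrite -subr_eq0 => e.
  have : (p %| ((j : nat)%:Z - (k : nat)%:Z)%R)%Z by rewrite dvF rmorphB /= -!pmulrn.
  by rewrite -eqz_mod_dvd !modz_nat eqz_nat !modn_small // => /eqP.
have sub : {subset enum [pred r | @row_root p x r] <= None :: map Some s}.
  move=> [j|]; rewrite mem_enum inE //= => h.
  by rewrite inE /= map_f // mem_filter h mem_enum.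
rewrite cardE; apply: leq_trans (uniq_leq_size (enum_uniq _) sub) _.
by rewrite /= size_map.
Qed.

Lemma card_proj_le (p : nat) (P : pred (option 'I_p)) : (#|P| <= p.+1)%N.
Proof. by apply: leq_trans (max_card _) _; rewrite card_option card_ord. Qed.

Lemma pdiv_sq_scale (p : nat) x : (0 < p)%N -> pdiv_form (p ^ 2)%N (fscale p%:Z x) = pdiv_form p x.
Proof.
move=> p0; have pz : p%:Z != 0 by rewrite eqz_nat -lt0n.
by rewrite /pdiv_form /fscale /map_form /= PoszX2 !dvdz_mul2l.
Qed.

(** A point of either type is a double root modulo p, and a form not divisible by p has at most one.
    If p divides x, type [isBd] still makes the point a double root of x / p, because it asks p^2 of
    both a and b. *)
Lemma card_double (p : nat) (P : nat -> pred (cubic_form int)) x : prime p ->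
  (forall y, P p y -> isBd p y) \/ ((forall y, P p y -> isTd p y) /\ ~~ pdiv_form p x) ->
  ~~ pdiv_form (p ^ 2)%N x ->
  (#|[pred r : option 'I_p | P p (form_act (proj_mx r) x)]| <= has_type P p x)%N.
Proof.
move=> pp hP np2; have p0 := prime_gt0 pp; have pz : p%:Z != 0 by rewrite eqz_nat -lt0n.
have uniqr r r' : P p (form_act (proj_mx r) x) -> P p (form_act (proj_mx r') x) -> r = r' :> option 'I_p.
  move=> h h'; apply/eqP/negPn/negP => ne.
  have [px|npx] := boolP (pdiv_form p x).
    case: hP => [hB|[_ /negP//]].
    move/pdiv_formP: px => [x' ex]; move: np2; rewrite ex pdiv_sq_scale // => /negP; apply.
    have ab (r0 : option 'I_p) : P p (form_act (proj_mx r0) x) -> (p %| ca (form_act (proj_mx r0) x'))%Z && (p %| cb (form_act (proj_mx r0) x'))%Z.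
      move=> /hB /and3P[+ + _]; rewrite ex form_act_scale /fscale /map_form /= PoszX2 !dvdz_mul2l //.
      by move=> -> ->.
    by have /andP[? ?] := ab _ h; have /andP[? ?] := ab _ h'; apply: (@double_root_proj p r r').
  have ab y : P p y -> (p %| ca y)%Z && (p %| cb y)%Z.
    move=> hy; have /and3P[h1 -> _] : isTd p y by case: hP => [/(_ _ hy)/isBd_isTd|[/(_ _ hy)]].
    by rewrite andbT; apply: dvdz_trans h1; rewrite PoszX2 dvdz_mull.
  case/negP: npx; have /andP[? ?] := ab _ h; have /andP[? ?] := ab _ h'.
  exact: (@double_root_proj p r r').
have [/existsP[r hr]|/existsPn nr] := boolP (has_type P p x).
  rewrite -[nat_of_bool true](card1 r); apply: subset_leq_card; apply/fintype.subsetP => r' hr'.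
  by rewrite !inE; apply/eqP; apply: uniqr.
by rewrite eq_card0 // => r; rewrite !inE; apply/negbTE/nr.
Qed.

Lemma dvd_div3 (p : nat) (k : int) : coprime p 3 -> (3 %| k)%Z ->
  (p %| (k %/ 3)%Z)%Z = (p %| k)%Z.
Proof.
move=> c /dvdzP[j ->]; rewrite mulzK // mulrC Gauss_dvdzr // coprimezE.
Qed.

(** Each lattice transforms into its density times the indicator of its dual: density p^-3 for [isB]
    and [isE], with duals [isBd] and [isEd]; p^-4 for their intersection, with dual [isTd]; and p^-4
    for the multiples of p, which come with the factor p. *)
Lemma FT_bad (R : realType) (p : nat) x : prime p -> (5 <= p)%N -> hatV x ->
  FT (p ^ 2) (fun y => (bad_at p y)%:R) x =
  \sum_(r : option 'I_p)
    ((p%:R ^+ 3)^-1 * (isBd p (form_act (proj_mx r) x))%:R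
     + (p%:R ^+ 3)^-1 * (isEd p (form_act (proj_mx r) x))%:R
     + - (p%:R ^+ 4)^-1 * (isTd p (form_act (proj_mx r) x))%:R)
  + - (p%:R ^+ 3)^-1 * (pdiv_form p x)%:R :> R[i].
Proof.
move=> pp p5 hx; have p0 := prime_gt0 pp; have M0 : (0 < p ^ 2)%N by rewrite expn_gt0 p0.
have pC : p%:R != 0 :> R[i] by rewrite pnatr_eq0 -lt0n.
have c3 : coprime p 3 by rewrite prime_coprime // gtnNdvd //; lia.
have c3' : coprime (p ^ 2) 3 by rewrite coprimeXl.
rewrite (FT_ext (fun y => bad_at_identity _ y pp)).
rewrite (FT_ext (g := fun y => \sum_(r : option 'I_p)
     ((isB p (form_act (proj_mx r) y))%:R + (isE p (form_act (proj_mx r) y))%:R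
      + (-1) * (isB p (form_act (proj_mx r) y) && isE p (form_act (proj_mx r) y))%:R)
     + (- p%:R) * (pdiv_form p y)%:R)); last first.
  move=> y; rewrite mulNr; congr (_ - _); apply: eq_bigr => r _; by rewrite mulN1r.
rewrite FTD FT_sum FTZ; congr (_ + _); last first.
  rewrite (FT_ext (g := fun y => (box_ind p p p p y)%:R)) //.
  rewrite (@FT_box R _ _ _ _ _ p p p p) ?mulnn //.
  have [hb hc] := hx; rewrite !dvd_div3 //.
  have -> : [&& (p %| cd x)%Z, (p %| cc x)%Z, (p %| cb x)%Z & (p %| ca x)%Z] = pdiv_form p x.
    by rewrite /pdiv_form andbC -!andbA; do ![case: (_ \in _)].
  by rewrite -?mulnn !natrM; move: (nat_of_bool _)%:R => z; field.
apply: eq_bigr => r _; rewrite !FTD FTZ.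
have hx' : hatV (form_act (proj_mx r) x) by apply: hatV_act.
have dr := det_proj_mx r.
have [hb hc] := hx'.
congr (_ + _ + _).
- rewrite (FT_act (phi := fun y => (isB p y)%:R)) //; last by move=> y z h; rewrite (isB_cong h).
  rewrite (FT_ext (g := fun y => (box_ind (p ^ 2) p 1 1 y)%:R)); last first.
    by move=> y; rewrite /isB /box_ind !dvd1z !andbT.
  rewrite (@FT_box R _ _ _ _ _ 1 p (p ^ 2) (p ^ 2)) ?mulnn ?muln1 ?mul1n //.
  rewrite !dvd_div3 // dvd1z /=.
  have -> : [&& (p %| cc (form_act (proj_mx r) x))%Z, ((p ^ 2)%N %| cb (form_act (proj_mx r) x))%Z
     & ((p ^ 2)%N %| ca (form_act (proj_mx r) x))%Z] = isBd p (form_act (proj_mx r) x).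
    by rewrite /isBd; do ![case: (_ \in _)].
  by rewrite -?mulnn !natrM; move: (nat_of_bool _)%:R => z; field.
- rewrite (FT_act (phi := fun y => (isE p y)%:R)) //; last by move=> y z h; rewrite (isE_cong h).
  rewrite (FT_ext (g := fun y => (box_ind p p p 1 y)%:R)); last first.
    by move=> y; rewrite /isE /box_ind !dvd1z !andbT.
  rewrite (@FT_box R _ _ _ _ _ p p p (p ^ 2)) ?mulnn ?muln1 ?mul1n //.
  rewrite !dvd_div3 //.
  have -> : [&& (p %| cd (form_act (proj_mx r) x))%Z, (p %| cc (form_act (proj_mx r) x))%Z, (p %| cb (form_act (proj_mx r) x))%Z
     & ((p ^ 2)%N %| ca (form_act (proj_mx r) x))%Z] = isEd p (form_act (proj_mx r) x).
    by rewrite /isEd; do ![case: (_ \in _)].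
  by rewrite -?mulnn !natrM; move: (nat_of_bool _)%:R => z; field.
- rewrite (FT_act (phi := fun y => (isB p y && isE p y)%:R)) //; last first.
    by move=> y z h; rewrite (isB_cong h) (isE_cong h).
  rewrite (FT_ext (g := fun y => (box_ind (p ^ 2) p p 1 y)%:R)); last first.
    move=> y; congr (_%:R); congr nat_of_bool; rewrite /isB /isE /box_ind !dvd1z !andbT.
    apply/idP/idP; first by move=> /andP[/andP[-> ->] /and3P[_ _ ->]].
    move=> /and3P[h1 h2 h3]; rewrite h1 h2 h3 !andbT /=.
    by apply: dvdz_trans h1; rewrite PoszX2 dvdz_mull.
  rewrite (@FT_box R _ _ _ _ _ 1 p p (p ^ 2)) ?mulnn ?muln1 ?mul1n //.
  rewrite !dvd_div3 // dvd1z /=.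
  have -> : [&& (p %| cc (form_act (proj_mx r) x))%Z, (p %| cb (form_act (proj_mx r) x))%Z
     & ((p ^ 2)%N %| ca (form_act (proj_mx r) x))%Z] = isTd p (form_act (proj_mx r) x).
    by rewrite /isTd; do ![case: (_ \in _)].
  by rewrite -?mulnn !natrM; move: (nat_of_bool _)%:R => z; field.
Qed.

(** If p^2 divides x, up to p + 1 points count for each type. If only p does, those for [isEd] and
    [isTd] are roots of x / p modulo p, at most 4. Otherwise no point is of type [isEd]. In both
    latter cases [card_double] leaves at most one point for [isBd], and in the last one for [isTd]
    too. The coefficients 8 cover all of this for p >= 5. *)
Lemma FT_bad_weight (R : realType) (p : nat) x : prime p -> (5 <= p)%N -> hatV x ->
  Normc.normc (FT (p ^ 2) (fun y => (bad_at p y)%:R) x) <= weight R p x.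
Proof.
move=> pp p5 hx; have p0 := prime_gt0 pp; rewrite FT_bad //.
pose cnt (P : nat -> pred (cubic_form int)) := #|[pred r : option 'I_p | P p (form_act (proj_mx r) x)]|.
have pR : 0 < p%:R :> R by rewrite ltr0n.
have p5R : 5 <= p%:R :> R by rewrite ler_nat.
have nk k b : Normc.normc ((p%:R ^+ k)^-1 * (nat_of_bool b)%:R : R[i]) = (p%:R ^+ k)^-1 * b%:R.
  by rewrite Normc.normcM Normc.normcV -natrX !normc_nat natrX.
have nk' k b : Normc.normc (- (p%:R ^+ k)^-1 * (nat_of_bool b)%:R : R[i]) = (p%:R ^+ k)^-1 * b%:R.
  by rewrite mulNr -mulN1r Normc.normcM nk -[X in Normc.normc X]/(Complex (-1) (-0)) /Normc.normc /= oppr0 expr0n /= addr0 sqrrN expr1n sqrtr1 mul1r.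
have cntE (P : nat -> pred (cubic_form int)) : \sum_(r : option 'I_p) (P p (form_act (proj_mx r) x))%:R = (cnt P)%:R :> R.
  by rewrite -natr_sum /cnt -sum1_card [in RHS]big_mkcond /=; congr (_%:R); apply: eq_bigr => r _; case: ifP.
apply: le_trans (_ : (p%:R ^+ 3)^-1 * (cnt isBd)%:R + (p%:R ^+ 3)^-1 * (cnt isEd)%:R +
    (p%:R ^+ 4)^-1 * (cnt isTd)%:R + (p%:R ^+ 3)^-1 * (pdiv_form p x)%:R <= _).
  apply: le_trans (normcD _ _) _; rewrite nk' lerD2r.
  apply: le_trans (normc_sum _ _) _.
  rewrite -!cntE !mulr_sumr -!big_split /=; apply: ler_sum => r _.
  by apply: le_trans (normcD _ _) _; rewrite nk' lerD2r; apply: le_trans (normcD _ _) _; rewrite !nk.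
rewrite /weight ltnNge p5 /=.
have hB : (cnt isBd)%:R <= (has_type isBd p x)%:R + p.+1%:R * (pdiv_form (p ^ 2)%N x)%:R :> R.
  have [p2|np2] := boolP (pdiv_form (p ^ 2)%N x).
    by rewrite mulr1; apply: ler_wpDl => //; rewrite ler_nat card_proj_le.
  by rewrite mulr0 addr0 ler_nat; apply: card_double => //; left.
have p2p : pdiv_form (p ^ 2)%N x -> pdiv_form p x.
  move=> /pdiv_formP[z ->]; apply/pdiv_formP; exists (fscale p%:Z z).
  by rewrite /fscale /map_form /= PoszX2 !mulrA.
have roots (P : nat -> pred (cubic_form int)) : (forall y, P p y -> ((p ^ 2)%N %| ca y)%Z) ->
    pdiv_form p x -> ~~ pdiv_form (p ^ 2)%N x -> (cnt P <= 4)%N.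
  move=> hP /pdiv_formP[x' ex]; rewrite ex pdiv_sq_scale // => npx'.
  apply: leq_trans (card_row_root pp npx'); apply: subset_leq_card; apply/fintype.subsetP => r.
  rewrite !inE => /hP; rewrite ex form_act_scale /fscale /map_form /= PoszX2 dvdz_mul2l //.
  by rewrite eqz_nat -lt0n.
have hE : (cnt isEd)%:R <= 4 * (pdiv_form p x)%:R + p.+1%:R * (pdiv_form (p ^ 2)%N x)%:R :> R.
  have [p2|np2] := boolP (pdiv_form (p ^ 2)%N x).
    by rewrite mulr1; apply: ler_wpDl; [rewrite mulr_ge0|rewrite ler_nat card_proj_le].
  rewrite mulr0 addr0; have [px|npx] := boolP (pdiv_form p x).
    by rewrite mulr1 ler_nat; apply: roots => // y /and4P[].
  rewrite mulr0 /cnt eq_card0 // => r; rewrite !inE; apply/negbTE; apply: contra npx => /and4P[h1 h2 h3 h4].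
  rewrite -(@pdiv_form_actK p (proj_mx r)) ?det_proj_mx ?coprimezE ?coprimen1 //.
  by apply/and4P; split=> //; apply: dvdz_trans h1; rewrite PoszX2 dvdz_mull.
have hT : (cnt isTd)%:R <= (has_type isTd p x)%:R + 4 * (pdiv_form p x)%:R + p.+1%:R * (pdiv_form (p ^ 2)%N x)%:R :> R.
  have [p2|np2] := boolP (pdiv_form (p ^ 2)%N x).
    by rewrite mulr1; apply: ler_wpDl; [rewrite addr_ge0 // mulr_ge0|rewrite ler_nat card_proj_le].
  rewrite mulr0 addr0; have [px|npx] := boolP (pdiv_form p x).
    by rewrite mulr1; apply: ler_wpDl => //; rewrite ler_nat; apply: roots => // y /and3P[].
  by rewrite mulr0 addr0 ler_nat; apply: card_double => //; right.
have a0 : 0 <= (pdiv_form p x)%:R :> R by [].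
have c0 : 0 <= (pdiv_form (p ^ 2)%N x)%:R :> R by [].
have pS : p.+1%:R = p%:R + 1 :> R by rewrite -natr1.
rewrite pS in hB hE hT.
set e : R := (p%:R ^+ 4)^-1.
have e0 : 0 <= e by rewrite invr_ge0 exprn_ge0.
have -> : (p%:R ^+ 3)^-1 = p%:R * e by rewrite /e; field; rewrite gt_eqF.
have -> : (p%:R ^+ 2)^-1 = p%:R ^+ 2 * e by rewrite /e; field; rewrite gt_eqF.
move: hB hE hT a0 c0; move: (cnt isBd)%:R (cnt isEd)%:R (cnt isTd)%:R (has_type isBd p x)%:R
  (has_type isTd p x)%:R (pdiv_form p x)%:R (pdiv_form (p ^ 2)%N x)%:R => B E T b t a c.
move: p%:R pR p5R => P P0 P5 hB hE hT a0 c0.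
have -> : P * e * B + P * e * E + e * T + P * e * a = e * (P * B + P * E + T + P * a) by ring.
have -> : 8 * (P * e) * a + 8 * (P ^+ 2 * e) * c + b * (P * e) + t * e =
   e * (8 * (P * a) + 8 * (P ^+ 2 * c) + P * b + t) by ring.
apply: ler_wpM2l => //.
have h1 : P * B <= P * (b + (P + 1) * c) by rewrite ler_pM2l.
have h2 : P * E <= P * (4 * a + (P + 1) * c) by rewrite ler_pM2l.
have h3 : 0 <= (P - 5) * a by rewrite mulr_ge0 // subr_ge0.
have h4 : 0 <= P * ((P - 1) * c) by rewrite !mulr_ge0 //; lra.
have h5 : 0 <= (P - 1) * c by rewrite !mulr_ge0 //; lra.
nra.
Qed.

Lemma normc_ge0 (R : realType) (z : R[i]) : 0 <= Normc.normc z.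
Proof. by case: z => a b; exact: sqrtr_ge0. Qed.

(** Under y = N y1 + M y2 the character splits, while f sees only N y1 and g only M y2, which the
    scaling hypotheses turn into y1 and y2. *)
Lemma FT_mult (R : realType) M N (f g : cubic_form int -> R[i]) x : (0 < M)%N -> (0 < N)%N ->
  coprime M N -> periodic M f -> periodic N g ->
  (forall y, f (fscale N%:Z y) = f y) -> (forall y, g (fscale M%:Z y) = g y) ->
  FT (M * N) (fun y => f y * g y) x = FT M f x * FT N g x.
Proof.
move=> M0 N0 cMN pf pg sf sg; rewrite /FT.
have MN0 : (0 < M * N)%N by rewrite muln_gt0 M0.
rewrite fsum_crt //; last first.
  move=> y z h; rewrite (chi_upz_periodic R x MN0 h).
  have hM : fcong M y z.
    have dM : (M %| Posz (M * N)%N)%Z by rewrite PoszM dvdz_mulr.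
    by move: h => /and4P[h1 h2 h3 h4]; apply/and4P; split; apply: dvdz_trans dM _.
  have hN : fcong N y z.
    have dN : (N %| Posz (M * N)%N)%Z by rewrite PoszM dvdz_mull.
    by move: h => /and4P[h1 h2 h3 h4]; apply/and4P; split; apply: dvdz_trans dN _.
  by rewrite (pf _ _ hM) (pg _ _ hN).
rewrite natrM exprMn invfM mulrACA; congr (_ * _).
rewrite /fsum big_distrlr /=; apply: eq_bigr => t _; apply: eq_bigr => u _.
have e1 : f (fadd (fscale N%:Z (cform t)) (fscale M%:Z (cform u))) = f (cform t).
  by rewrite -(sf (cform t)); apply: pf; exact: fcong_scale.
have e2 : g (fadd (fscale N%:Z (cform t)) (fscale M%:Z (cform u))) = g (cform u).
  rewrite -(sg (cform u)); apply: pg.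
  have -> : fadd (fscale N%:Z (cform t)) (fscale M%:Z (cform u)) =
    fadd (fscale M%:Z (cform u)) (fscale N%:Z (cform t)).
    by rewrite /fadd; congr CubicForm; rewrite addrC.
  exact: fcong_scale.
rewrite e1 e2 upzD !upzZ chiD chi_scale // mulnC chi_scale //.
by rewrite mulrACA.
Qed.

Lemma FT_norm_le1 (R : realType) M (f : cubic_form int -> bool) x : (0 < M)%N ->
  Normc.normc (FT M (fun y => (f y)%:R) x : R[i]) <= 1.
Proof.
move=> M0; rewrite /FT Normc.normcM Normc.normcV -natrX normc_nat.
rewrite mulrC ler_pdivrMr ?ltr0n ?expn_gt0 ?M0 // mul1r.
apply: le_trans (normc_sum _ _) _.
apply: le_trans (_ : \sum_(t : 'I_M * 'I_M * 'I_M * 'I_M) 1 <= _).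
  apply: ler_sum => t _; rewrite Normc.normcM chi_norm mulr1 normc_nat.
  by case: (f _).
rewrite sumr_const !card_prod !card_ord ler_nat; lia.
Qed.

Definition bad_all (s : seq nat) (y : cubic_form int) : bool := all (bad_at^~ y) s.

Lemma FT_bad_all (R : realType) (s : seq nat) x : uniq s -> all prime s -> hatV x ->
  Normc.normc (FT ((\prod_(p <- s) p) ^ 2) (fun y => (bad_all s y)%:R) x) <=
  \prod_(p <- s) weight R p x.
Proof.
elim: s => [|p s IH] /=.
  by move=> _ _ _; rewrite !big_nil; exact: (@FT_norm_le1 R _ (bad_all [::])).
move=> /andP[ps us] /andP[pp as_] hx; rewrite !big_cons expnMn.
set Q := (\prod_(q <- s) q)%N in IH *.
have Q0 : (0 < Q)%N by apply: prod_primes_gt0.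
have p0 := prime_gt0 pp.
have cpQ : coprime p Q.
  have := @coprime_prods [:: p] s; rewrite big_seq1; apply=> q r.
  rewrite inE => /eqP -> rs; split; rewrite ?(allP as_ _ rs) //.
  by apply: contraNneq ps => ->.
have qQ q : q \in s -> (q %| Q)%N by apply: dvd_prod_seq.
have per : periodic (Q ^ 2) (fun y => (bad_all s y)%:R : R[i]).
  move=> y z h; congr (_%:R); congr nat_of_bool; apply: eq_in_all => q qs.
  apply: bad_at_cong; have dq : ((q ^ 2)%N %| Posz (Q ^ 2)%N)%Z by rewrite dvdzE /= dvdn_exp2r ?qQ.
  by move: h => /and4P[h1 h2 h3 h4]; apply/and4P; split; apply: dvdz_trans dq _.
rewrite (FT_ext (g := fun y => (bad_at p y)%:R * (bad_all s y)%:R)); last first.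
  by move=> y; rewrite /=; case: (bad_at p y); case: (bad_all s y); rewrite ?mulr0 ?mul0r ?mulr1.
rewrite FT_mult ?expn_gt0 ?p0 ?Q0 ?coprimeXl ?coprimeXr //.
- rewrite Normc.normcM; apply: ler_pM.
  + exact: normc_ge0.
  + exact: normc_ge0.
  + have [p5|p5] := ltnP p 5; first by rewrite /weight p5; apply: FT_norm_le1; rewrite expn_gt0 p0.
    exact: FT_bad_weight.
  + exact: IH.
- by move=> y z h; rewrite (bad_at_cong h).
- move=> y; rewrite bad_at_scale // dvdzE /= Euclid_dvdX // negb_and -prime_coprime //.
  by rewrite cpQ.
- move=> y; congr (_%:R); congr nat_of_bool; apply: eq_in_all => q qs.
  have qp := allP as_ _ qs.
  rewrite bad_at_scale // dvdzE /= Euclid_dvdX // negb_and dvdn_prime2 //.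
  by apply/orP; left; apply: contraNneq ps => <-.
Qed.

(** * p-adic integers *)

Lemma fractionE (A : idomainType) (x : {fraction A}) :
  exists (a b : A), b != 0 /\ x = FracField.tofrac a / FracField.tofrac b.
Proof.
elim/quotW: x => r; exists (frac r).1, (frac r).2.
have d0 := denom_ratioP r; split=> //.
have e0 : FracField.tofrac (frac r).2 != 0 by rewrite tofrac_eq0.
apply: (mulIf e0); rewrite mulfVK //.
rewrite -[_ * _]/(FracField.mul _ _).
apply/eqP; rewrite !piE FracField.equivfE /=.
rewrite /FracField.mulf.
rewrite !numden_Ratio ?mulf_neq0 ?oner_eq0 //.
by rewrite !mulr1 mulrC.
Qed.

Lemma padic_of_intD p (pr : prime p) (m n : int) :
  padic_of_int pr (m + n) = padic_of_int pr m + padic_of_int pr n.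
Proof. by apply: padic_ext => k /=; rewrite modzDm. Qed.

Lemma padic_of_intM p (pr : prime p) (m n : int) :
  padic_of_int pr (m * n) = padic_of_int pr m * padic_of_int pr n.
Proof. by apply: padic_ext => k /=; rewrite modzMm. Qed.

Definition padic_red p (pr : prime p) (x : padic_int pr) : 'F_p := (res x 1)%:~R.

Lemma intr_modF p (m : int) : prime p -> ((m %% p)%Z)%:~R = m%:~R :> 'F_p.
Proof.
by move=> pr; apply/eqP; rewrite -subr_eq0 -rmorphB /= -(dvdz_pcharf (pchar_Fp pr)) -eqz_mod_dvd modz_mod.
Qed.

Lemma padic_red_int p (pr : prime p) m : padic_red (padic_of_int pr m) = m%:~R.
Proof. by rewrite /padic_red /= expn1 intr_modF. Qed.

Lemma padic_redD p (pr : prime p) (x y : padic_int pr) :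
  padic_red (x + y) = padic_red x + padic_red y.
Proof. by rewrite /padic_red -rmorphD /= expn1 intr_modF. Qed.

Lemma padic_redM p (pr : prime p) (x y : padic_int pr) :
  padic_red (x * y) = padic_red x * padic_red y.
Proof. by rewrite /padic_red -rmorphM /= expn1 intr_modF. Qed.

Lemma padic_red0 p (pr : prime p) : padic_red (0 : padic_int pr) = 0.
Proof. by rewrite -[0 in LHS]/(padic_of_int pr 0) padic_red_int. Qed.

Lemma padic_red1 p (pr : prime p) : padic_red (1 : padic_int pr) = 1.
Proof. by rewrite -[1 in LHS]/(padic_of_int pr 1) padic_red_int. Qed.

Lemma padic_redB p (pr : prime p) (x y : padic_int pr) :
  padic_red (x - y) = padic_red x - padic_red y.
Proof. by apply/eqP; rewrite -(inj_eq (addIr (padic_red y))) -padic_redD !subrK. Qed.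

HB.instance Definition _ p (pr : prime p) :=
  GRing.isZmodMorphism.Build (padic_int pr) 'F_p (@padic_red p pr) (@padic_redB p pr).

HB.instance Definition _ p (pr : prime p) :=
  GRing.isMonoidMorphism.Build (padic_int pr) 'F_p (@padic_red p pr)
    (conj (padic_red1 pr) (@padic_redM p pr)).

Definition padic_p p (pr : prime p) : padic_int pr := padic_of_int pr p.

Lemma padic_pE p (pr : prime p) : padic_p pr = p%:R.
Proof.
suff h n : padic_of_int pr n%:Z = n%:R by exact: h.
by elim: n => [|n IH] //; rewrite -addn1 PoszD padic_of_intD IH natrD.
Qed.

Lemma padic_red_p p (pr : prime p) : padic_red (padic_p pr) = 0.
Proof. by rewrite padic_red_int -[p%:Z%:~R]/(p%:R) pchar_Fp_0. Qed.

Lemma padic_red_res p (pr : prime p) (x : padic_int pr) : (padic_red x == 0) = (res x 1 == 0).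
Proof.
rewrite /padic_red -(dvdz_pcharf (pchar_Fp pr)).
have := res_mod x 1; rewrite expn1 => e; apply/idP/eqP => [/dvdz_mod0P|->]; first by rewrite e.
by rewrite dvdz0.
Qed.

Lemma padic_red_eq0 p (pr : prime p) (x : padic_int pr) :
  padic_red x = 0 -> exists y, x = padic_p pr * y.
Proof.
move=> /eqP; rewrite padic_red_res => /eqP x1.
have pz : (p%:Z != 0) by rewrite eqz_nat -lt0n prime_gt0.
have pdiv n : (p %| res x n.+1)%Z.
  apply/dvdz_mod0P; have := res_mod_add x 1 n; rewrite expn1 add1n x1 => <- //.
(* Dividing by p costs one level: the quotient modulo p^n is read from x modulo p^(n + 1). *)
have coh n : (res x n.+1 %/ p)%Z = ((res x n.+2 %/ p)%Z %% (p ^ n)%N)%Z.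
  have /dvdzP[u eu] := pdiv n.+1; have /dvdzP[v ev] := pdiv n.
  have := res_coh x n.+1; rewrite eu ev expnS PoszM !mulzK // => e.
  apply: (mulfI pz); rewrite mulz_modr // 1?mulrC //.
    by rewrite e [u * _]mulrC.
  by rewrite ltz_nat prime_gt0.
exists (PadicInt pr coh); apply: padic_ext => n /=.
have /dvdzP[u eu] := pdiv n.
rewrite modzMml [in RHS](mulrC p%:Z) divzK //.
by rewrite -res_coh.
Qed.

Lemma padic_unit_red p (pr : prime p) (x : padic_int pr) : padic_red x != 0 -> exists y, y * x = 1.
Proof.
rewrite padic_red_res => x1.
have cop n : coprimez (res x n) (p ^ n)%N.
  rewrite coprimezE; case: n => [|n]; first by rewrite expn0 coprimen1.
  rewrite /= coprime_sym coprimeXl // prime_coprime //.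
  apply: contra x1 => h; have := res_mod_add x 1 n; rewrite expn1 add1n => ->.
  by apply/eqP/dvdz_mod0P.
have inv n : exists u, ((p ^ n)%N %| (u * res x n - 1)%R)%Z.
  have /coprimezP[[u v] /= e] := cop n; exists u.
  by apply/dvdzP; exists (- v); rewrite -e; ring.
have [u hu] := choice inv.
pose y n := (u n %% (p ^ n)%N)%Z.
have pn n : (p ^ n)%N%:Z != 0 by rewrite eqz_nat expn_eq0 negb_and -lt0n prime_gt0.
(* Inverses modulo p^n are unique, which makes the chosen ones coherent. *)
have coh n : y n = (y n.+1 %% (p ^ n)%N)%Z.
  rewrite /y modz_coh; apply/eqP; rewrite eqz_mod_dvd.
  have c : coprimez (p ^ n)%N (res x n) by rewrite coprimez_sym cop.
  rewrite -(Gauss_dvdzl _ c).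
  have d1 := hu n.
  have d2 : ((p ^ n)%N %| (u n.+1 * res x n.+1 - 1)%R)%Z.
    by apply: dvdz_trans (hu n.+1); rewrite expnS PoszM dvdz_mull.
  have d3 : ((p ^ n)%N %| (res x n.+1 - res x n)%R)%Z.
    by rewrite -eqz_mod_dvd -res_coh res_mod.
  have -> : (u n - u n.+1) * res x n = (u n * res x n - 1) - (u n.+1 * res x n.+1 - 1) +
     u n.+1 * (res x n.+1 - res x n) by ring.
  by apply: rpredD; [apply: rpredB|apply: dvdz_mull].
exists (PadicInt pr coh); apply: padic_ext => n /=.
by rewrite /y modzMml; apply/eqP; rewrite eqz_mod_dvd hu.
Qed.

Lemma padic_unitE p (pr : prime p) (x : padic_int pr) : (x \is a GRing.unit) = (padic_red x != 0).
Proof.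
apply/idP/idP => [ux|/padic_unit_red[y e]].
  have := rmorph_unit (padic_red (pr := pr)) ux.
  by rewrite unitfE.
by apply/unitrP; exists y; rewrite e mulrC e.
Qed.

Lemma padic_factor p (pr : prime p) (x : padic_int pr) : x != 0 ->
  exists k u, u \is a GRing.unit /\ x = padic_p pr ^+ k * u.
Proof.
move=> x0; have [n xn] : exists n, res x n != 0.
  apply: contrapT => h; case/eqP: x0; apply: padic_ext => n.
  rewrite /= mod0z; apply/eqP/negPn/negP => nz; by apply: h; exists n.
(* Dividing by p lowers the level at which x is seen to be nonzero; at level 0 all residues
   vanish. *)
elim: n x {x0} xn => [|n IH] x xn.
  by move: (res_mod x 0) xn; rewrite expn0 modz1 => <-; rewrite eqxx.
have [ux|] := boolP (x \is a GRing.unit); first by exists 0%N, x; rewrite mul1r.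
rewrite padic_unitE negbK => /eqP/padic_red_eq0[y ey].
have yn : res y n != 0.
  apply: contra xn => /eqP y0; rewrite ey /= modzMml; apply/eqP/dvdz_mod0P.
  rewrite expnS PoszM; apply: dvdz_mul => //.
  by apply/dvdz_mod0P; rewrite -res_coh.
have [k [u [uu e]]] := IH _ yn; exists k.+1, u; split=> //.
by rewrite ey e exprS mulrA.
Qed.

Lemma padic_p_neq0 p (pr : prime p) : padic_p pr != 0.
Proof.
apply/eqP => /(congr1 (fun x => res x 2)) /=; rewrite mod0z modz_small.
  by move=> [] /eqP; rewrite -leqn0 leqNgt prime_gt0.
rewrite ltz_nat -[X in (X < _)%N]expn1 ltn_exp2l ?prime_gt1 //.
Qed.

(** Comparing valuations: either x is integral or 1 / x lies in p Z_p. The second case is stated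
    through the inverse, as excluding roots of an Eisenstein polynomial requires. *)
Lemma Qp_dichotomy p (pr : prime p) (x : Qp pr) :
  (exists z : padic_int pr, x = FracField.tofrac z) \/
  (exists z : padic_int pr, x * FracField.tofrac (padic_p pr * z) = 1).
Proof.
have [a [b [b0 ->]]] := fractionE x.
have [->|a0] := eqVneq a 0; first by left; exists 0; rewrite tofrac0 mul0r.
have [k [u [uu ea]]] := padic_factor a0; have [l [v [uv eb]]] := padic_factor b0.
have tp0 : FracField.tofrac (padic_p pr) != 0 by rewrite tofrac_eq0 padic_p_neq0.
have tu (w : padic_int pr) : w \is a GRing.unit -> FracField.tofrac w != 0.
  by move=> uw; rewrite tofrac_eq0; apply: contraTneq uw => ->; rewrite unitr0.
rewrite ea eb !tofracM !tofracXn.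
have tinv (w : padic_int pr) : w \is a GRing.unit ->
    FracField.tofrac w * FracField.tofrac w^-1 = 1.
  by move=> uw; rewrite -tofracM divrr // tofrac1.
have [lk|kl] := leqP l k.
  left; exists (padic_p pr ^+ (k - l) * u * v^-1).
  rewrite !tofracM !tofracXn -{1}(subnK lk) exprD.
  apply: (mulIf (mulf_neq0 (expf_neq0 l tp0) (tu _ uv))).
  rewrite mulfVK ?mulf_neq0 ?(expf_neq0 _ tp0) ?tu //.
  rewrite -[RHS]mulr1 -[X in _ = _ * X](tinv _ uv).
  move: (FracField.tofrac v) (FracField.tofrac v^-1) (tinv _ uv) => V V' e.
  by rewrite e mulr1 -!mulrA [V' * (_ * _)]mulrCA [V' * V]mulrC e mulr1; ring.
right; exists (padic_p pr ^+ (l - k.+1) * v * u^-1).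
rewrite !tofracM !tofracXn -{1}(subnK kl) exprD.
rewrite -[RHS](tinv _ uu) -(mulr1 (_ * FracField.tofrac u^-1)).
have h : (FracField.tofrac (padic_p pr) ^+ (l - k.+1)
  * FracField.tofrac (padic_p pr) ^+ k.+1 * FracField.tofrac v) != 0.
  by rewrite !mulf_neq0 ?(expf_neq0 _ tp0) ?tu.
rewrite mulrAC; apply: (mulIf h); rewrite divfK // exprS mulr1.
ring.
Qed.

(** * Total ramification and triple roots *)

(* The action of the matrix [[j, 1], [-1, 0]], for which the substitution on Delone-Faddeev
   rings is an explicit isomorphism. *)
Definition inv_shift (A : comNzRingType) (j : A) (f : cubic_form A) : cubic_form A :=
  let: CubicForm a b c d := f in
  CubicForm (a * j ^+ 3 + b * j ^+ 2 + c * j + d)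
    (- (3%:R * a * j ^+ 2 + 2%:R * b * j + c)) (3%:R * a * j + b) (- a).

Lemma form_act_inv_shift (j : int) f : form_act (mx22 j 1 (-1) 0) f = inv_shift j f.
Proof.
by case: f => a b c d; rewrite /form_act /inv_shift !mx22E; congr CubicForm; ring.
Qed.

Lemma map_inv_shift (A B : comNzRingType) (h : {rmorphism A -> B}) j f :
  map_form h (inv_shift j f) = inv_shift (h j) (map_form h f).
Proof.
case: f => a b c d; rewrite /inv_shift /map_form /=.
by congr CubicForm; ring.
Qed.

Definition DFpull (A : comNzRingType) (j : A) (f : cubic_form A)
    (r : DFring (inv_shift j f)) : DFring f :=
  let: (x, y, z) := r in
  (x + y * (ca f * j ^+ 2 + cb f * j) + z * ca f * j, y * j - z, y).

Definition DFpush (A : comNzRingType) (j : A) (f : cubic_form A) (r : DFring f) :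
    DFring (inv_shift j f) :=
  let: (x, y, z) := r in
  (x - z * (ca f * j ^+ 2 + cb f * j) - (j * z - y) * ca f * j, z, j * z - y).

Lemma DFpushK (A : comNzRingType) j (f : cubic_form A) : cancel (@DFpush A j f) (@DFpull A j f).
Proof. by case: f => a b c d [[x y] z]; congr (_, _, _) => /=; ring. Qed.

Lemma DFpullK (A : comNzRingType) j (f : cubic_form A) : cancel (@DFpull A j f) (@DFpush A j f).
Proof. by case: f => a b c d [[x y] z]; congr (_, _, _) => /=; ring. Qed.

Lemma DFpushM (A : comNzRingType) j (f : cubic_form A) (r s : DFring f) :
  DFpush j (r * s) = DFpush j r * DFpush j s.
Proof.
suff h : DFpush j (DFmul r s) = DFmul (DFpush j r) (DFpush j s) by exact: h.
by case: f r s => a b c d [[x y] z] [[x' y'] z'] /=; congr (_, _, _); ring.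
Qed.

Lemma DFpush1 (A : comNzRingType) j (f : cubic_form A) : DFpush j (1 : DFring f) = 1.
Proof. by case: f => a b c d; congr (_, _, _) => /=; ring. Qed.

Lemma DFpushB (A : comNzRingType) j (f : cubic_form A) (r s : DFring f) :
  DFpush j (r - s) = DFpush j r - DFpush j s.
Proof. by case: f r s => a b c d [[x y] z] [[x' y'] z']; congr (_, _, _) => /=; ring. Qed.

HB.instance Definition _ (A : comNzRingType) j (f : cubic_form A) :=
  GRing.isZmodMorphism.Build (DFring f) (DFring (inv_shift j f)) (@DFpush A j f) (@DFpushB A j f).

HB.instance Definition _ (A : comNzRingType) j (f : cubic_form A) :=
  GRing.isMonoidMorphism.Build (DFring f) (DFring (inv_shift j f)) (@DFpush A j f)
    (conj (@DFpush1 A j f) (@DFpushM A j f)).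

(** The generator w satisfies w^3 + b w^2 + a c w + a^2 d = 0. With e = x / y, nilpotency of x + y w
    turns this polynomial into (w + e)^3, so a^2 f = (a u + e v)^3, and moving the root u = -(e / a)
    v leaves only the last coefficient. *)
Lemma cube_of_nilpotent_w (F : fieldType) (f : cubic_form F) (x y : F) :
  let r : DFring f := (x, y, 0) in r ^+ 3 = 0 -> r ^+ 2 != 0 ->
  exists j d, inv_shift j f = CubicForm 0 0 0 d.
Proof.
case: f => a b c d r; rewrite exprS expr2.
rewrite -[r * r]/(DFmul _ _) -[r * DFmul _ _]/(DFmul _ _) /r /= => -[e1 e2 e3] nz.
have [y0|y0] := eqVneq y 0.
  move: e1; rewrite y0 !(mulr0, mul0r, subr0, addr0) => /eqP; rewrite !mulf_eq0 !orbb => /eqP x0.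
  by case/eqP: nz; rewrite y0 x0 !(mulr0, mul0r, subr0, addr0).
have [a0|a0] := eqVneq a 0.
  have x0 : x = 0.
    move: e1; rewrite a0 !(mulr0, mul0r, subr0, addr0) => /eqP.
    by rewrite !mulf_eq0 !orbb => /eqP.
  have b0 : b = 0.
    have : b ^+ 2 * y ^+ 3 = 0.
      move: e2; rewrite a0 x0 !(mulr0, mul0r, subr0, addr0, add0r) => e2.
      by rewrite -[RHS]e2; ring.
    by move/eqP; rewrite mulf_eq0 ?expf_eq0 (negbTE y0) orbF => /eqP.
  by case/eqP: nz; rewrite a0 x0 b0 !(mulr0, mul0r, subr0, addr0).
pose e := x / y; have ex : x = e * y by rewrite /e divfK.
have eb : b = 3%:R * e.
  have : a * y ^+ 3 * (3%:R * e - b) = 0 by rewrite -[RHS]e3 ex; ring.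
  move/eqP; rewrite !mulf_eq0 ?expf_eq0 (negbTE y0) (negbTE a0) /= subr_eq0.
  by move/eqP.
have ec : a * c = 3%:R * e ^+ 2.
  have : y ^+ 3 * (3%:R * e ^+ 2 - a * c) = 0 by rewrite -[RHS]e2 ex eb; ring.
  move/eqP; rewrite !mulf_eq0 ?expf_eq0 (negbTE y0) /= subr_eq0.
  by move/eqP.
have ed : a ^+ 2 * d = e ^+ 3.
  have : y ^+ 3 * (e ^+ 3 - a ^+ 2 * d) = 0 by rewrite -[RHS]e1 ex eb; ring.
  move/eqP; rewrite !mulf_eq0 ?expf_eq0 (negbTE y0) /= subr_eq0.
  by move/eqP.
exists (- e / a), (- a).
have -> : c = 3%:R * e ^+ 2 / a by rewrite -ec mulrC mulKf.
have -> : d = e ^+ 3 / a ^+ 2 by rewrite -ed mulrC mulKf // expf_neq0.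
by rewrite /inv_shift eb; congr CubicForm; field.
Qed.

Lemma cube_of_nilpotent (F : fieldType) (f : cubic_form F) (r : DFring f) :
  r ^+ 3 = 0 -> r ^+ 2 != 0 ->
  (exists j d, inv_shift j f = CubicForm 0 0 0 d) \/
  exists i j d, inv_shift j (inv_shift i f) = CubicForm 0 0 0 d.
Proof.
case: r => [[x y] z]; have [->|z0] := eqVneq z 0.
  by move=> h1 h2; left; apply: cube_of_nilpotent_w h1 h2.
(* [DFpush j] has last coordinate j z - y, which this j kills. *)
move=> h1 h2; right; exists (y / z).
set s : DFring f := (x, y, z) in h1 h2.
have hs : DFpush (y / z) s ^+ 3 = 0 by rewrite -rmorphXn h1 rmorph0.
have hs2 : DFpush (y / z) s ^+ 2 != 0.
  by rewrite -rmorphXn raddf_eq0 //; exact: can_inj (@DFpushK _ _ _).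
move: hs hs2; rewrite /DFpush /s.
have -> : y / z * z - y = 0 by rewrite divfK // subrr.
exact: cube_of_nilpotent_w.
Qed.

Definition DFmap (A B : comNzRingType) (h : A -> B) (f : cubic_form A) (r : DFring f) :
  DFring (map_form h f) := let: (x, y, z) := r in (h x, h y, h z).

Lemma DFmapM (A B : comNzRingType) (h : {rmorphism A -> B}) (f : cubic_form A) (r s : DFring f) :
  DFmap h (r * s) = DFmap h r * DFmap h s.
Proof.
suff e : DFmap h (DFmul r s) = DFmul (DFmap h r) (DFmap h s) by exact: e.
by case: f r s => a b c d [[x y] z] [[x' y'] z'] /=; congr (_, _, _); ring.
Qed.

Definition DFscal (A : comNzRingType) (f : cubic_form A) (k : A) : DFring f := (k, 0, 0).

Lemma DFscalM (A : comNzRingType) (f : cubic_form A) k x y z :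
  DFscal f k * ((x, y, z) : DFring f) = (k * x, k * y, k * z).
Proof.
suff e : DFmul (DFscal f k) ((x, y, z) : DFring f) = (k * x, k * y, k * z) by exact: e.
by case: f => a b c d /=; congr (_, _, _); ring.
Qed.

Lemma DFnat (A : comNzRingType) (f : cubic_form A) n : n%:R = DFscal f n%:R.
Proof.
elim: n => [|n IH] //; rewrite mulrS IH [in RHS]mulrS.
by congr (_, _, _) => /=; rewrite addr0.
Qed.

Lemma Fp_int_surj p (x : 'F_p) : exists k : int, x = k%:~R.
Proof. by exists (x : nat)%:Z; rewrite -[LHS]natr_Zp. Qed.

Lemma isE_modp p f d : prime p -> map_form (fun k : int => k%:~R : 'F_p) f = CubicForm 0 0 0 d ->
  isE p f.
Proof.
move=> pr [/eqP h1 /eqP h2 /eqP h3 _].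
by apply/and3P; split; rewrite (dvdz_pcharf (pchar_Fp pr)).
Qed.

Lemma map_form_red p (pr : prime p) f :
  map_form (@padic_red p pr) (map_form (padic_of_int pr) f) = map_form (fun k : int => k%:~R : 'F_p) f.
Proof. by rewrite /map_form /= !padic_red_int. Qed.

Lemma totally_ramified_isE p (pr : prime p) f : totally_ramified_at pr f ->
  exists r : option 'I_p, isE p (form_act (proj_mx r) f).
Proof.
move=> [K [dK [w [iw [w0 uw] [p0 ip ipi]]] [phi [inj rng]]]].
rewrite dK in p0 ip ipi.
have cl x : integers x -> exists r, x = phi r.
  by rewrite -rng => -[r _ <-]; exists r.
have lc r : integers (phi r) by rewrite -rng; exists r.
have [r er] := cl w iw.
have [s es] := cl _ ipi; have [t et] := cl _ ip.
set F := map_form (padic_of_int pr) f in phi inj rng cl lc r er s es t et *.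
have phip : phi (DFscal F (padic_p pr)) = p%:R by rewrite padic_pE -DFnat rmorph_nat.
have pK0 : p%:R != 0 :> K by apply: contraNneq p0 => ->; rewrite mul0r.
have r3 : r ^+ 3 = DFscal F (padic_p pr) * s.
  apply: inj; rewrite rmorphXn rmorphM phip -er -es invf_div mulrCA divff ?mulr1 //.
have scal0 (u : DFring F) : DFmap (@padic_red p pr) (DFscal F (padic_p pr) * u) = 0.
  by case: u => [[x y] z]; rewrite DFscalM /DFmap !padic_redM padic_red_p !mul0r.
have scalP (u : DFring F) : DFmap (@padic_red p pr) u = 0 ->
    exists v, u = DFscal F (padic_p pr) * v.
  case: u => [[x y] z] [/padic_red_eq0[x' ->] /padic_red_eq0[y' ->] /padic_red_eq0[z' ->]].
  by exists (x', y', z'); rewrite DFscalM.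
have mM (u v : DFring F) : DFmap (@padic_red p pr) (u * v) =
    DFmap (@padic_red p pr) u * DFmap (@padic_red p pr) v by exact: DFmapM.
have q3 : (DFmap (@padic_red p pr) r) ^+ 3 = 0.
  transitivity (DFmap (@padic_red p pr) (r ^+ 3)); last by rewrite r3 scal0.
  by rewrite [in RHS]exprS [in RHS]expr2 [LHS]exprS [in LHS]expr2 mM [X in _ = _ * X]mM.
(* Otherwise w^2 = p phi(v). As p / w^3 is integral, the ramification index being 3, so is the
   product 1 / w = phi(v) (p / w^3), and the uniformizer property would make 1 a nonunit. *)
have q2 : (DFmap (@padic_red p pr) r) ^+ 2 != 0.
  apply/eqP; rewrite expr2 -mM => /scalP[v ev].
  have i1 : integers (1 / w).
    have -> : 1 / w = phi (v * t).
      rewrite rmorphM -et; move/(congr1 phi): ev; rewrite !rmorphM phip -er => ev.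
      have -> : phi v = w * w / p%:R by rewrite ev mulrC mulKf.
      by field; rewrite w0.
    exact: lc.
  have int1 : integers (1 : K) by rewrite -(rmorph1 phi); apply: lc.
  have [_ h] := uw _ int1; apply: (h i1).
  by split; rewrite ?oner_eq0 ?invr1.
have lift g : \det g = 1 -> isE p (form_act g f) ->
    exists r : option 'I_p, isE p (form_act (proj_mx r) f).
  move=> dg; apply: lower_stable_lift (isE_stable pr) _ => //.
  by rewrite dg dvdz1 /= neq_ltn prime_gt1 // orbT.
have det_shift (j : int) : \det (mx22 j 1 (-1) 0) = 1 by rewrite det22 !mx22E; ring.
have := cube_of_nilpotent q3 q2; rewrite map_form_red.
case=> [[j [d]]|[i [j [d]]]].
  have [J ->] := Fp_int_surj j; rewrite -(map_inv_shift intr) -form_act_inv_shift => e.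
  by apply: (lift (mx22 J 1 (-1) 0)) => //; apply: isE_modp e.
have [J ->] := Fp_int_surj j; have [I ->] := Fp_int_surj i.
rewrite -(map_inv_shift intr) -(map_inv_shift intr) -!form_act_inv_shift -form_actM => e.
apply: (lift (mx22 J 1 (-1) 0 *m mx22 I 1 (-1) 0)); last exact: isE_modp e.
by rewrite det_mulmx !det_shift mulr1.
Qed.

(** * Eisenstein forms and totally ramified cubic extensions *)

Lemma adjoin_root_free (E : fieldType) (K : fieldExtType E) (h : {poly E}) (T : K) (x y z : E) :
  irreducible_poly h -> size h = 4%N -> root (map_poly (in_alg K) h) T ->
  x%:A + y%:A * T + z%:A * T ^+ 2 = 0 -> [/\ x = 0, y = 0 & z = 0].
Proof.
move=> ih sh rT e; pose P := Poly [:: x; y; z].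
have PT : (map_poly (in_alg K) P).[T] = 0.
  rewrite /P /= !cons_poly_def !(rmorphD, rmorphM, rmorph0) /= map_polyX !map_polyC /=.
  by rewrite !hornerE -[RHS]e; ring.
have [P0|P0] := eqVneq P 0.
  have cP i : P`_i = 0 by rewrite P0 coef0.
  by have := (cP 0%N, cP 1%N, cP 2%N); rewrite /P !coef_Poly /= => -[[-> ->] ->].
have : coprimep h P.
  rewrite irreducible_poly_coprime //; apply: contraL (size_Poly [:: x; y; z]) => hd.
  by rewrite -ltnNge; have := dvdp_leq P0 hd; rewrite sh.
move=> /Bezout_eq1_coprimepP[[u v] /= /(congr1 (fun q => (map_poly (in_alg K) q).[T]))].
rewrite !(rmorphD, rmorphM, rmorph1) /= !hornerE PT (rootP rT) !mulr0 addr0 => /eqP.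
by rewrite eq_sym oner_eq0.
Qed.

Lemma adjoin_root_span (E : fieldType) (K : fieldExtType E) (h : {poly E}) (T : K) (v : K) :
  size h = 4%N -> root (map_poly (in_alg K) h) T -> <<1; T>>%VS = fullv ->
  exists x y z : E, v = x%:A + y%:A * T + z%:A * T ^+ 2.
Proof.
move=> sh rT full.
have vT : v \in <<1; T>>%VS by rewrite full memvf.
have /polyOver1P[q eq] := @Fadjoin_polyOver _ K 1%VS T v.
have := Fadjoin_poly_eq vT; rewrite eq => <-.
have h0 : h != 0 by rewrite -size_poly_eq0 sh.
rewrite (divp_eq q h) rmorphD rmorphM !hornerE /= (rootP rT) mulr0 add0r.
have : (size (q %% h)%R <= 3)%N by rewrite -ltnS -sh ltn_modpN0.
move: (q %% h)%R => r sr; exists r`_0, r`_1, r`_2.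
rewrite (@horner_coef_wide _ 3); last by rewrite size_map_poly.
by rewrite !big_ord_recl big_ord0 !coef_map /= expr0 expr1 mulr1 addr0 addrA.
Qed.

Lemma horner_map_cubic (E K : comNzRingType) (g : {rmorphism E -> K}) u v w x :
  (map_poly g ('X^3 + u%:P * 'X^2 + v%:P * 'X + w%:P)).[x] =
  x ^+ 3 + g u * x ^+ 2 + g v * x + g w.
Proof.
rewrite 3!rmorphD /= map_polyXn (rmorphM _ u%:P) (rmorphM _ v%:P) /= map_polyXn map_polyX.
by rewrite !map_polyC !hornerD !hornerCM !hornerXn hornerX hornerC.
Qed.

Lemma size_cubic (E : comNzRingType) (u v w : E) :
  size ('X^3 + u%:P * 'X^2 + v%:P * 'X + w%:P) = 4%N.
Proof.
rewrite -!addrA size_polyDl size_polyXn //.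
apply: leq_ltn_trans (size_polyD _ _) _; rewrite gtn_max; apply/andP; split.
  by apply: leq_ltn_trans (size_polyMleq _ _) _; rewrite size_polyXn size_polyC; case: (_ != 0).
apply: leq_ltn_trans (size_polyD _ _) _; rewrite gtn_max; apply/andP; split.
  by apply: leq_ltn_trans (size_polyMleq _ _) _; rewrite size_polyX size_polyC; case: (_ != 0).
by rewrite size_polyC; case: (_ != 0).
Qed.

Lemma integral_cubic (A K : comNzRingType) (g : {rmorphism A -> K}) u v w x :
  x ^+ 3 + g u * x ^+ 2 + g v * x + g w = 0 -> integralOver g x.
Proof.
move=> e; exists ('X^3 + u%:P * 'X^2 + v%:P * 'X + w%:P).
  rewrite monicE lead_coefE size_cubic !coefD coefXn !coefCM coefXn coefX coefC /=.
  by rewrite !mulr0 !addr0.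
by rewrite rootE horner_map_cubic e.
Qed.

Lemma Qp_denominator p (pr : prime p) (x : Qp pr) :
  exists k (z : padic_int pr), p%:R ^+ k * x = FracField.tofrac z.
Proof.
have [a [b [b0 ->]]] := fractionE x; have [k [u [uu ->]]] := padic_factor b0.
exists k, (a * u^-1); rewrite tofracM tofracXn padic_pE rmorph_nat.
have p0 : p%:R != 0 :> Qp pr.
  by rewrite -(rmorph_nat (@FracField.tofrac _)) tofrac_eq0 -padic_pE padic_p_neq0.
have u0 : FracField.tofrac u != 0.
  by rewrite tofrac_eq0; apply: contraTneq uu => ->; rewrite unitr0.
have -> : FracField.tofrac (a * u^-1) = FracField.tofrac a / FracField.tofrac u.
  by apply: (mulIf u0); rewrite divfK // -tofracM divrK.
by rewrite invfM mulrCA mulVKf // expf_neq0.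
Qed.

(** A cubic without roots is irreducible. An integral root would be divisible by p, hence the
    constant term by p^2; if the root is not integral, its inverse lies in p Z_p and dividing the
    equation by the cube of the root gives 1 = 0 modulo p. *)
Lemma eisenstein_irreducible p (pr : prime p) (e0 e1 e2 : padic_int pr) :
  padic_red e0 != 0 ->
  let h : {poly Qp pr} := 'X^3 + (FracField.tofrac (padic_p pr * e2))%:P * 'X^2
    + (FracField.tofrac (padic_p pr * e1))%:P * 'X + (FracField.tofrac (padic_p pr * e0))%:P in
  size h = 4%N /\ irreducible_poly h.
Proof.
move=> u0 h; set P := padic_p pr in h *.
have sh : size h = 4%N by exact: size_cubic.
split=> //; apply: cubic_irreducible; rewrite ?sh // => x; apply/negP => /rootP.
rewrite /h !(hornerD, hornerM, hornerXn, hornerX, hornerC).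
have [[z ->]|[z ez]] := Qp_dichotomy x.
  rewrite -!tofracM -!tofracD => /eqP; rewrite tofrac_eq0 => /eqP ez.
  have /eqP := congr1 (@padic_red p pr) ez.
  rewrite !(rmorphD, rmorphM, rmorphXn) rmorph0 /= padic_red_p !mul0r !addr0.
  rewrite !mulf_eq0 !orbb => /eqP/padic_red_eq0[y ey].
  have : P * (e0 + P * (P * y ^+ 3 + P * e2 * y ^+ 2 + e1 * y)) = 0.
    by rewrite -[RHS]ez ey -/P; ring.
  move=> /eqP; rewrite mulf_eq0 (negbTE (padic_p_neq0 pr)) /= => /eqP/(congr1 (@padic_red p pr)).
  rewrite rmorphD rmorphM rmorph0 /= padic_red_p mul0r addr0 => /eqP.
  by rewrite (negbTE u0).
set t := FracField.tofrac (P * z) in ez => e.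
have : FracField.tofrac (1 + P * e2 * (P * z) + P * e1 * (P * z) ^+ 2 + P * e0 * (P * z) ^+ 3) = 0.
  rewrite !(rmorphD, rmorph1, rmorphXn) /= !(tofracM (_ * _) (P * z)) !(tofracM (_ * _) (_ ^+ _)) !tofracXn -/t.
  have {1}-> : 1 = (x * t) ^+ 3 by rewrite ez expr1n.
  have -> : FracField.tofrac (P * e2) * t = FracField.tofrac (P * e2) * (x * t) ^+ 2 * t by rewrite ez expr1n mulr1.
  have -> : FracField.tofrac (P * e1) * t ^+ 2 = FracField.tofrac (P * e1) * (x * t) * t ^+ 2 by rewrite ez mulr1.
  by rewrite -[RHS](mul0r (t ^+ 3)) -e; ring.
move=> /eqP; rewrite tofrac_eq0 => /eqP/(congr1 (@padic_red p pr)).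
rewrite !(rmorphD, rmorphM, rmorphXn, rmorph1) rmorph0 /= padic_red_p !(mul0r, addr0) => /eqP.
by rewrite oner_eq0.
Qed.

Lemma DF_rmorphism (A K : comNzRingType) (i : {rmorphism A -> K}) (f : cubic_form A) (W T : K) :
  let: CubicForm a b c d := f in
  W * T = - (i a * i d) -> W ^+ 2 = - (i a * i c) - i b * W + i a * T ->
  T ^+ 2 = - (i b * i d) - i d * W + i c * T ->
  exists phi : {rmorphism DFring f -> K},
    forall x y z, phi (x, y, z) = i x + i y * W + i z * T.
Proof.
case: f => a b c d eWT eW eT.
set f := CubicForm a b c d.
pose g (r : DFring f) := let: (x, y, z) := r in i x + i y * W + i z * T.
have gB : zmod_morphism g.
  by move=> [[x y] z] [[x' y'] z'] /=; rewrite !rmorphB; ring.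
have gM : monoid_morphism g.
  split; first by rewrite /g /= rmorph1 !rmorph0 !mul0r !addr0.
  move=> r s; suff h : g (DFmul r s) = g r * g s by exact: h.
  case: r s => [[x y] z] [[x' y'] z'] /=.
  have -> : (i x + i y * W + i z * T) * (i x' + i y' * W + i z' * T) =
    i x * i x' + (i x * i y' + i y * i x') * W + (i x * i z' + i z * i x') * T +
    (i y * i y') * W ^+ 2 + (i y * i z' + i z * i y') * (W * T) + i z * i z' * T ^+ 2 by ring.
  by rewrite eWT eW eT; ring.
pose phi : {rmorphism DFring f -> K} := HB.pack g
  (GRing.isZmodMorphism.Build _ _ g gB) (GRing.isMonoidMorphism.Build _ _ g gM).
by exists phi.
Qed.

(** The residue map sending w and t to 0, possible because a c, a d and b d vanish modulo p. *)
Lemma residue_rmorphism p (pr : prime p) (a b c d : padic_int pr) :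
  padic_red a = 0 -> padic_red b = 0 ->
  exists rho : {rmorphism DFring (CubicForm a b c d) -> 'F_p},
    forall x y z, rho (x, y, z) = padic_red x.
Proof.
move=> a0 b0; set f := CubicForm a b c d.
pose g (r : DFring f) := let: (x, y, z) := r in padic_red x.
have gB : zmod_morphism g by move=> [[x y] z] [[x' y'] z'] /=; rewrite rmorphB.
have gM : monoid_morphism g.
  split; first by rewrite /g /= rmorph1.
  move=> r s; suff h : g (DFmul r s) = g r * g s by exact: h.
  case: r s => [[x y] z] [[x' y'] z'] /=.
  by rewrite !(rmorphB, rmorphM) /= a0 b0 !mul0r !subr0.
pose rho : {rmorphism DFring f -> 'F_p} := HB.pack g
  (GRing.isZmodMorphism.Build _ _ g gB) (GRing.isMonoidMorphism.Build _ _ g gM).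
by exists rho.
Qed.

Definition DFtau (A : comNzRingType) (f : cubic_form A) : DFring f := (0, 0, 1).

Lemma DFmulE (A : comNzRingType) (f : cubic_form A) (r s : DFring f) : r * s = DFmul r s.
Proof. by []. Qed.

(** t generates the kernel of the residue map. Multiplication by t sends (x', y', z') to (- a d y' -
    b d z', - d z', x' + c z'), so z' is read off first, then y' and x', dividing by the units d and
    a1. *)
Lemma DF_tau_dvd p (pr : prime p) (a1 b1 c1 d x y z : padic_int pr) :
  padic_red a1 != 0 -> padic_red d != 0 -> padic_red x = 0 ->
  let f := CubicForm (padic_p pr * a1) (padic_p pr * b1) (padic_p pr * c1) d in
  exists s : DFring f, (x, y, z) = DFtau f * s.
Proof.
move=> /padic_unit_red[u eu] /padic_unit_red[v ev] /padic_red_eq0[x1 ->] f.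
set P := padic_p pr in f *.
pose z' := - (y * v); pose y' := - (x1 + b1 * d * z') * (u * v); pose x' := z - P * c1 * z'.
exists (x', y', z'); rewrite DFmulE.
congr (_, _, _) => /=.
- have -> : y' = - (x1 + b1 * d * z') * (u * v) by [].
  have -> : P * x1 = P * (x1 + b1 * d * z') * ((u * a1) * (v * d)) - P * b1 * d * z' by rewrite eu ev; ring.
  by ring.
- by transitivity (y * (v * d)); [rewrite ev mulr1|rewrite /z'; ring].
- by rewrite /x'; ring.
Qed.

(** The second factor reduces to a1 d^2, so t^3 is p times a unit when a1 and d are units: t is a
    uniformizer with ramification index 3. *)
Lemma DF_tau_cube p (pr : prime p) (a1 b1 c1 d : padic_int pr) :
  let P := padic_p pr in
  let f := CubicForm (P * a1) (P * b1) (P * c1) d in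
  DFtau f ^+ 3 = DFscal f P *
    (a1 * d ^+ 2 - P * b1 * d * c1, - d * c1, - b1 * d + P * c1 ^+ 2).
Proof.
move=> P f; rewrite DFscalM exprS expr2 !DFmulE.
by rewrite /=; congr (_, _, _); ring.
Qed.

Lemma integersM p (pr : prime p) (K : fieldExtType (Qp pr)) (u v : K) :
  integers u -> integers v -> integers (u * v).
Proof.
pose i : {rmorphism padic_int pr -> K} := (in_alg K \o @FracField.tofrac _)%FUN.
have h := @integral_mul (padic_int pr) K i u v.
exact: h.
Qed.

Lemma integersD p (pr : prime p) (K : fieldExtType (Qp pr)) (u v : K) :
  integers u -> integers v -> integers (u + v).
Proof.
pose i : {rmorphism padic_int pr -> K} := (in_alg K \o @FracField.tofrac _)%FUN.
have h := @integral_add (padic_int pr) K i u v.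
exact: h.
Qed.

(* T = phi tau satisfies T ^ 3 = p * unit. An integral y with T y = phi r lies in the range
   of phi: if rho r <> 0, multiplying the monic equation of y by T ^ n and reducing would
   give rho r ^ n = 0. *)
Lemma eisenstein_integers p (pr : prime p) (K : fieldExtType (Qp pr)) (a1 b1 c1 d : padic_int pr) :
  let f := CubicForm (padic_p pr * a1) (padic_p pr * b1) (padic_p pr * c1) d in
  forall phi : {rmorphism DFring f -> K},
  padic_red a1 != 0 -> padic_red d != 0 -> \dim {:K} = 3%N -> injective phi ->
  (forall r, integers (phi r)) ->
  (forall x, phi (DFscal f x) = (FracField.tofrac x)%:A) ->
  (forall x : K, exists k r, p%:R ^+ k * x = phi r) ->
  totally_ramified K /\ range phi = @integers p pr K.
Proof.
move=> f phi ua ud dK inj int scal den.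
have [rho rhoE] := @residue_rmorphism p pr (padic_p pr * a1) (padic_p pr * b1) (padic_p pr * c1) d
  ltac:(by rewrite padic_redM padic_red_p mul0r) ltac:(by rewrite padic_redM padic_red_p mul0r).
rewrite -/f in rho rhoE.
pose tau := DFtau f; pose T := phi tau.
have rtau : rho tau = 0 by rewrite rhoE padic_red0.
have tauP r : rho r = 0 -> exists s, r = tau * s.
  by case: r => [[x y] z]; rewrite rhoE => x0; apply: DF_tau_dvd.
have T0 : T != 0.
  by rewrite /T raddf_eq0 //; apply/eqP => /(congr1 (fun u : DFring f => u.2))/eqP; rewrite oner_eq0.
pose eta : DFring f := (a1 * d ^+ 2 - padic_p pr * b1 * d * c1, - d * c1, - b1 * d + padic_p pr * c1 ^+ 2).
have reta : rho eta != 0.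
  rewrite rhoE rmorphB !rmorphM /= padic_red_p !mul0r subr0.
  by rewrite !mulf_neq0.
have phip : phi (DFscal f (padic_p pr)) = p%:R by rewrite padic_pE -DFnat rmorph_nat.
have T3 : T ^+ 3 = p%:R * phi eta.
  by rewrite -rmorphXn /tau DF_tau_cube rmorphM phip.
have TkD k x r : p%:R ^+ k * x = phi r -> exists s, T ^+ (3 * k) * x = phi s.
  move=> e; exists (eta ^+ k * r); rewrite exprM T3 exprMn mulrAC e rmorphM rmorphXn.
  by rewrite mulrC.
have step y : integers y -> (exists r, T * y = phi r) -> exists s, y = phi s.
  move=> [q mq rq] [r er]; have [r0|r0] := eqVneq (rho r) 0.
    have [s es] := tauP _ r0; exists s; apply: (mulfI T0).
    by rewrite er es rmorphM.
  have sq : size q = (size q).-1.+1 by rewrite prednK // size_poly_gt0 monic_neq0.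
  set n := (size q).-1 in sq.
  have /inj : phi (\sum_(j < n.+1) DFscal f q`_j * r ^+ j * tau ^+ (n - j)) = phi 0.
    rewrite rmorph0 -[RHS](mulr0 (T ^+ n)) -(rootP rq) horner_coef size_map_inj_poly; last first.
    - by rewrite tofrac0 scale0r.
    - by move=> x y' /=; rewrite -!scal => /inj [].
    rewrite sq mulr_sumr rmorph_sum; apply: eq_bigr => j _.
    rewrite !rmorphM !rmorphXn -er scal coef_map_id0; last by rewrite tofrac0 scale0r.
    have -> : T ^+ n = T ^+ j * T ^+ (n - j) by rewrite -exprD subnKC // leq_ord.
    rewrite exprMn -/T.
    by move: (_%:A) (T ^+ j) (T ^+ (n - j)) (y ^+ j) => u1 u2 u3 u4; ring.
  move=> /(congr1 rho); rewrite rmorph_sum rmorph0 big_ord_recr /= big1 ?add0r.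
    rewrite subnn expr0 mulr1 rmorphM rmorphXn rhoE.
    have -> : q`_n = 1 by move: mq; rewrite monicE => /eqP.
    by rewrite rmorph1 mul1r => /eqP; rewrite expf_eq0 (negbTE r0) andbF.
  by move=> j _; rewrite rmorphM [rho (tau ^+ _)]rmorphXn rtau expr0n subn_eq0 leqNgt ltn_ord mulr0.
have steps m y : integers y -> (exists r, T ^+ m * y = phi r) -> exists s, y = phi s.
  elim: m y => [|m IH] y iy [r er]; first by exists r; rewrite -er mul1r.
  apply: step => //; apply: (IH (T * y)); first exact: integersM (int _) iy.
  by exists r; rewrite mulrA -exprSr.
have rng : range phi = @integers p pr K.
  apply/seteqP; split=> x; first by move=> [r _ <-]; exact: int.
  move=> ix; have [k [r er]] := den x.
  have [s es] := steps _ _ ix (TkD _ _ _ er).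
  by exists s.
have cl x : integers x -> exists r, x = phi r.
  by rewrite -rng => -[r _ <-]; exists r.
have unitr r : rho r != 0 -> exists s, (phi r)^-1 = phi s.
  move=> r0; have pr0 : phi r != 0.
    by rewrite raddf_eq0 //; apply: contraNneq r0 => ->; rewrite rmorph0.
  have [k [u eu]] := den (phi r)^-1; have [v ev] := TkD _ _ _ eu.
  (* Some T^m / phi(r) lies in the range of phi. The factors T are cancelled one at a time: if r v =
     tau^(m + 1) and rho r is nonzero, then rho v = 0 and tau divides v. *)
  elim: (3 * k)%N v ev => [|m IH] v ev; first by exists v; rewrite -ev mul1r.
  have : T ^+ m.+1 = phi (r * v) by rewrite rmorphM -ev mulrCA mulfV // mulr1.
  rewrite -rmorphXn => /inj/(congr1 rho); rewrite rmorphXn rtau expr0n rmorphM /= => /esym/eqP.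
  rewrite mulf_eq0 (negbTE r0) /= => /eqP/tauP[s es].
  apply: (IH s); apply: (mulfI T0).
  by rewrite mulrA -exprS ev es rmorphM.
split=> //; exists T; split; first exact: int.
  split=> // x /cl[r ->]; split=> [nu|/cl[s es] [nz _ /cl[t et]]].
    have [r0|r0] := eqVneq (rho r) 0.
      have [s ->] := tauP _ r0; rewrite rmorphM mulrC mulKf //; exact: int.
    case: nu; have [s es] := unitr _ r0; split; last by rewrite es; apply: int.
    - by rewrite raddf_eq0 //; apply: contraNneq r0 => ->; rewrite rmorph0.
    - exact: int.
  have er : r = tau * s by apply: inj; rewrite rmorphM -es mulrC divfK.
  have /inj/(congr1 rho) : phi (r * t) = phi 1.
    by rewrite rmorphM -et rmorph1 mulfV.
  rewrite er !rmorphM rtau rmorph1 !mul0r => /esym/eqP.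
  by rewrite oner_eq0.
have e0 : phi eta != 0.
  by rewrite raddf_eq0 //; apply: contraNneq reta => ->; rewrite rmorph0.
have p0 : p%:R != 0 :> K.
  by rewrite -phip raddf_eq0 //; apply/eqP => /(congr1 (fun u : DFring f => u.1.1))/eqP; rewrite (negbTE (padic_p_neq0 pr)).
have -> : p%:R / T ^+ \dim {:K} = (phi eta)^-1 by rewrite dK T3 invfM mulrA mulfV // mul1r.
have [s es] := unitr _ reta.
by split; rewrite ?invr_eq0 ?invrK // es; apply: int.
Qed.

(** The cubic equation is the characteristic one of t in the Delone-Faddeev ring. Solving the
    relation for t^2 gives w, and the other relations follow. *)
Lemma DF_relations (K : fieldType) (a b c d T : K) : d != 0 ->
  T ^+ 3 + - c * T ^+ 2 + b * d * T + - (a * d ^+ 2) = 0 ->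
  exists W, [/\ W * T = - (a * d), W ^+ 2 = - (a * c) - b * W + a * T,
    T ^+ 2 = - (b * d) - d * W + c * T, W = - (T ^+ 2 - c * T + b * d) / d &
    W ^+ 3 + b * W ^+ 2 + a * c * W + a ^+ 2 * d = 0].
Proof.
move=> d0 eT; pose W := - (T ^+ 2 - c * T + b * d) / d.
have eWT : W * T = - (a * d).
  apply: (mulfI d0); apply/eqP; rewrite -subr_eq0 -oppr_eq0; apply/eqP.
  by rewrite -[RHS]eT /W; field.
have dW : d * W = - (T ^+ 2 - c * T + b * d) by rewrite /W; field.
have eW2 : W ^+ 2 = - (a * c) - b * W + a * T.
  apply: (mulfI d0).
  have -> : d * W ^+ 2 = - ((W * T) * T - c * (W * T) + b * d * W).
    by rewrite expr2 mulrA dW; ring.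
  by rewrite eWT; ring.
exists W; split=> //; first by rewrite dW; ring.
have -> : W ^+ 3 = - (a * c) * W - b * W ^+ 2 + a * (W * T).
  by rewrite exprS {1}eW2; ring.
by rewrite eWT; ring.
Qed.

(** K is generated by a root T of the characteristic polynomial T^3 - c T^2 + b d T - a d^2 of t,
    which is Eisenstein because p divides a, b, c, while a1 and d are units. *)
Lemma eisenstein_extension p (pr : prime p) (a1 b1 c1 d : padic_int pr) :
  let f := CubicForm (padic_p pr * a1) (padic_p pr * b1) (padic_p pr * c1) d in
  padic_red a1 != 0 -> padic_red d != 0 ->
  exists K : fieldExtType (Qp pr),
    [/\ \dim {:K} = 3%N, totally_ramified K &
        exists phi : {rmorphism DFring f -> K},
          injective phi /\ range phi = @integers p pr K].
Proof.
move=> f ua ud; set P := padic_p pr in f *.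
have [sh ih] := @eisenstein_irreducible p pr (- (a1 * d ^+ 2)) (b1 * d) (- c1)
  ltac:(by rewrite rmorphN rmorphM rmorphXn oppr_eq0 mulf_neq0 ?expf_neq0).
set h := (X in size X = _) in sh ih.
have [K dK [T rT full]] := irredp_FAdjoin ih.
rewrite sh /= in dK.
pose i : {rmorphism padic_int pr -> K} := (in_alg K \o @FracField.tofrac _)%FUN.
have i_inj : injective i.
  by move=> x y /(fmorph_inj (in_alg K))/eqP; rewrite tofrac_eq => /eqP.
have d0 : i d != 0.
  by rewrite raddf_eq0 //; apply: contraNneq ud => ->; rewrite padic_red0.
have e1 : i (P * - c1) = - i (P * c1) by rewrite mulrN rmorphN.
have e2 : i (P * (b1 * d)) = i (P * b1) * i d by rewrite mulrA rmorphM.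
have e3 : i (P * - (a1 * d ^+ 2)) = - (i (P * a1) * i d ^+ 2).
  by rewrite mulrN mulrA rmorphN rmorphM rmorphXn.
have eT : T ^+ 3 + i (P * - c1) * T ^+ 2 + i (P * (b1 * d)) * T + i (P * - (a1 * d ^+ 2)) = 0.
  by have := rootP rT; rewrite /h horner_map_cubic.
have [W [eWT eW2 eT2 eW eW3]] : exists W, [/\ W * T = - (i (P * a1) * i d),
    W ^+ 2 = - (i (P * a1) * i (P * c1)) - i (P * b1) * W + i (P * a1) * T,
    T ^+ 2 = - (i (P * b1) * i d) - i d * W + i (P * c1) * T,
    W = - (T ^+ 2 - i (P * c1) * T + i (P * b1) * i d) / i d &
    W ^+ 3 + i (P * b1) * W ^+ 2 + i (P * a1) * i (P * c1) * W + i (P * a1) ^+ 2 * i d = 0].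
  by apply: DF_relations => //; rewrite -e1 -e2 -e3.
have [phi phiE] := @DF_rmorphism _ _ i f W T eWT eW2 eT2.
have inj : injective phi.
  suff inj0 x y z : phi (x, y, z) = 0 -> ((x, y, z) : DFring f) = 0.
    move=> r s e; apply/eqP; rewrite -subr_eq0.
    have : phi (r - s) = 0 by rewrite rmorphB e subrr.
    by case: (r - s) => [[x y] z] /inj0 ->.
  rewrite phiE => e.
  (* The coordinates of phi(x, y, z) in the basis 1, T, T^2, with W replaced by its expression in
     T. *)
  have e' : (FracField.tofrac x - FracField.tofrac y * FracField.tofrac (P * b1))%:A +
     (FracField.tofrac z + FracField.tofrac y * FracField.tofrac (P * c1) / FracField.tofrac d)%:A * T +
     (- FracField.tofrac y / FracField.tofrac d)%:A * T ^+ 2 = 0 :> K.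
    have -> : (FracField.tofrac x - FracField.tofrac y * FracField.tofrac (P * b1))%:A =
        i x - i y * i (P * b1) :> K.
      by rewrite -[LHS]/(in_alg K _) rmorphB rmorphM.
    have -> : (FracField.tofrac z + FracField.tofrac y * FracField.tofrac (P * c1) / FracField.tofrac d)%:A =
        i z + i y * i (P * c1) / i d :> K.
      by rewrite -[LHS]/(in_alg K _) rmorphD !rmorphM fmorphV.
    have -> : (- FracField.tofrac y / FracField.tofrac d)%:A = - i y / i d :> K.
      by rewrite -[LHS]/(in_alg K _) rmorphM rmorphN fmorphV.
    rewrite -[RHS]e eW; move: (i x) (i y) (i z) (i (P * b1)) (i (P * c1)) (i d) d0 => x' y' z' b' c' d' d0'.
    by field.
  have [h1 h2 h3] := adjoin_root_free ih sh rT e'.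
  have td : FracField.tofrac d != 0.
    by rewrite tofrac_eq0; apply: contraNneq ud => ->; rewrite padic_red0.
  have y0 : y = 0.
    move: h3 => /eqP; rewrite mulf_eq0 invr_eq0 (negbTE td) orbF oppr_eq0 tofrac_eq0.
    by move/eqP.
  move: h1 h2; rewrite y0 tofrac0 !mul0r subr0 addr0 => /eqP; rewrite tofrac_eq0 => /eqP ->.
  by move=> /eqP; rewrite tofrac_eq0 => /eqP ->.
have iT : integers T by exact: (@integral_cubic _ _ i _ _ _ _ eT).
have iW : integers W.
  apply: (@integral_cubic _ _ i (P * b1) (P * a1 * (P * c1)) ((P * a1) ^+ 2 * d)).
  by rewrite (rmorphM i (P * a1)) (rmorphM i (_ ^+ 2)) (rmorphXn i).
have int r : integers (phi r).
  case: r => [[x y] z]; rewrite phiE.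
  have ii u : integers (i u) by exact: (integral_id i).
  by apply: integersD; [apply: integersD|]; try apply: integersM.
have scal x : phi (DFscal f x) = (FracField.tofrac x)%:A.
  by rewrite phiE !rmorph0 !mul0r !addr0.
have den (v : K) : exists k r, p%:R ^+ k * v = phi r.
  have [x [y [z ->]]] := adjoin_root_span v sh rT full.
  have [kx [x' ex]] := Qp_denominator x; have [ky [y' ey]] := Qp_denominator y.
  have [kz [z' ez]] := Qp_denominator z.
  have eK k u (u' : padic_int pr) : p%:R ^+ k * u = FracField.tofrac u' -> p%:R ^+ k * u%:A = i u' :> K.
    move=> e; transitivity (in_alg K (p%:R ^+ k * u)); last by rewrite e.
    by rewrite rmorphM rmorphXn rmorph_nat.
  exists (kx + ky + kz)%N.
  exists (p%:R ^+ (ky + kz) * DFscal f x' + p%:R ^+ (kx + kz) * DFscal f y' * DFtau f +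
     p%:R ^+ (kx + ky) * DFscal f z' * DFtau f ^+ 2).
  have phit : phi (DFtau f) = T by rewrite phiE !rmorph0 mul0r !add0r rmorph1 mul1r.
  have phis k u : phi (p%:R ^+ k * DFscal f u) = p%:R ^+ k * i u.
    by rewrite rmorphM rmorphXn rmorph_nat scal.
  rewrite 2!rmorphD (rmorphM phi (p%:R ^+ (kx + kz) * DFscal f y')).
  rewrite (rmorphM phi (p%:R ^+ (kx + ky) * DFscal f z')) (rmorphXn phi) phit !phis.
  rewrite -(eK _ _ _ ex) -(eK _ _ _ ey) -(eK _ _ _ ez) !exprD.
  by move: x%:A y%:A z%:A (p%:R ^+ kx) (p%:R ^+ ky) (p%:R ^+ kz) => *; ring.
have [tr rng] := eisenstein_integers ua ud dK inj int scal den.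
by exists K; split=> //; exists phi.
Qed.

Lemma padic_of_intN p (pr : prime p) (m : int) : padic_of_int pr (- m) = - padic_of_int pr m.
Proof. by apply: padic_ext => k /=; rewrite modzNm. Qed.

Lemma padic_of_intX p (pr : prime p) (m : int) k :
  padic_of_int pr (m ^+ k) = padic_of_int pr m ^+ k.
Proof. by elim: k => [//|k IH]; rewrite !exprS padic_of_intM IH. Qed.

Lemma padic_of_int_nat p (pr : prime p) n : padic_of_int pr n%:R = n%:R.
Proof. by elim: n => [|n IH] //; rewrite !mulrS padic_of_intD IH. Qed.

Lemma map_inv_shift_padic p (pr : prime p) (j : int) f :
  map_form (padic_of_int pr) (inv_shift j f) =
  inv_shift (padic_of_int pr j) (map_form (padic_of_int pr) f).
Proof.
case: f => a b c d; rewrite /inv_shift /map_form /=.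
by congr CubicForm; rewrite ?padic_of_intN ?padic_of_intD
  ?(padic_of_intM _ _ (j ^+ _)) ?(padic_of_intM _ _ j) ?padic_of_intX ?padic_of_intM ?padic_of_int_nat.
Qed.

Lemma totally_ramified_inv_shift p (pr : prime p) (j : int) f :
  totally_ramified_at pr (inv_shift j f) -> totally_ramified_at pr f.
Proof.
move=> [K [dK tr ex]]; exists K; split=> //.
move: ex; rewrite map_inv_shift_padic; set F := map_form _ f.
set J := padic_of_int pr j; move=> [phi [inj rng]].
exists (phi \o @DFpush _ J F)%FUN; split.
  by apply: inj_comp inj _; exact: can_inj (@DFpushK _ J F).
rewrite -rng; apply/seteqP; split=> x [r _ <-]; first by exists (DFpush J r).
by exists (DFpull r); rewrite //= DFpullK.
Qed.

Lemma totally_ramified_eisenstein p (pr : prime p) f : isE p f -> ~~ isB p f ->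
  ~~ (p %| cd f)%Z -> totally_ramified_at pr f.
Proof.
case: f => a b c d /and3P[/= /dvdzP[a1 ->] /dvdzP[b1 ->] /dvdzP[c1 ->]] nB pd.
rewrite /totally_ramified_at /map_form /=.
rewrite ![_ * p%:Z]mulrC !padic_of_intM -/(padic_p pr).
apply: eisenstein_extension.
  rewrite padic_red_int -(dvdz_pcharf (pchar_Fp pr)); apply: contra nB => pa.
  by rewrite /isB /= PoszX2 [a1 * _]mulrC dvdz_mul // dvdz_mull.
by rewrite padic_red_int -(dvdz_pcharf (pchar_Fp pr)).
Qed.

Lemma nonV_bad_at p (pr : prime p) f : ~ V_ pr f <-> bad_at p f.
Proof.
have lift g : g \in unitmx -> isB p (form_act g f) -> bad_at p f.
  move=> ug Bg; have ndet : ~~ (p %| \det g)%Z.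
    have p1 : p != 1%N by rewrite neq_ltn prime_gt1 // orbT.
    by move: ug; rewrite unitmxE => /orP[]/eqP ->; rewrite dvdzE /= dvdn1.
  have [r hr] := lower_stable_lift pr (isB_stable pr) ndet Bg.
  by apply/existsP; exists r; rewrite hr.
split=> [nV|/existsP[r hr] [[npd nex] ntr]].
  have [U|nU] := pselect (U_ p f).
    have [r hr] : exists r : option 'I_p, isE p (form_act (proj_mx r) f).
      by apply: totally_ramified_isE; apply: contrapT => ntr; apply: nV; split; [exact: U|exact: ntr].
    by apply/existsP; exists r; rewrite hr orbT.
  have [[h1 h2 h3 h4]|npd] := pselect [/\ (p %| ca f)%Z, (p %| cb f)%Z, (p %| cc f)%Z & (p %| cd f)%Z].
    (* A form divisible by p satisfies [isE] at every point. *)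
    by apply/existsP; exists None; rewrite /= form_act1 /isE h1 h2 h3 orbT.
  have [[g ug [h1 h2]]|nex] := pselect (exists2 g : 'M[int]_2, g \in unitmx &
      ((p ^ 2)%N %| ca (form_act g f))%Z /\ (p %| cb (form_act g f))%Z).
    by apply: (lift g) => //; apply/andP.
  by case: nU.
have ur : proj_mx r \in unitmx by rewrite unitmxE det_proj_mx unitr1.
have nB : ~~ isB p (form_act (proj_mx r) f).
  by apply/negP => /andP[h1 h2]; apply: nex; exists (proj_mx r).
move: hr; rewrite (negbTE nB) /= => hE; apply: ntr.
have nd : ~~ (p %| cd (form_act (proj_mx r) f))%Z.
  apply/negP => hd; have := hE => /and3P[ha hb hc].
  have : pdiv_form p f.
    rewrite -(@pdiv_form_actK p (proj_mx r)) ?det_proj_mx ?coprimezE ?coprimen1 //.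
    by rewrite /pdiv_form ha hb hc hd.
  by move=> /and4P[? ? ? ?]; apply: npd.
have := totally_ramified_eisenstein pr hE nB nd.
case: r {ur nB hE nd} => [j|] /=; last by rewrite form_act1.
by rewrite form_act_inv_shift; exact: totally_ramified_inv_shift.
Qed.

(** * The class bounds *)

Lemma reduced_count (R : realType) (lam : R) ms ns (s : seq (cubic_form int)) : 0 < lam ->
  good_primes (ms ++ ns) -> inequiv s ->
  {in s, forall x, [/\ form_disc x != 0, `|(form_disc x)%:~R| <= lam ^+ 4,
     hess_dvd (\prod_(p <- ms) p)%N x & ((\prod_(p <- ns) p)%N %| form_disc x)%Z]} ->
  (size s)%:R <= 4 ^+ size (ms ++ ns) * (5 * 10 ^+ 6) *
    main_bound lam (\prod_(p <- ms) p)%N%:R (\prod_(p <- ns) p)%N%:R.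
Proof.
move=> l0 gp [us is_] hs.
have ex x : exists y, x \in s -> [/\ eqv x y, exists k ka, in_dbox lam k ka y &
    ca y = 0 -> `|cc y| <= `|cb y|].
  have [xs|_] := boolP (x \in s); last by exists x.
  have [D0 Dl _ _] := hs _ xs; have [g dg [k [ka [h1 h2]]]] := exists_dbox l0 D0 Dl.
  by exists (form_act g x) => _; split=> //; [exists g|exists k, ka].
have [red hred] := choice ex.
set S := map red s.
have uS : uniq S.
  rewrite map_inj_in_uniq // => x y xs ys e; apply: is_ => //.
  have [ex1 _ _] := hred _ xs; have [ey1 _ _] := hred _ ys.
  by apply: eqv_trans ex1 _; rewrite e; apply: eqv_sym.
have hS : {in S, forall y, [/\ exists k ka, in_dbox lam k ka y, ca y = 0 -> `|cc y| <= `|cb y|,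
    form_disc y != 0 /\ `|(form_disc y)%:~R| <= lam ^+ 4 &
    hess_dvd (\prod_(p <- ms) p)%N y /\ ((\prod_(p <- ns) p)%N %| form_disc y)%Z]}.
  move=> y /mapP[x xs ->]; have [e1 e2 e3] := hred _ xs; have [f1 f2 f3 f4] := hs _ xs.
  by split=> //; rewrite (eqv_disc e1) //; split=> //; exact: hess_dvd_eqv e1 f3.
set P := [pred y : cubic_form int | ca y == 0].
have c1 : (size (seq.filter P S))%:R <= 4 ^+ size (ms ++ ns) * 10 ^+ 3 *
    main_bound lam (\prod_(p <- ms) p)%N%:R (\prod_(p <- ns) p)%N%:R.
  apply: count_az => //; first exact: filter_uniq.
  move=> y; rewrite mem_filter => /andP[/eqP a0 yS]; have [[k [ka [_ hb _ _ _]]] h2 h3 h4] := hS _ yS.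
  split=> //; last exact: h2.
  apply: le_trans hb _; rewrite ler_pdivrMr ?exprn_gt0 // ler_peMr ?mulr_ge0 ?(ltW l0) //.
  by rewrite exprn_ege1 // ler1n.
have c2 : (size (seq.filter (predC P) S))%:R <= 4 ^+ size (ms ++ ns) * (4 * 10 ^+ 6) *
    main_bound lam (\prod_(p <- ms) p)%N%:R (\prod_(p <- ns) p)%N%:R.
  apply: count_anz => //; first exact: filter_uniq.
  by move=> y; rewrite mem_filter => /andP[a0 yS]; have [h1 h2 h3 [h4 h5]] := hS _ yS; split.
have sz : size s = (size (seq.filter P S) + size (seq.filter (predC P) S))%N.
  by rewrite !size_filter count_predC size_map.
rewrite sz natrD; apply: le_trans (lerD c1 c2) _.
have mb0 : 0 <= main_bound lam (\prod_(p <- ms) p)%N%:R (\prod_(p <- ns) p)%N%:R.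
  by rewrite /main_bound !addr_ge0 ?divr_ge0 ?mulr_ge0 ?exprn_ge0 // ltW.
have w0 : 0 <= 4 ^+ size (ms ++ ns) :> R by rewrite exprn_ge0.
rewrite -mulrDl -mulrDr; apply: ler_wpM2r => //; apply: ler_wpM2l => //.
by rewrite (exprD _ 3 3); have : 1 <= 10 ^+ 3 :> R by [rewrite exprn_ege1 // ler1n]; nra.
Qed.

(** The condition m <= lam^2 forces lam >= 1, and then each of the three terms is at most lam^4 /
    m. *)
Lemma main_bound_le1 (R : realType) (lam m n : R) : 1 <= m -> 1 <= n -> m <= lam ^+ 2 -> 0 < lam ->
  main_bound lam m n <= 3 * bound1 1 m n (lam ^+ 4).
Proof.
move=> m1 n1 ml l0; rewrite /main_bound /bound1 expr1n mul1r.
have m0 : 0 < m by lra.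
have n0 : 0 < n by lra.
have l1 : 1 <= lam.
  rewrite leNgt; apply/negP => l1; have : lam ^+ 2 < 1 by rewrite expr2; nra.
  lra.
have lk k : 0 <= lam ^+ k by rewrite exprn_ge0 // ltW.
have h1 : lam ^+ 4 / (m ^+ 2 * n) <= lam ^+ 4 / m.
  apply: ler_wpM2l => //; rewrite lef_pV2 ?posrE ?mulr_gt0 ?exprn_gt0 //.
  nra.
have h2 : lam ^+ 3 / m <= lam ^+ 4 / m.
  by apply: ler_wpM2r; rewrite ?invr_ge0 ?(ltW m0) // [lam ^+ 4]exprS ler_peMl.
have h3 : lam ^+ 2 <= lam ^+ 4 / m.
  by rewrite ler_pdivlMr // (exprD _ 2 2) ler_wpM2l.
lra.
Qed.

(** The term m^2 n^3 is such that its product with lam^4 / (m^2 n) is (lam^2 n)^2. So lam^2 n is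
    dominated by the sum, and with it lam^2, as well as lam^3 / m if lam <= m n; if lam > m n, the
    first term alone dominates lam^3 / m. *)
Lemma main_bound_le2 (R : realType) (lam m n : R) : 1 <= m -> 1 <= n -> 0 < lam ->
  main_bound lam m n <= 3 * bound2 1 m n (lam ^+ 4).
Proof.
move=> m1 n1 l0; rewrite /main_bound /bound2 expr1n mul1r divr1.
have m0 : 0 < m by lra.
have n0 : 0 < n by lra.
set A := lam ^+ 4 / (m ^+ 2 * n); set B := m ^+ 2 * n ^+ 3.
have A0 : 0 <= A by rewrite divr_ge0 ?mulr_ge0 ?exprn_ge0 ?ltW.
have B0 : 0 <= B by rewrite mulr_ge0 ?exprn_ge0 ?ltW.
(* AM-GM *)
have h : lam ^+ 2 * n <= A + B.
  rewrite -(@ler_pM2r _ (m ^+ 2 * n)) ?mulr_gt0 ?exprn_gt0 //.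
  have -> : (A + B) * (m ^+ 2 * n) = lam ^+ 4 + (m * n) ^+ 4 by rewrite /A /B; field; rewrite !gt_eqF.
  have -> : lam ^+ 2 * n * (m ^+ 2 * n) = lam ^+ 2 * (m * n) ^+ 2 by ring.
  have : 0 <= (lam ^+ 2 - (m * n) ^+ 2) ^+ 2 by exact: sqr_ge0.
  have := mulr_ge0 (sqr_ge0 lam) (sqr_ge0 (m * n)).
  have -> : lam ^+ 4 = (lam ^+ 2) ^+ 2 by ring.
  have -> : (m * n) ^+ 4 = ((m * n) ^+ 2) ^+ 2 by ring.
  by move: (lam ^+ 2) ((m * n) ^+ 2) => x y; nra.
have h2 : lam ^+ 2 <= A + B by apply: le_trans h; rewrite ler_peMr ?sqr_ge0.
have h3 : lam ^+ 3 / m <= A + B.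
  have [lm|ml] := leP lam (m * n).
    apply: le_trans h; rewrite ler_pdivrMr // [lam ^+ 3]exprSr.
    have -> : lam ^+ 2 * n * m = lam ^+ 2 * (m * n) by ring.
    by rewrite ler_wpM2l ?sqr_ge0.
  apply: ler_wpDr => //; rewrite ler_pdivlMr ?mulr_gt0 ?exprn_gt0 //.
  have -> : lam ^+ 3 / m * (m ^+ 2 * n) = lam ^+ 3 * (m * n) by field; rewrite gt_eqF.
  by rewrite [lam ^+ 4]exprSr ler_wpM2l ?exprn_ge0 ?ltW.
lra.
Qed.

(** By [hess_disc], m^2 divides 3 Disc, and m is prime to 3. This supplies the condition m <= lam^2
    of [main_bound_le1]. *)
Lemma hess_dvd_disc ms ns x : good_primes (ms ++ ns) -> form_disc x != 0 ->
  hess_dvd (\prod_(p <- ms) p)%N x -> ((\prod_(p <- ms) p)%N ^ 2 <= absz (form_disc x))%N.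
Proof.
move=> [ul pl] D0 /and3P[/dvdzP[a ea] /dvdzP[b eb] /dvdzP[c ec]].
set m := (\prod_(p <- ms) p)%N in ea eb ec *.
have c3 : coprimez (m ^ 2)%N 3.
  rewrite coprimezE /= coprimeXl //; have := @coprime_prods ms [:: 3%N]; rewrite big_seq1; apply=> p r.
  move=> pms; rewrite inE => /eqP ->; have [pp p5] := pl p ltac:(by rewrite mem_cat pms).
  by split=> //; apply: contraTneq p5 => ->.
have : ((m ^ 2)%N %| (3%:R * form_disc x)%R)%Z.
  apply/dvdzP; exists (4%:R * a * c - b ^+ 2); rewrite PoszX2.
  by rewrite -hess_disc ea eb ec; ring.
rewrite Gauss_dvdzr // dvdzE /= => /dvdn_leq; apply.
by rewrite absz_gt0.
Qed.

Lemma base_bound (R : realType) (bf : R -> R -> R -> R -> R) :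
  (forall Q m n Y : R, 1 <= Q -> 1 <= m -> 1 <= n -> 0 <= Y -> 0 <= bf Q m n Y) ->
  (forall lam m n : R, 1 <= m -> 1 <= n -> m <= lam ^+ 2 -> 0 < lam ->
     main_bound lam m n <= 3 * bf 1 m n (lam ^+ 4)) ->
  forall ms ns Y, good_primes (ms ++ ns) -> 0 <= Y ->
   class_bound (tweight R [::] (\prod_(p <- ms) p) (\prod_(p <- ns) p)) Y
     (15 * 10 ^+ 6 * 4 ^+ size (ms ++ ns) *
      bf 1 (\prod_(p <- ms) p)%N%:R (\prod_(p <- ns) p)%N%:R Y).
Proof.
move=> bf0 hbf ms ns Y gp Y0 s [us is_] hs.
have apr : all prime ms /\ all prime ns.
  have [_ pl] := gp; split; apply/allP => p ps.
    by have [] := pl p; rewrite // mem_cat ps.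
  by have [] := pl p; rewrite // mem_cat ps orbT.
set m := (\prod_(p <- ms) p)%N; set n := (\prod_(p <- ns) p)%N.
have m1 : 1 <= m%:R :> R by rewrite ler1n; apply: prod_primes_gt0; exact: apr.1.
have n1 : 1 <= n%:R :> R by rewrite ler1n; apply: prod_primes_gt0; exact: apr.2.
pose P x := hess_dvd m x && (n %| form_disc x)%Z.
have -> : \sum_(x <- s) tweight R [::] m n x = (size (seq.filter P s))%:R.
  rewrite size_filter -sum1_count natr_sum [RHS]big_mkcond; apply: eq_bigr => x _.
  by rewrite /tweight big_nil /P; case: (hess_dvd _ _); case: (_ \in _); rewrite ?mulr0 ?mulr1 ?mul1r.
set S := seq.filter P s.
have hS x : x \in S -> [/\ x \in s, hess_dvd m x & (n %| form_disc x)%Z].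
  by rewrite mem_filter => /andP[/andP[]].
have iS : inequiv S.
  split; first exact: filter_uniq.
  by move=> x y /hS[xs _ _] /hS[ys _ _]; apply: is_.
have C0 : 0 <= 15 * 10 ^+ 6 * 4 ^+ size (ms ++ ns) * bf 1 m%:R n%:R Y.
  by rewrite !mulr_ge0 ?exprn_ge0 // bf0.
(* The inequality m^2 <= Y is obtained from an actual form in the list; an empty list is trivial. *)
have [S0|[x xS]] : S = [::] \/ exists x, x \in S.
  by case: (S) => [|x t]; [left|right; exists x; rewrite mem_head].
  by rewrite S0.
have [xs hx _] := hS _ xS; have [Dx0 DxY] := hs _ xs.
pose lam := Num.sqrt (Num.sqrt Y).
have l2 : lam ^+ 2 = Num.sqrt Y by rewrite sqr_sqrtr ?sqrtr_ge0.
have l4 : lam ^+ 4 = Y by rewrite (exprM _ 2 2) l2 sqr_sqrtr.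
have mY : m%:R ^+ 2 <= Y.
  apply: le_trans DxY; rewrite -intr_norm -natrX -[(m ^ 2)%:R]/((m ^ 2)%:Z%:~R) ler_int -abszE lez_nat.
  exact: hess_dvd_disc gp Dx0 hx.
have Y1 : 0 < Y by apply: lt_le_trans mY; rewrite exprn_gt0 //; lra.
have l0 : 0 < lam by rewrite !sqrtr_gt0.
have ml : m%:R <= lam ^+ 2.
  by rewrite l2 -(@ler_pXn2r _ 2) ?nnegrE ?sqrtr_ge0 // sqr_sqrtr.
have := @reduced_count R lam ms ns S l0 gp iS.
rewrite l4 => h; apply: le_trans (h _) _.
  by move=> y /hS[ys h1 h2]; have [D0 DY] := hs _ ys; split.
have := hbf lam _ _ m1 n1 ml l0; rewrite l4 => hb.
have -> : 15 * 10 ^+ 6 * 4 ^+ size (ms ++ ns) * bf 1 m%:R n%:R Y =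
  4 ^+ size (ms ++ ns) * (5 * 10 ^+ 6) * (3 * bf 1 m%:R n%:R Y) by ring.
by apply: ler_wpM2l => //; rewrite mulr_ge0 ?exprn_ge0 // mulr_ge0 ?exprn_ge0.
Qed.

Lemma weight_class_bound (R : realType) (bf : R -> R -> R -> R -> R) :
  stable_bound bf ->
  (forall lam m n : R, 1 <= m -> 1 <= n -> m <= lam ^+ 2 -> 0 < lam ->
     main_bound lam m n <= 3 * bf 1 m n (lam ^+ 4)) ->
  forall L Y, uniq L -> all prime L -> 0 <= Y ->
   class_bound (fun x => \prod_(p <- L) weight R p x) Y
     (15 * 10 ^+ 6 * (3 ^+ 7) ^+ size L * bf (\prod_(p <- L) p)%N%:R 1 1 Y).
Proof.
move=> st hb L Y uL pL Y0.
have [bf0 _] := st.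
have C0 : 0 <= 15 * 10 ^+ 6 :> R by rewrite mulr_ge0 ?exprn_ge0.
have := @tweight_bound R bf _ C0 st (base_bound bf0 hb) L [::] [::] Y.
rewrite /= !cats0 !big_nil expr0 mulr1 => /(_ uL pL) h s is_ hs.
apply: le_trans (h _ Y0 s is_ hs); last by split.
by apply: ler_sum => x _; rewrite /tweight /hess_dvd !dvd1z !mulr1.
Qed.

(** * Dual coefficients *)

Lemma squarefree_prod_primes q : (0 < q)%N -> (forall p, prime p -> ~ (p ^ 2 %| q)%N) ->
  (\prod_(p <- primes q) p)%N = q.
Proof.
move=> q0 sq; rewrite [RHS]prod_prime_decomp // prime_decompE big_map big_seq [RHS]big_seq.
apply: eq_bigr => p; rewrite mem_primes => /and3P[pp _ pq] /=.
have l1 : (0 < logn p q)%N by rewrite logn_gt0 mem_primes pp q0.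
have l2 : (logn p q < 2)%N.
  by rewrite ltnNge; apply/negP => h; apply: (sq p pp); rewrite pfactor_dvdn.
by have -> : logn p q = 1%N by lia.
Qed.

Lemma hatPhi_FT (R : realType) q x : (0 < q)%N -> hatV x ->
  hatPhi R q x = FT (q ^ 2) (fun y => (bad_all (primes q) y)%:R) x.
Proof.
move=> q0 hx; rewrite /hatPhi /FT fsumE natrX -exprM; congr (_ * _).
do 4 (apply: eq_bigr => ? _); rewrite /Phi /chi (pairing_upz _ _ hx) natrX; congr (_%:R * _).
congr nat_of_bool; apply/asboolP/allP => [h p|h p pr pq].
  rewrite mem_primes => /and3P[pr _ pq].
  by apply/(nonV_bad_at pr); apply: h.
by apply/nonV_bad_at; apply: h; rewrite mem_primes pr q0.
Qed.

Lemma hatPhi_weight (R : realType) q x : (0 < q)%N -> (forall p, prime p -> ~ (p ^ 2 %| q)%N) ->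
  hatV x -> Normc.normc (hatPhi R q x) <= \prod_(p <- primes q) weight R p x.
Proof.
move=> q0 sq hx; rewrite hatPhi_FT // -[in X in FT (X ^ 2)](squarefree_prod_primes q0 sq).
apply: FT_bad_all => //; first exact: primes_uniq.
by apply/allP => p; rewrite mem_primes => /and3P[].
Qed.

(** For an infinite support the list is empty by convention, so the statement holds in either
    case. *)
Lemma finite_support_sub (T : Type) (J : choiceType) (i : T) (P : set J) (F : J -> T) x :
  x \in finite_support i P F -> P x.
Proof.
have [fin|inf] := pselect (finite_set (P `&` F @^-1` [set~ i])).
  by rewrite in_finite_support // inE => -[].
by rewrite no_finite_support.
Qed.

Lemma orbit_eqv x y : sl2_orbit x y -> eqv x y.
Proof. by move=> [g dg <-]; exists g. Qed.

Lemma eqv_orbit x y : eqv x y -> sl2_orbit x = sl2_orbit y.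
Proof.
move=> e; apply/seteqP; split=> z /orbit_eqv h.
  by have [g dg ->] := eqv_trans (eqv_sym e) h; exists g.
by have [g dg ->] := eqv_trans e h; exists g.
Qed.

Lemma orbitsP (R : realType) q s (mu : R) O : orbits q s mu O ->
  let x := xget (CubicForm 0 0 0 0) O in
  [/\ O = sl2_orbit x, hatV x, form_disc x != 0 & `|form_disc x|%:~R / q%:R ^+ 8 = mu].
Proof.
move=> [x0 [hx0 D0 Dmu] <-] x.
have /orbit_eqv e : sl2_orbit x0 x.
  rewrite /x; case: xgetP => [y -> //|/(_ x0)]; case.
  by exists 1%:M; rewrite ?form_act1 // /SL2Z /= det1.
split.
- exact: eqv_orbit.
- by have [g _ ->] := e; apply: hatV_act.
- rewrite (eqv_disc e); apply: contraTneq D0 => ->; by rewrite mulr0 ltxx.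
- by rewrite (eqv_disc e).
Qed.

Lemma sum_abs_b_le (R : realType) (q : nat) (s : bool) (X B : R) : (0 < q)%N ->
  (forall p, prime p -> ~ (p ^ 2 %| q)%N) ->
  class_bound (fun x => \prod_(p <- primes q) weight R p x) (q%:R ^+ 8 * X) B ->
  sum_abs_b q s X <= B.
Proof.
move=> q0 sq cb; rewrite /sum_abs_b.
set A := (X in finite_support _ X _); set F := (X in finite_support _ _ X).
set l := finite_support 0 A F; have ul : uniq l by exact: finite_support_uniq.
have hl mu : mu \in l -> mu < X by move=> ml; have [_] : A mu by exact: finite_support_sub ml.
pose rep (O : set (cubic_form int)) := xget (CubicForm 0 0 0 0) O.
pose G (O : set (cubic_form int)) : R[i] :=
  hatPhi R q (rep O) / #|` fset_set (sl2_stab (rep O))|%fset%:R.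
pose lO (mu : R) : seq (set (cubic_form int)) := finite_support 0 (orbits q s mu) G.
have hO mu O : O \in lO mu -> orbits q s mu O by exact: finite_support_sub.
apply: le_trans (_ : \sum_(mu <- l) \sum_(O <- lO mu) \prod_(p <- primes q) weight R p (rep O) <= _).
  rewrite big_seq [X in _ <= X]big_seq; apply: ler_sum => mu mul.
  rewrite /F /b_; apply: le_trans (normc_sum _ _) _.
  rewrite -/(lO mu) big_seq [X in _ <= X]big_seq; apply: ler_sum => O /hO/orbitsP[_ hx _ _].
  rewrite Normc.normcM Normc.normcV normc_nat.
  apply: le_trans (hatPhi_weight R q0 sq hx).
  rewrite -[X in _ <= X]mulr1; apply: ler_wpM2l; first exact: normc_ge0.
  (* The cardinal 0, given by convention to an infinite stabilizer, also passes because its inverse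
     is 0. *)
  by case: #|` _|%fset => [|n]; rewrite ?invr0 // invf_le1 // ler1n.
have <- : \sum_(x <- [seq rep o | mu <- l, o <- lO mu]) \prod_(p <- primes q) weight R p x =
    \sum_(mu <- l) \sum_(O <- lO mu) \prod_(p <- primes q) weight R p (rep O).
  exact: big_allpairs_dep.
have q8 : 0 < q%:R ^+ 8 :> R by rewrite exprn_gt0 // ltr0n.
(* The discriminant determines mu, so representatives for different mu are inequivalent and the
   double sum is a single sum over inequivalent forms. *)
have key mu mu' O O' : O \in lO mu -> O' \in lO mu' -> eqv (rep O) (rep O') -> mu = mu' /\ O = O'.
  move=> /hO/orbitsP[eO _ _ em] /hO/orbitsP[eO' _ _ em'] e; split.
    by rewrite -em -em' -!/(rep _) (eqv_disc e).
  by rewrite eO eO'; apply: eqv_orbit.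
apply: cb.
  split.
    apply: allpairs_uniq_dep => //; first by move=> mu _; exact: finite_support_uniq.
    move=> _ _ /allpairsPdep[mu [u [_ hmo ->]]] /allpairsPdep[mu' [u' [_ hmo' ->]]] /= e.
    have [|em eO] := key _ _ _ _ hmo hmo'; first by rewrite e; exact: eqv_refl.
    by rewrite em eO.
  move=> _ _ /allpairsPdep[mu [u [_ hmo ->]]] /allpairsPdep[mu' [u' [_ hmo' ->]]] e.
  by have [_ ->] := key _ _ _ _ hmo hmo' e.
move=> _ /allpairsPdep[mu [u [mul /hO/orbitsP[_ _ D0 em] ->]]]; split=> //.
rewrite -intr_norm mulrC -ler_pdivrMr // em; exact: ltW (hl _ mul).
Qed.

(** A prime p >= N satisfies p^eps >= K and pays for its own factor; there are at most N primes
    below N, whence the constant K^N. *)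
Lemma omega_powR (R : realType) (K eps : R) : 1 <= K -> 0 < eps ->
  exists2 C : R, 0 <= C & forall L, uniq L -> all prime L ->
    K ^+ size L <= C * (\prod_(p <- L) p)%N%:R `^ eps.
Proof.
move=> K1 e0; have K0 : 0 <= K by lra.
pose N := (Num.truncn (K `^ eps^-1)).+1.
have hN : K `^ eps^-1 < N%:R by rewrite truncnS_gt // num_real.
have big_p (p : nat) : (N <= p)%N -> K <= p%:R `^ eps.
  move=> Np; rewrite -{1}[K]powRr1 // -[in X in X <= _](mulVf (lt0r_neq0 e0)) powRrM.
  apply: ge0_ler_powR; rewrite ?nnegrE ?powR_ge0 ?(ltW e0) //.
  by apply: le_trans (ltW hN) _; rewrite ler_nat.
exists (K ^+ N); first exact: exprn_ge0.
have step L : all prime L -> K ^+ size L <= K ^+ count (fun p => p < N)%N L * (\prod_(p <- L) p)%N%:R `^ eps.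
  elim: L => [_|p L IH /= /andP[pp pL]]; first by rewrite big_nil powR1 mulr1.
  rewrite big_cons natrM powRM // exprS exprD mulrACA; apply: ler_pM => //.
  - exact: exprn_ge0.
  - have [pN|Np] := ltnP p N; last by rewrite mul1r big_p.
    have p1 : 1 <= p%:R :> R by rewrite ler1n prime_gt0.
    have := ler_powR p1 (ltW e0); rewrite powRr0 => p1e.
    by rewrite expr1 ler_peMr.
  - exact: IH.
move=> L uL pL; apply: le_trans (step L pL) _; apply: ler_wpM2r; first exact: powR_ge0.
apply: ler_weXn2l => //; rewrite -size_filter -[N in (_ <= N)%N](size_iota 0).
apply: uniq_leq_size; first exact: filter_uniq.
by move=> p; rewrite mem_filter mem_iota add0n => /andP[].
Qed.

Theorem theorem4p1 (R : realType) (s : bool) (eps : R) (heps : 0 < eps) :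
  (exists C : R, forall (q : nat) (X : R), (0 < q)%N ->
     (forall p : nat, prime p -> ~ (p ^ 2 %| q)%N) -> 0 < X ->
     sum_abs_b q s X <= C * (q%:R `^ (2%:R + eps) * X)) /\
  (exists C : R, forall (q : nat) (X : R), (0 < q)%N ->
     (forall p : nat, prime p -> ~ (p ^ 2 %| q)%N) -> 0 < X ->
     sum_abs_b q s X <= C * (q%:R `^ (1 + eps) * X + q%:R `^ (- 1 + eps))).
Proof.
have [C C0 hC] : exists2 C : R, 0 <= C & forall L, uniq L -> all prime L ->
    (3 ^+ 7) ^+ size L <= C * (\prod_(p <- L) p)%N%:R `^ eps.
  by apply: omega_powR; rewrite // exprn_ege1 // ler1n.
have bound (bf : R -> R -> R -> R -> R) q X : stable_bound bf ->
    (forall lam m n : R, 1 <= m -> 1 <= n -> m <= lam ^+ 2 -> 0 < lam ->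
       main_bound lam m n <= 3 * bf 1 m n (lam ^+ 4)) ->
    (0 < q)%N -> (forall p : nat, prime p -> ~ (p ^ 2 %| q)%N) -> 0 < X ->
    sum_abs_b q s X <= 15 * 10 ^+ 6 * C * (q%:R `^ eps * bf q%:R 1 1 (q%:R ^+ 8 * X)).
  move=> st hb q0 sq X0; have [bf0 _] := st.
  have Y0 : 0 <= q%:R ^+ 8 * X by rewrite mulr_ge0 ?exprn_ge0 ?(ltW X0).
  have pq : all prime (primes q) by apply/allP => p; rewrite mem_primes => /and3P[].
  have := weight_class_bound st hb (primes_uniq q) pq Y0.
  rewrite squarefree_prod_primes // => cb.
  apply: le_trans (sum_abs_b_le s q0 sq cb) _.
  have := hC _ (primes_uniq q) pq; rewrite squarefree_prod_primes // => h.
  rewrite mulrA; apply: ler_wpM2r; first by apply: bf0; rewrite // ler1n.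
  by rewrite -[X in _ <= X]mulrA; apply: ler_wpM2l h; rewrite mulr_ge0 ?exprn_ge0.
split; exists (15 * 10 ^+ 6 * C) => q X q0 sq X0.
  (* With Q = q and Y = q^8 X the bound is q^8 X / q^6. *)
  apply: le_trans (bound _ q X (@bound1_stable R) (@main_bound_le1 R) q0 sq X0) _.
  have qR : q%:R != 0 :> R by rewrite pnatr_eq0 -lt0n.
  rewrite powRD ?qR ?implybT // powR_mulrn // /bound1.
  rewrite le_eqVlt; apply/orP; left; apply/eqP.
  by move: (q%:R `^ eps) => z; field.
(* Here it is q^8 X / q^7 + 1 / q. *)
apply: le_trans (bound _ q X (@bound2_stable R) _ q0 sq X0) _.
  by move=> lam m n m1 n1 _ l0; apply: main_bound_le2.
have qR : q%:R != 0 :> R by rewrite pnatr_eq0 -lt0n.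
rewrite !powRD ?qR ?implybT // powRr1 // powR_inv1 // /bound2.
rewrite le_eqVlt; apply/orP; left; apply/eqP.
by move: (q%:R `^ eps) => z; field.
Qed.
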